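(* Let $\alpha\in(0,2)$ and let $S_0,S_1,S_2,S_3$ be i.i.d. each with distribution $S_\alpha(1,0,0)$. Let $a\in(0,1)$ and, for $i=1,2,3$, define $$X_i=aS_0+(1-a^\alpha)^{1/\alpha}S_i,$$ and $X=(X_1,X_2,X_3)$. (i) If $\alpha>1/2$, then $X^h$ is a color process for all sufficiently large $h$. (ii) If $\alpha<1/2$, then $X^h$ is not a color process for any sufficiently large $h$ (i.e. there is $h_0$ such that $X^h$ is not a color process for any $h>h_0$).
   Context: $S_\alpha(1,0,0)$ denotes the symmetric $\alpha$-stable distribution on $\mathbb{R}$ with characteristic function $\theta\mapsto e^{-|\theta|^\alpha}$. A $\{0,1\}$-valued process $(Y_i)_{i\in S}$ is a color process (divide and color process) if there are $p\in[0,1]$ and a random partition $\pi$ of $S$ such that $(Y_i)$ has the same law as the process obtained by sampling $\pi$ and then, independently of $\pi$ and independently for different partition elements, assigning all elements of a partition element the value $1$ with probability $p$ and the value $0$ with probability $1-p$. For a random vector $X=(X_i)$ and $h\in\mathbb{R}$, $X^h=(X^h_i)$ with $X^h_i=I(X_i>h)$. *)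

(* Defs.v *)
From HB Require Import structures.
From mathcomp Require Import all_boot all_order all_algebra.
From mathcomp Require Import complex.
From mathcomp Require Import all_classical all_reals all_analysis.

Set Implicit Arguments.
Unset Strict Implicit.
Unset Printing Implicit Defensive.

Import Order.TTheory GRing.Theory Num.Theory.
Import numFieldNormedType.Exports.

Local Open Scope classical_set_scope.
Local Open Scope ring_scope.
Local Open Scope complex_scope.

(* [R[i]] carries no integration theory here, so E[exp(i t x)] is given by its
   real and imaginary parts; both integrands are bounded. *)
Definition charfun (R : realType) (mu : probability R R) (t : R) : R[i] :=
  Rintegral mu setT (fun x : R => cos (t * x)) +i*
  Rintegral mu setT (fun x : R => sin (t * x)).

(* mu is the law S_alpha(1, 0, 0) *)
Definition standard_symmetric_stable (R : realType) (alpha : R)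
    (mu : probability R R) : Prop :=
  forall t : R, charfun mu t = (expR (- (`|t| `^ alpha)))%:C.

Definition mutually_independent (R : realType) (d : measure_display)
    (T : measurableType d) (P : probability T R) (I : finType)
    (X : I -> {RV P >-> R}) : Prop :=
  forall (J : {set I}) (B : I -> set R), (forall i, measurable (B i)) ->
    P (\bigcap_(i in [set` J]) (X i @^-1` B i)) =
    (\prod_(i in J) P (X i @^-1` B i))%E.

Definition random_partition_law (R : realType) (I : finType)
    (q : {set {set I}} -> R) : Prop :=
  [/\ forall pi, 0 <= q pi,
      forall pi, ~~ finset.partition pi [set: I]%SET -> q pi = 0 &
      \sum_(pi : {set {set I}}) q pi = 1].

(* Probability that the divide and color process (i |-> c (block of i in pi))
   equals y, where pi has law q and, independently of pi, c gives i.i.d.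
   Bernoulli(p) colors.  Every subset of I gets a color, but only the colors of
   the blocks of pi are used. *)
Definition divide_and_color_law (R : realType) (I : finType) (p : R)
    (q : {set {set I}} -> R) (y : {ffun I -> bool}) : R :=
  \sum_(pi : {set {set I}}) q pi *
    \sum_(c : {ffun {set I} -> bool} | [ffun i => c (finset.pblock pi i)] == y)
      \prod_(B : {set I}) (if c B then p else 1 - p).

Definition color_process (R : realType) (d : measure_display)
    (T : measurableType d) (P : probability T R) (I : finType)
    (Y : I -> T -> bool) : Prop :=
  exists (p : R) (q : {set {set I}} -> R),
    [/\ 0 <= p <= 1, random_partition_law q &
        forall y : {ffun I -> bool},
          P [set w | forall i, Y i w = y i] =
          (divide_and_color_law p q y)%:E].

Definition threshold (R : realType) (T : Type) (I : Type) (X : I -> T -> R)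
    (h : R) : I -> T -> bool :=
  fun i w => h < X i w.

(* Main.v *)
(* Let u1 = P(X1 > h) and r2 = P(X1, X2 > h >= X3), r1 = P(X1 > h >= X2, X3).
   If X^h is a color process and u1 <= 1/2 then u1 r1 <= (1 - u1) r2; conversely,
   by exchangeability of X^h, this inequality makes the weights of the five
   partitions of {1, 2, 3}, solved for from u1, r1 and r2, nonnegative once h is
   large.  With b = (1 - a^alpha)^(1/alpha), A = a^alpha, B = b^alpha = 1 - A and
   P(S0 > x) ~ c x^(-alpha), one has u1 r1 ~ c^2 B h^(-2 alpha), while
     r2 ~ c^2 (B^2 + A B I(alpha)) h^(-2 alpha),
     I(alpha) = int_0^1 (v^(-1/alpha) - 1)^(-alpha) dv:
   either b S1 and b S2 both exceed h, or a S0 exceeds h and b S3 pulls X3 back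
   below h, v being (a S0 / h)^(-alpha).  Since B = B^2 + A B, the sign of
   I(alpha) - 1 decides; the integrand v (1 - v^(1/alpha))^(-alpha) increases with
   alpha and I(1/2) = int_0^1 v / sqrt (1 - v^2) dv = 1.

   The integral enters only through Riemann sums, compared with v / sqrt (1 - v^2)
   on [1/2, 1] and with v / sqrt (1 - theta v^2) on [0, 1/2], theta = 4 / 2^(1/alpha).
   The upper bound on r2 also needs P(|S0 - x| <= z) = O(z x^(-alpha - 1)), because
   (v^(-1/alpha) - 1)^(-alpha) blows up at v = 1: this is where a S0 is close to h,
   and it follows from the Fejer kernel, whose mean is controlled by the convexity of
   t |-> exp (- t^alpha) on the half-line for alpha <= 1.  Equal
   characteristic functions give equal tails by Weierstrass approximation of
   indicators by trigonometric polynomials. *)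

Require Import Defs.
From mathcomp Require Import all_boot all_order all_algebra.
From mathcomp Require Import all_classical all_reals all_analysis.
From mathcomp Require Import measurable_realfun zify ring lra.

Set Implicit Arguments.
Unset Strict Implicit.
Unset Printing Implicit Defensive.

Import Order.TTheory GRing.Theory Num.Theory.
Import numFieldNormedType.Exports.

Local Open Scope classical_set_scope.
Local Open Scope ring_scope.

(** * Equality in law from characteristic functions *)

(** With u2 = P(X1, X2 > h) and u3 = P(X1, X2, X3 > h), both are c A h^(-alpha) to first order and
    r2 = u2 - u3 is what is left after cancellation, of order h^(-2 alpha). Limits of u2 and u3
    therefore say nothing about r2: its event is enclosed directly, between disjoint boxes inside
    and a finite cover outside, a box being a product event of the four independent variables. No
    exact limit of r2 is needed, only a bound strictly on the right side of c^2 B. The strictness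
    comes from v <= 1/2: theta is the number for which theta v^2 and v^(1/alpha) agree at v = 1/2,
    and it differs from 1 as soon as alpha differs from 1/2. The constant c is never computed. That
    x^alpha P(|S0| > x) converges follows from the means of (1 - cos (t S0)) f(cos (t S0)) divided
    by t^alpha: they converge for polynomials f, and the factor 1 - cos, of mean at most t^alpha,
    carries this over to continuous f. That c > 0 is where alpha < 2 enters. *)

Section weierstrass.
Variable R : realType.

(** Heine's theorem, from compactness as a near-covering property. Only [x] is confined to the
    segment; [y] may lie outside. *)
Lemma unif_continuous_itv (f : R -> R) (a b e : R) : continuous f -> 0 < e ->
  exists2 d : R, 0 < d & forall x y, a <= x <= b -> `|x - y| < d -> `|f x - f y| <= e.
Proof.
move=> cf e0.
have := @segment_compact R a b.
move/compact_near_coveringP => /(_ R 0^'+ (fun d x => forall y, `|x - y| < d ->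
   `|f x - f y| <= e)) nc.
have {nc} : \forall d \near 0^'+, `[a, b] `<=` (fun x => forall y, `|x - y| < d ->
   `|f x - f y| <= e).
  apply: nc => x _.
  have e20 : 0 < e / 2 by rewrite divr_gt0.
  have /cvgrPdist_lt /(_ _ e20) /nbhs_ballP [r /= r0 hr] := cf x.
  exists (ball x (r / 2), [set d | d < r / 2]).
    split => /=; first by apply/nbhs_ballP; exists (r / 2) => //=; rewrite divr_gt0.
    by apply: nbhs_right_lt; rewrite divr_gt0.
  move=> [x' d] /= [hx' hd] y hy.
  have h1 := hr x'; have h2 := hr y.
  rewrite /ball /= in hx' h1 h2.
  have {}h1 : `|f x - f x'| < e / 2 by apply: h1; lra.
  have {}h2 : `|f x - f y| < e / 2.
    apply: h2; have -> : x - y = (x - x') + (x' - y) by ring.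
    apply: le_lt_trans (ler_normD _ _) _; lra.
  have -> : f x' - f y = (f x - f y) - (f x - f x') by ring.
  apply: le_trans (ler_normB _ _) _; lra.
case=> d0 /= d00 hd.
exists (d0 / 2); first by rewrite divr_gt0.
move=> x y xab; apply: (hd (d0 / 2)) => /=.
- by rewrite sub0r normrN gtr0_norm ?divr_gt0 // ltr_pdivrMr // ltr_pMr // ltr1n.
- by rewrite divr_gt0.
- by rewrite in_itv.
Qed.

(* The Bernstein polynomial sum_k binom(n, k) phi(k) X^k (1 - X)^(n - k),
   through Pascal's recursion. *)
Fixpoint bernstein (n : nat) (phi : nat -> R) : {poly R} :=
  if n is n'.+1
  then (1 - 'X) * bernstein n' phi + 'X * bernstein n' (phi \o succn)
  else (phi 0%N)%:P.

Lemma bernsteinS n phi v : (bernstein n.+1 phi).[v] =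
  (1 - v) * (bernstein n phi).[v] + v * (bernstein n (phi \o succn)).[v].
Proof. by rewrite /= !hornerE. Qed.

Lemma ler_bernstein n (phi psi : nat -> R) v : 0 <= v <= 1 ->
  (forall k, (k <= n)%N -> phi k <= psi k) ->
  (bernstein n phi).[v] <= (bernstein n psi).[v].
Proof.
move=> /andP[v0 v1]; elim: n phi psi => [|n IH] phi psi h.
  by rewrite /= !hornerE h.
rewrite !bernsteinS; apply: lerD; apply: ler_wpM2l; rewrite ?subr_ge0 //.
  by apply: IH => k kn; apply: h; rewrite (leq_trans kn).
by apply: IH => k kn; apply: h.
Qed.

Lemma bernsteinD n (phi psi : nat -> R) v :
  (bernstein n (fun k => phi k + psi k)).[v] =
  (bernstein n phi).[v] + (bernstein n psi).[v].
Proof.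
elim: n phi psi => [|n IH] phi psi; first by rewrite /= !hornerE.
by rewrite !bernsteinS !IH; ring.
Qed.

Lemma bernsteinZ n (c : R) (phi : nat -> R) v :
  (bernstein n (fun k => c * phi k)).[v] = c * (bernstein n phi).[v].
Proof.
elim: n phi => [|n IH] phi; first by rewrite /= !hornerE.
by rewrite !bernsteinS !IH; ring.
Qed.

Lemma bernstein_cst n (c : R) v : (bernstein n (fun=> c)).[v] = c.
Proof.
elim: n => [|n IH]; first by rewrite /= !hornerE.
by rewrite bernsteinS !IH; ring.
Qed.

(** Second moment of a shifted binomial variable. The shift [s] makes the induction close: [succn]
    turns it into [s + 1]. *)
Lemma bernstein_sqr n (s : R) v : (bernstein n (fun k => (k%:R + s) ^+ 2)).[v] =
  n%:R * v * (1 - v) + (n%:R * v + s) ^+ 2.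
Proof.
elim: n s => [|n IH] s; first by rewrite /= !hornerE; ring.
rewrite bernsteinS IH.
have -> : (fun k => (k%:R + s) ^+ 2) \o succn = (fun k => (k%:R + (s + 1)) ^+ 2).
  by apply/funext => k /=; rewrite -natr1; ring.
rewrite IH -natr1; ring.
Qed.

(** Bernstein's proof: bounding |f x - f y| by a constant plus a multiple of a square, and averaging
    over binomial weights, leaves only the variance to control. *)
Lemma weierstrass_approx (f : R -> R) (e : R) : continuous f -> 0 < e ->
  exists p : {poly R}, forall x : R, -1 <= x <= 1 -> `|f x - p.[x]| <= e.
Proof.
move=> cf e0.
have e20 : 0 < e / 2 by rewrite divr_gt0.
have [d d0 hd] := unif_continuous_itv (-1) 1 cf e20.
have [M hM] : exists M : R, forall x : R, -1 <= x <= 1 -> `|f x| <= M.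
  have [] := @compact_bounded R R^o (f @` `[-1, 1]).
    apply: continuous_compact; last exact: segment_compact.
    by apply: continuous_subspaceT.
  move=> M [_ hM]; exists (M + 1) => x hx.
  by apply: (hM (M + 1)); [rewrite ltrDl|exists x].
have M0 : 0 <= M by apply: le_trans (hM 0 _); rewrite ?normr_ge0 //; lra.
(* At distance at least [d] the quadratic term [C * ((x - y) / 2) ^+ 2] is at least [2 * M]. The
   halving matches the passage from [-1, 1] to [0, 1]. *)
pose C := 2 * M / (d / 2) ^+ 2.
have C0 : 0 <= C by rewrite /C divr_ge0 ?sqr_ge0 ?mulr_ge0.
have fC (x y : R) : -1 <= x <= 1 -> -1 <= y <= 1 ->
    `|f x - f y| <= e / 2 + C * ((x - y) / 2) ^+ 2.
  move=> hx hy; have [xyd|xyd] := ltP `|x - y| d.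
    by apply: le_trans (hd _ _ hx xyd) _; rewrite lerDl mulr_ge0 ?sqr_ge0.
  apply: le_trans (ler_normB _ _) _.
  have h1 : 2 * M <= C * ((x - y) / 2) ^+ 2.
    rewrite /C -mulrA ler_peMr ?mulr_ge0 // mulrC ler_pdivlMr ?exprn_gt0 ?divr_gt0 // mul1r.
    rewrite -[leRHS]ger0_norm ?sqr_ge0 // normrX lerXn2r ?nnegrE ?divr_ge0 ?normr_ge0 ?(ltW d0) //.
    by rewrite normrM (gtr0_norm (_ : 0 < 2^-1)) ?invr_gt0 // ler_pM2r ?invr_gt0.
  have := hM x hx; have := hM y hy; lra.
(* [C] times the variance v (1 - v) / n has to stay below e / 2. *)
pose n := (Num.truncn (C / (e / 2))).+1.
have n0 : 0 < n%:R :> R by rewrite ltr0n.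
have hn : C / n%:R <= e / 2.
  rewrite ler_pdivrMr // mulrC -ler_pdivrMr //; apply/ltW.
  by apply: truncnS_gt.
pose phi k := f (2 * (k%:R / n%:R) - 1).
exists (bernstein n phi \Po ('X * (2^-1)%:P + (2^-1)%:P)) => x hx.
rewrite horner_comp.
set v := _.[x]; have hv : v = (1 + x) / 2 by rewrite /v !hornerE; field.
have v01 : 0 <= v <= 1 by rewrite hv; lra.
have hk k : (k <= n)%N -> `|f x - phi k| <= e / 2 + C * (n%:R ^- 2) * (k%:R + (- (n%:R * v))) ^+ 2.
  move=> kn; have /andP[k0 k1] : 0 <= (k%:R / n%:R : R) <= 1.
    by rewrite divr_ge0 //= ?ler0n // ler_pdivrMr // mul1r ler_nat.
  apply: le_trans (fC _ _ hx _) _; first by lra.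
  rewrite lerD2l -mulrA ler_wpM2l // hv le_eqVlt; apply/orP; left; apply/eqP.
  by field; rewrite pnatr_eq0.
have sq : (bernstein n (fun k => e / 2 + C * (n%:R ^- 2) * (k%:R + (- (n%:R * v))) ^+ 2)).[v] <= e.
  rewrite bernsteinD bernstein_cst bernsteinZ bernstein_sqr addrN expr0n /= addr0.
  have -> : C * n%:R ^- 2 * (n%:R * v * (1 - v)) = (C / n%:R) * (v * (1 - v)).
    by field; rewrite pnatr_eq0.
  have h0 : 0 <= C / n%:R by rewrite divr_ge0.
  have hvv : v * (1 - v) <= 1 by nra.
  have := ler_wpM2l h0 hvv; lra.
rewrite ler_norml; apply/andP; split.
  rewrite lerBrDr; rewrite addrC.
  rewrite lerBlDr.
  have := ler_bernstein v01 (phi := phi) (psi := fun k => f x + (e / 2 + C * (n%:R ^- 2) * (k%:R + (- (n%:R * v))) ^+ 2)).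
  move=> /(_ n) h; apply: le_trans (h _) _.
    by move=> k /hk; rewrite ler_norml => /andP[? _]; lra.
  by rewrite bernsteinD bernstein_cst lerD2l.
have := ler_bernstein v01 (psi := fun k => phi k + (e / 2 + C * (n%:R ^- 2) * (k%:R + (- (n%:R * v))) ^+ 2)) (phi := fun=> f x).
move=> /(_ n) h.
have {}h : f x <= (bernstein n phi).[v] + e.
  rewrite -(bernstein_cst n (f x) v); apply: le_trans (h _) _.
    by move=> k /hk; rewrite ler_norml => /andP[_ ?]; lra.
  by rewrite bernsteinD lerD2l.
by rewrite lerBlDr addrC.
Qed.

End weierstrass.

(** * Means of bounded variables and real-valued probabilities *)

Section bounded_mean.
Context d (T : measurableType d) (R : realType) (P : probability T R).
Implicit Types (f g : T -> R) (A B : set T).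

Definition bounded_measurable f : Prop :=
  measurable_fun setT f /\ exists M : R, forall w, `|f w| <= M.

Definition mean f : R := \int[P]_w f w.
Definition pr A : R := fine (P A).

Lemma bm_integrable f : bounded_measurable f -> P.-integrable setT (EFin \o f).
Proof.
move=> [mf [M hM]]; apply: measurable_bounded_integrable => //.
  by apply: le_lt_trans (ltry 1); exact: probability_le1.
exists M; split; first exact: num_real.
by move=> y My x _; apply: le_trans (hM x) (ltW My).
Qed.

Lemma bm_cst (c : R) : bounded_measurable (fun=> c).
Proof. by split; [exact: measurable_cst|exists `|c|]. Qed.

Lemma bmD f g : bounded_measurable f -> bounded_measurable g ->
  bounded_measurable (fun w => f w + g w).
Proof.
move=> [mf [M hM]] [mg [N hN]]; split; first exact: measurable_funD.
by exists (M + N) => w; rewrite (le_trans (ler_normD _ _)) // lerD.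
Qed.

Lemma bmM f g : bounded_measurable f -> bounded_measurable g ->
  bounded_measurable (fun w => f w * g w).
Proof.
move=> [mf [M hM]] [mg [N hN]]; split; first exact: measurable_funM.
by exists (M * N) => w; rewrite normrM ler_pM.
Qed.

Lemma bmZ (c : R) f : bounded_measurable f -> bounded_measurable (fun w => c * f w).
Proof. by move=> hf; apply: bmM => //; exact: bm_cst. Qed.

Lemma bmN f : bounded_measurable f -> bounded_measurable (fun w => - f w).
Proof.
move=> hf; have := bmZ (-1) hf.
by under eq_fun do rewrite mulN1r.
Qed.

Lemma bmB f g : bounded_measurable f -> bounded_measurable g ->
  bounded_measurable (fun w => f w - g w).
Proof. by move=> hf hg; apply: bmD => //; exact: bmN. Qed.

Lemma bm_sum (I : Type) (s : seq I) (F : I -> T -> R) :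
  (forall i, bounded_measurable (F i)) ->
  bounded_measurable (fun w => \sum_(i <- s) F i w).
Proof.
move=> h; elim: s => [|i s IH].
  by under eq_fun do rewrite big_nil; exact: bm_cst.
by under eq_fun do rewrite big_cons; exact: bmD.
Qed.

Lemma bm_comp (g : R -> R) (V : T -> R) (M : R) : continuous g ->
  (forall x, `|g x| <= M) -> measurable_fun setT V ->
  bounded_measurable (fun w => g (V w)).
Proof.
move=> cg hM mV; split; last by exists M => w.
by apply: (measurableT_comp _ mV); exact: continuous_measurable_fun.
Qed.

Lemma bm_indic A : measurable A -> bounded_measurable (\1_A : T -> R).
Proof.
move=> mA; split; first exact: measurable_indic.
by exists 1 => w; rewrite indicE; case: (_ \in _); rewrite ?normr1 ?normr0.
Qed.

Lemma mean_cst (c : R) : mean (fun=> c) = c.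
Proof. rewrite /mean Rintegral_cst //.
by rewrite [X in fine X](_ : _ = 1%E) ?mulr1 //; exact: probability_setT. Qed.

Lemma meanD f g : bounded_measurable f -> bounded_measurable g ->
  mean (fun w => f w + g w) = mean f + mean g.
Proof. by move=> hf hg; apply: RintegralD => //; exact: bm_integrable. Qed.

Lemma meanZ (c : R) f : bounded_measurable f ->
  mean (fun w => c * f w) = c * mean f.
Proof. by move=> hf; apply: RintegralZl => //; exact: bm_integrable. Qed.

Lemma meanB f g : bounded_measurable f -> bounded_measurable g ->
  mean (fun w => f w - g w) = mean f - mean g.
Proof. by move=> hf hg; apply: RintegralB => //; exact: bm_integrable. Qed.

Lemma mean_sum (I : Type) (s : seq I) (F : I -> T -> R) :
  (forall i, bounded_measurable (F i)) ->
  mean (fun w => \sum_(i <- s) F i w) = \sum_(i <- s) mean (F i).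
Proof.
move=> h; elim: s => [|i s IH].
  by under eq_fun do rewrite big_nil; rewrite mean_cst big_nil.
under eq_fun do rewrite big_cons.
by rewrite meanD ?IH ?big_cons //; exact: bm_sum.
Qed.

Lemma ler_mean f g : bounded_measurable f -> bounded_measurable g ->
  (forall w, f w <= g w) -> mean f <= mean g.
Proof. by move=> hf hg fg; apply: le_Rintegral => //; exact: bm_integrable. Qed.

Lemma mean_dist f g (e : R) : bounded_measurable f -> bounded_measurable g ->
  (forall w, `|f w - g w| <= e) -> `|mean f - mean g| <= e.
Proof.
move=> hf hg h; rewrite -meanB // ler_norml; apply/andP; split.
  rewrite -(mean_cst (- e)); apply: ler_mean; [exact: bm_cst|exact: bmB|].
  by move=> w; have := h w; rewrite ler_norml => /andP[].
rewrite -[leRHS](mean_cst e); apply: ler_mean; [exact: bmB|exact: bm_cst|].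
by move=> w; have := h w; rewrite ler_norml => /andP[].
Qed.

Lemma mean_indic A : measurable A -> mean (\1_A) = pr A.
Proof. by move=> mA; rewrite /mean /Rintegral integral_indic // setIT. Qed.

Lemma pr_fin A : measurable A -> P A = (pr A)%:E.
Proof. by move=> mA; rewrite /pr fineK // fin_num_measure. Qed.

Lemma pr_ge0 A : 0 <= pr A. Proof. by rewrite /pr fine_ge0. Qed.

Lemma pr_le1 A : measurable A -> pr A <= 1.
Proof. by move=> mA; rewrite -lee_fin -pr_fin // probability_le1. Qed.

Lemma le_pr A B : measurable A -> measurable B -> A `<=` B -> pr A <= pr B.
Proof. by move=> mA mB AB; rewrite -lee_fin -!pr_fin // le_measure // inE. Qed.

Lemma prU_le A B : measurable A -> measurable B -> pr (A `|` B) <= pr A + pr B.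
Proof.
move=> mA mB; rewrite -lee_fin EFinD -!pr_fin //; last exact: measurableU.
exact: measureU2.
Qed.

Lemma prU A B : measurable A -> measurable B -> A `&` B = set0 ->
  pr (A `|` B) = pr A + pr B.
Proof.
move=> mA mB AB; apply: EFin_inj; rewrite EFinD -!pr_fin //; last exact: measurableU.
exact: measureU.
Qed.

Lemma prC A : measurable A -> pr (~` A) = 1 - pr A.
Proof.
move=> mA; apply: EFin_inj; rewrite EFinB -!pr_fin //; last exact: measurableC.
by rewrite probability_setC.
Qed.

Lemma prT : pr setT = 1. Proof. by rewrite /pr [X in fine X](_ : _ = 1%E) //; exact: probability_setT. Qed.

Lemma markov_mean A f (c : R) : measurable A -> bounded_measurable f ->
  (forall w, 0 <= f w) -> (forall w, A w -> c <= f w) -> c * pr A <= mean f.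
Proof.
move=> mA hf f0 hc; rewrite -mean_indic // -meanZ; last exact: bm_indic.
apply: ler_mean => //; first by apply: bmZ; exact: bm_indic.
move=> w; rewrite indicE; have [/set_mem/hc|_] := boolP (w \in A).
  by rewrite mulr1.
by rewrite mulr0.
Qed.

Lemma mean_le_pr A f : measurable A -> bounded_measurable f ->
  (forall w, f w <= 1) -> (forall w, ~ A w -> f w <= 0) -> mean f <= pr A.
Proof.
move=> mA hf f1 hc; rewrite -mean_indic //; apply: ler_mean => //; first exact: bm_indic.
move=> w; rewrite indicE; have [_|] := boolP (w \in A); first exact: f1.
by rewrite notin_setE => /hc.
Qed.

End bounded_mean.

(** * Trigonometric moments *)

Section trigonometric_moments.
Context d (T : measurableType d) (R : realType) (P : probability T R).
Implicit Types (V : T -> R) (r : {poly R}).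
Local Notation mean := (mean P).

Lemma cos_norm_le1 (x : R) : `|cos x| <= 1.
Proof. by rewrite ler_norml cos_geN1 cos_le1. Qed.

Lemma sin_norm_le1 (x : R) : `|sin x| <= 1.
Proof. by rewrite ler_norml sin_geN1 sin_le1. Qed.

Lemma bm_cos V (s : R) : measurable_fun setT V ->
  bounded_measurable (fun w => cos (s * V w)).
Proof.
move=> mV; apply: (@bm_comp _ _ _ (fun x => cos x) (fun w => s * V w) 1).
- exact: continuous_cos.
- exact: cos_norm_le1.
- exact: measurable_funM.
Qed.

Lemma bm_sin V (s : R) : measurable_fun setT V ->
  bounded_measurable (fun w => sin (s * V w)).
Proof.
move=> mV; apply: (@bm_comp _ _ _ (fun x => sin x) (fun w => s * V w) 1).
- exact: continuous_sin.
- exact: sin_norm_le1.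
- exact: measurable_funM.
Qed.

Lemma bm_comp_cos (g : R -> R) V (s : R) : continuous g ->
  measurable_fun setT V -> bounded_measurable (fun w => g (cos (s * V w))).
Proof.
move=> cg mV; have [M hM] : exists M : R, forall x, -1 <= x <= 1 -> `|g x| <= M.
  have [] := @compact_bounded R R^o (g @` `[-1, 1]).
    apply: continuous_compact; last exact: segment_compact.
    by apply: continuous_subspaceT.
  move=> M [_ hM]; exists (M + 1) => x hx.
  by apply: (hM (M + 1)); [rewrite ltrDl|exists x].
apply: (@bm_comp _ _ _ (fun x => g (cos x)) (fun w => s * V w) M).
- by move=> x; apply: continuous_comp; [exact: continuous_cos|exact: cg].
- by move=> x; apply: hM; rewrite cos_geN1 cos_le1.
- exact: measurable_funM.
Qed.

Lemma bm_poly_cos r V (t : R) : measurable_fun setT V ->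
  bounded_measurable (fun w => r.[cos (t * V w)]).
Proof.
move=> mV; apply: (@bm_comp_cos (fun x => r.[x])) => //.
exact: continuous_horner.
Qed.

(** The product-to-sum formula: a factor cos (t V) shifts the frequency [s] by [t] in both
    directions. By induction on the polynomial, these means are determined by those of cos (s V)
    alone, provided that [s] is left free. *)
Lemma mean_polyMXaddC_cos r (c : R) V (t s : R) : measurable_fun setT V ->
  mean (fun w => (r * 'X + c%:P).[cos (t * V w)] * cos (s * V w)) =
  2^-1 * (mean (fun w => r.[cos (t * V w)] * cos ((s + t) * V w)) +
          mean (fun w => r.[cos (t * V w)] * cos ((s - t) * V w))) +
  c * mean (fun w => cos (s * V w)).
Proof.
move=> mV.
have h0 s' : bounded_measurable (fun w => r.[cos (t * V w)] * cos (s' * V w)).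
  by apply: bmM; [exact: bm_poly_cos|exact: bm_cos].
have h1 := bm_cos s mV.
have h2 := bmD (h0 (s + t)) (h0 (s - t)).
rewrite -(meanD P (h0 _) (h0 _)) -(meanZ P _ h2) -(meanZ P _ h1).
rewrite -(meanD P (bmZ _ h2) (bmZ _ h1)).
congr (mean _); apply/funext => w; rewrite hornerMXaddC (mulrDl s t) (mulrBl _ s t) cosD cosB.
move: (cos (t * V w)) (cos (s * V w)) (sin (s * V w)) (sin (t * V w)) => x u v z.
by move: r.[x] => y; field.
Qed.

Lemma mean_polyMXaddC_sin r (c : R) V (t s : R) : measurable_fun setT V ->
  mean (fun w => (r * 'X + c%:P).[cos (t * V w)] * sin (s * V w)) =
  2^-1 * (mean (fun w => r.[cos (t * V w)] * sin ((s + t) * V w)) +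
          mean (fun w => r.[cos (t * V w)] * sin ((s - t) * V w))) +
  c * mean (fun w => sin (s * V w)).
Proof.
move=> mV.
have h0 s' : bounded_measurable (fun w => r.[cos (t * V w)] * sin (s' * V w)).
  by apply: bmM; [exact: bm_poly_cos|exact: bm_sin].
have h1 := bm_sin s mV.
have h2 := bmD (h0 (s + t)) (h0 (s - t)).
rewrite -(meanD P (h0 _) (h0 _)) -(meanZ P _ h2) -(meanZ P _ h1).
rewrite -(meanD P (bmZ _ h2) (bmZ _ h1)).
congr (mean _); apply/funext => w; rewrite hornerMXaddC (mulrDl s t) (mulrBl _ s t) sinD sinB.
move: (cos (t * V w)) (cos (s * V w)) (sin (s * V w)) (sin (t * V w)) => x u v z.
by move: r.[x] => y; field.
Qed.

End trigonometric_moments.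

Lemma continuous_max_cst (R : realType) (c : R) (g : R -> R) :
  continuous g -> continuous (fun u => Num.max c (g u)).
Proof.
move=> cg u; apply: (@continuous_max _ R (cst c) g u); last exact: cg.
exact: cst_continuous.
Qed.

(** * Equal characteristic functions give equal tails *)

Section equality_in_law.
Context d (T : measurableType d) (R : realType) (P : probability T R).
Implicit Types (V W : T -> R).
Local Notation mean := (mean P).
Local Notation pr := (pr P).

(** Dominated convergence. Pointwise convergence is asked as eventual equality, because every
    approximation of an indicator used below becomes exact at each point. *)
Lemma mean_cvg_indic (f : nat -> T -> R) (A : set T) : measurable A ->
  (forall n, bounded_measurable (f n)) -> (forall n w, `|f n w| <= 1) ->
  (forall w, \forall n \near \oo, f n w = \1_A w) ->
  mean (f n) @[n --> \oo] --> pr A.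
Proof.
move=> mA bf f1 fA; rewrite -mean_indic //.
have mf n : measurable_fun setT (EFin \o f n) by apply/measurable_EFinP; exact: (bf n).1.
have mi : measurable_fun setT (EFin \o (\1_A : T -> R)).
  by apply/measurable_EFinP; exact: measurable_indic.
have [||_ _ h] := dominated_convergence measurableT mf mi _ (bm_integrable P (bm_cst T 1)).
- apply: aeW => w _; apply: cvg_near_cst.
  by have := fA w; apply: filterS => n /= ->.
- by apply: aeW => w n _; rewrite lee_fin.
apply: fine_cvg; rewrite /mean /Rintegral fineK //.
by apply: integrable_fin_num => //; apply: bm_integrable; exact: bm_indic.
Qed.

Definition same_trig V W : Prop :=
  [/\ measurable_fun setT V, measurable_fun setT W,
      forall t : R, mean (fun w => cos (t * V w)) = mean (fun w => cos (t * W w)) &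
      forall t : R, mean (fun w => sin (t * V w)) = mean (fun w => sin (t * W w))].

Lemma same_trig_shift V W (x : R) : same_trig V W ->
  same_trig (fun w => V w - x) (fun w => W w - x).
Proof.
move=> [mV mW hc hs].
have mB (U : T -> R) : measurable_fun setT U -> measurable_fun setT (fun w => U w - x).
  by move=> mU; apply: measurable_funB.
have expand (U : T -> R) : measurable_fun setT U -> forall t : R,
    mean (fun w => cos (t * (U w - x))) =
      cos (t * x) * mean (fun w => cos (t * U w)) + sin (t * x) * mean (fun w => sin (t * U w)) /\
    mean (fun w => sin (t * (U w - x))) =
      cos (t * x) * mean (fun w => sin (t * U w)) + - sin (t * x) * mean (fun w => cos (t * U w)).
  move=> mU t; have hc' := bm_cos t mU; have hs' := bm_sin t mU.
  rewrite -!(meanZ P _ hc') -!(meanZ P _ hs') -(meanD P (bmZ _ hc') (bmZ _ hs')).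
  rewrite -(meanD P (bmZ _ hs') (bmZ _ hc')).
  by split; congr (fun f => mean f); apply/funext => w; rewrite mulrBr ?cosB ?sinB; ring.
split; [exact: mB|exact: mB| |] => t.
  by rewrite (expand V mV t).1 (expand W mW t).1 hc hs.
by rewrite (expand V mV t).2 (expand W mW t).2 hc hs.
Qed.

Lemma same_trig_poly V W (r : {poly R}) (t s : R) : same_trig V W ->
  mean (fun w => r.[cos (t * V w)] * cos (s * V w)) =
    mean (fun w => r.[cos (t * W w)] * cos (s * W w)) /\
  mean (fun w => r.[cos (t * V w)] * sin (s * V w)) =
    mean (fun w => r.[cos (t * W w)] * sin (s * W w)).
Proof.
move=> [mV mW hc hs]; elim/poly_ind: r s => [|r c IH] s.
  by split; apply: eq_Rintegral => w _; rewrite !horner0 !mul0r.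
split.
  by rewrite !mean_polyMXaddC_cos // hc !(IH _).1.
by rewrite !mean_polyMXaddC_sin // hs !(IH _).2.
Qed.

(** Polynomial approximation of [f] and [g] reduces this to [same_trig_poly]. The sine term reaches
    functions of the angle that are not even. *)
Lemma same_trig_cont V W (f g : R -> R) (t : R) : same_trig V W ->
  continuous f -> continuous g ->
  mean (fun w => f (cos (t * V w)) + g (cos (t * V w)) * sin (t * V w)) =
  mean (fun w => f (cos (t * W w)) + g (cos (t * W w)) * sin (t * W w)).
Proof.
move=> hVW cf cg; have [mV mW _ _] := hVW.
apply/eqP; rewrite -subr_eq0 -normr_le0; apply/ler_addgt0Pl => e e0; rewrite addr0.
have e40 : 0 < e / 4 by rewrite divr_gt0.
have [p hp] := weierstrass_approx cf e40.
have [q hq] := weierstrass_approx cg e40.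
have bmf (U : T -> R) (mU : measurable_fun setT U) :
    bounded_measurable (fun w => f (cos (t * U w)) + g (cos (t * U w)) * sin (t * U w)).
  by apply: bmD; [exact: bm_comp_cos|apply: bmM; [exact: bm_comp_cos|exact: bm_sin]].
(* The factor [cos (0 * U w)], equal to 1, gives the polynomial term the shape treated by
   [same_trig_poly]. *)
have bmp (U : T -> R) (mU : measurable_fun setT U) :
    bounded_measurable (fun w => p.[cos (t * U w)] * cos (0 * U w)).
  by apply: bmM; [exact: bm_poly_cos|exact: bm_cos].
have bmq (U : T -> R) (mU : measurable_fun setT U) :
    bounded_measurable (fun w => q.[cos (t * U w)] * sin (t * U w)).
  by apply: bmM; [exact: bm_poly_cos|exact: bm_sin].
have close (U : T -> R) (mU : measurable_fun setT U) :
    `|mean (fun w => f (cos (t * U w)) + g (cos (t * U w)) * sin (t * U w)) -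
      (mean (fun w => p.[cos (t * U w)] * cos (0 * U w)) +
       mean (fun w => q.[cos (t * U w)] * sin (t * U w)))| <= e / 2.
  rewrite -(meanD P (bmp U mU) (bmq U mU)); apply: mean_dist; [exact: bmf|by apply: bmD; auto|].
  move=> w; rewrite mul0r cos0 mulr1 opprD addrACA -mulrBl.
  have hcos : -1 <= cos (t * U w) <= 1 by rewrite cos_geN1 cos_le1.
  apply: le_trans (ler_normD _ _) _; rewrite normrM.
  rewrite (_ : e / 2 = e / 4 + e / 4 * 1); last by field.
  by rewrite lerD ?hp // ler_pM ?hq ?sin_norm_le1.
have [h1 _] := same_trig_poly p t 0 hVW.
have [_ h2] := same_trig_poly q t t hVW.
have tri (x y z : R) : `|x - z| <= e / 2 -> `|y - z| <= e / 2 -> `|x - y| <= e.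
  by rewrite !ler_norml => /andP[? ?] /andP[? ?]; apply/andP; split; lra.
by apply: tri (close W mW); rewrite -h1 -h2; exact: close.
Qed.

(** For a sine s, the indicator of 0 < s is the limit of (|s| + s) / (2 max(1 / (n + 1), |s|)), and
    |s| is the square root of 1 - cos^2: this has the form handled by [same_trig_cont]. *)
Lemma same_trig_sin_gt0 V W (t : R) : same_trig V W ->
  pr [set w | 0 < sin (t * V w)] = pr [set w | 0 < sin (t * W w)].
Proof.
move=> hVW; have [mV mW _ _] := hVW.
pose g (n : nat) (u : R) := (2 * Num.max (n.+1%:R^-1) (Num.sqrt (1 - u ^+ 2)))^-1.
pose f n u := g n u * Num.sqrt (1 - u ^+ 2).
have max0 (n : nat) (s : R) : 0 < Num.max (n.+1%:R^-1 : R) s.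
  by rewrite lt_max invr_gt0 ltr0n.
have csq : continuous (fun u : R => Num.sqrt (1 - u ^+ 2)).
  move=> u; apply: (@continuous_comp _ _ _ (fun u : R => 1 - u ^+ 2) Num.sqrt); last exact: sqrt_continuous.
  by apply: cvgB; [exact: cvg_cst|exact: exprn_continuous].
have cg n : continuous (g n).
  move=> u; apply: cvgV; first by rewrite mulf_neq0 // gt_eqF.
  apply: cvgM; first exact: cvg_cst.
  exact: (continuous_max_cst csq).
have cf n : continuous (f n) by move=> u; apply: cvgM; [exact: cg|exact: csq].
pose h n (U : T -> R) w := f n (cos (t * U w)) + g n (cos (t * U w)) * sin (t * U w) : R.
have hE n U w : h n U w = (`|sin (t * U w)| + sin (t * U w)) /
    (2 * Num.max (n.+1%:R^-1) `|sin (t * U w)|).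
  by rewrite /h /f /g -sin2cos2 sqrtr_sqr -mulrDr mulrC.
have lim (U : T -> R) : measurable_fun setT U ->
    mean (h n U) @[n --> \oo] --> pr [set w | 0 < sin (t * U w)].
  move=> mU; apply: mean_cvg_indic.
  - rewrite (_ : [set _ | _] = (fun w => sin (t * U w)) @^-1` `]0, +oo[%classic).
      by rewrite -[X in measurable X]setTI; apply: (bm_sin t mU).1.
    by apply/seteqP; split => w /=; rewrite in_itv /= andbT.
  - by move=> n; apply: bmD; [exact: bm_comp_cos|apply: bmM; [exact: bm_comp_cos|exact: bm_sin]].
  - move=> n w; rewrite hE; set s := sin _.
    have m0 := max0 n `|s|.
    rewrite ger0_norm; last by rewrite divr_ge0 ?mulr_ge0 ?(ltW m0) //; have := ler_norm (- s); rewrite normrN; lra.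
    rewrite ler_pdivrMr ?mulr_gt0 // mul1r.
    have : `|s| <= Num.max n.+1%:R^-1 `|s| by rewrite le_max lexx orbT.
    have := ler_norm s; lra.
  - move=> w; rewrite /= indicE; have [/set_mem /= s0|] := boolP (w \in _); last first.
      rewrite notin_setE /= => /negP; rewrite -leNgt => s0.
      by apply: nearW => n; rewrite hE ler0_norm // addNr mul0r.
    have := near_infty_natSinv_lt (PosNum s0).
    apply: filterS => n /= hn; rewrite hE gtr0_norm // max_r ?(ltW hn) //.
    by field; rewrite gt_eqF.
have := lim V mV; have -> : (fun n => mean (h n V)) = (fun n => mean (h n W)).
  by apply/funext => n; exact: same_trig_cont.
by move=> /cvg_unique; apply; [exact: norm_hausdorff|exact: lim].
Qed.

(** The sine of V / (n + 1) has the sign of V as soon as |V| / (n + 1) is below pi. *)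
Lemma same_trig_gt0 V W : same_trig V W ->
  pr [set w | 0 < V w] = pr [set w | 0 < W w].
Proof.
move=> hVW; have [mV mW _ _] := hVW.
have mpos (U : T -> R) : measurable_fun setT U -> measurable [set w | 0 < U w].
  move=> mU; rewrite (_ : [set _ | _] = U @^-1` `]0, +oo[%classic).
    by rewrite -[X in measurable X]setTI; exact: mU.
  by apply/seteqP; split => w /=; rewrite in_itv /= andbT.
have msin (U : T -> R) (t : R) : measurable_fun setT U -> measurable [set w | 0 < sin (t * U w)].
  by move=> mU; apply: mpos; exact: (bm_sin t mU).1.
have lim (U : T -> R) : measurable_fun setT U ->
    pr [set w | 0 < sin (n.+1%:R^-1 * U w)] @[n --> \oo] --> pr [set w | 0 < U w].
  move=> mU.
  rewrite (_ : (fun n => _) = (fun n => mean (\1_[set w | 0 < sin (n.+1%:R^-1 * U w)]))); last first.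
    by apply/funext => n; rewrite mean_indic //; exact: msin.
  apply: mean_cvg_indic; first exact: mpos.
  - by move=> n; apply: bm_indic; exact: msin.
  - by move=> n w; rewrite indicE; case: (_ \in _); rewrite ?normr1 ?normr0.
  - move=> w; have p0 : 0 < pi / (`|U w| + 1) by rewrite divr_gt0 ?pi_gt0 // ltr_wpDl.
    have := near_infty_natSinv_lt (PosNum p0).
    apply: filterS => n /= hn; rewrite !indicE; congr ((nat_of_bool _)%:R).
    have n0 : 0 < n.+1%:R^-1 :> R by rewrite invr_gt0 ltr0n.
    have hb : n.+1%:R^-1 * `|U w| < pi.
      have a0 : 0 < `|U w| + 1 by rewrite ltr_wpDl.
      move: hn; rewrite /= ltr_pdivlMr // => hn; apply: le_lt_trans hn.
      by rewrite ler_wpM2l ?(ltW n0) // lerDl.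
    apply/idP/idP => /set_mem /= h; apply/mem_set => /=.
      rewrite ltNge; apply/negP => u0; move: h; apply/negP; rewrite -leNgt.
      rewrite -oppr_ge0 -sinN -mulrN; apply: sin_ge0_pi.
      by rewrite mulr_ge0 ?(ltW n0) ?oppr_ge0 //= -(ler0_norm u0) ltW.
    by apply: sin_gt0_pi; rewrite mulr_gt0 //= -(gtr0_norm h).
have := lim V mV.
have -> : (fun n => pr [set w | 0 < sin (n.+1%:R^-1 * V w)]) =
    (fun n => pr [set w | 0 < sin (n.+1%:R^-1 * W w)]).
  by apply/funext => n; exact: same_trig_sin_gt0.
by move=> /cvg_unique; apply; [exact: norm_hausdorff|exact: lim].
Qed.

Lemma same_trig_gt V W (x : R) : same_trig V W ->
  pr [set w | x < V w] = pr [set w | x < W w].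
Proof.
move=> /(same_trig_shift x) /same_trig_gt0 h0.
rewrite (_ : [set w | x < V w] = [set w | 0 < V w - x]); last first.
  by apply/seteqP; split => w /=; rewrite subr_gt0.
by rewrite h0; congr pr; apply/seteqP; split => w /=; rewrite subr_gt0.
Qed.

End equality_in_law.

(** * Tails of symmetric stable laws *)

Section real_limits.
Variable R : realType.
Implicit Types (x y c e : R).

(** A Cauchy criterion in which each precision has its own approximate limit, for limits that
    polynomial approximation or truncation does not make explicit. *)
Lemma real_cauchy_cvg (U : Type) (F : set_system U) {FF : ProperFilter F}
    (f : U -> R) :
  (forall e, 0 < e -> exists l : R, \forall x \near F, `|f x - l| <= e) ->
  exists l : R, f x @[x --> F] --> l.
Proof.
move=> h; suff /cvg_ex [l hl] : cvg (f x @[x --> F]) by exists l.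
apply/cauchy_cvgP/cauchy_exP => e e0.
have e20 : 0 < e / 2 by rewrite divr_gt0.
have [l hl] := h _ e20; exists l.
have : \forall x \near F, `|l - f x| < e.
  by apply: filterS hl => x; rewrite distrC => /le_lt_trans; apply; lra.
by [].
Qed.

Lemma powR_inv_cvg0 al : 0 < al -> x `^ (- al) @[x --> +oo] --> (0 : R).
Proof.
move=> al0; apply/cvgrPdist_le => e e0.
near=> x; have x0 : 0 < x by near: x; exact: nbhs_pinfty_gt.
rewrite sub0r normrN ger0_norm ?powR_ge0 // powRN invf_ple ?posrE ?powR_gt0 //.
have h : (e^-1) `^ (al^-1) <= x by near: x; apply: nbhs_pinfty_ge; exact: num_real.
have := ge0_ler_powR (ltW al0) _ _ h; rewrite !nnegrE => /(_ (powR_ge0 _ _) (ltW x0)).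
by rewrite -powRrM mulVf ?gt_eqF // powRr1 // invr_ge0 ltW.
Unshelve. all: by end_near. Qed.

Lemma nbhs_pinfty_powR_ge al c : 0 < al -> \forall x \near +oo, c <= x `^ al.
Proof.
move=> al0; near=> x; have x0 : 0 < x by near: x; exact: nbhs_pinfty_gt.
have h : `|c| `^ al^-1 <= x by near: x; apply: nbhs_pinfty_ge; exact: num_real.
apply: le_trans (ler_norm c) _; rewrite -[leLHS]powRr1 // -(mulVf (_ : al != 0)) ?gt_eqF //.
by rewrite powRrM ge0_ler_powR ?nnegrE ?powR_ge0 // ltW.
Unshelve. all: by end_near. Qed.

Lemma expRN_le_quadratic y : 0 <= y -> 1 - y <= expR (- y) <= 1 - y + y ^+ 2.
Proof.
move=> y0; rewrite expR_ge1Dx expRN /=.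
have h := expR_ge1Dx y; have y1 : 0 < 1 + y by lra.
apply: (@le_trans _ _ (1 + y)^-1); first by rewrite lef_pV2 ?posrE ?expR_gt0.
rewrite -div1r ler_pdivrMr // -subr_ge0.
have -> : (1 - y + y ^+ 2) * (1 + y) - 1 = y ^+ 3 by ring.
exact: exprn_ge0.
Qed.

Lemma ler_cos_pi x y : 0 <= x -> x <= y -> y <= pi -> cos y <= cos x.
Proof.
move=> x0; rewrite le_eqVlt => /orP[/eqP -> //|xy] ypi.
by rewrite ltW // ltr_cos // in_itv /=; lra.
Qed.

End real_limits.

(** * Existence of the two-sided tail constant *)

Section stable_tail.
Context d (T : measurableType d) (R : realType) (P : probability T R).
Variables (alpha : R) (V : T -> R).
Local Notation mean := (mean P).
Local Notation pr := (pr P).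
Hypothesis halpha : 0 < alpha < 2.
Hypothesis mV : measurable_fun setT V.
Hypothesis hcos : forall t : R, mean (fun w => cos (t * V w)) = expR (- (`|t| `^ alpha)).

(** Only cosine means are assumed in this section, and they see [V] through |V| alone: hence the
    two-sided tail. *)
Definition tail2 (x : R) : R := pr [set w | x < `|V w|].

Let alpha0 : 0 < alpha. Proof. by case/andP: halpha. Qed.

Let mtail (x : R) : measurable [set w | x < `|V w|].
Proof.
rewrite (_ : [set _ | _] = (fun w => `|V w|) @^-1` `]x, +oo[%classic).
  by rewrite -[X in measurable X]setTI; apply: measurableT_comp.
by apply/seteqP; split => w /=; rewrite in_itv /= andbT.
Qed.

Lemma bm_1Bcos (t : R) : bounded_measurable (fun w => 1 - cos (t * V w)).
Proof. by apply: bmB; [exact: bm_cst|exact: bm_cos]. Qed.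

Lemma mean_1Bcos (t : R) : mean (fun w => 1 - cos (t * V w)) = 1 - expR (- (`|t| `^ alpha)).
Proof. by rewrite (meanB P (bm_cst _ _) (bm_cos _ mV)) mean_cst hcos. Qed.

Lemma mean_1Bcos_le (t : R) : 0 < t -> mean (fun w => 1 - cos (t * V w)) <= t `^ alpha.
Proof.
move=> t0; rewrite mean_1Bcos gtr0_norm //.
have := expR_ge1Dx (- (t `^ alpha)); lra.
Qed.

Lemma cos_norm_mul (t : R) w : 0 <= t -> cos (t * V w) = cos (t * `|V w|).
Proof. by move=> t0; rewrite -cos_norm normrM ger0_norm. Qed.

Lemma tail2_cvg0 (x : R) : 0 < x -> tail2 (2 ^+ n * x) @[n --> \oo] --> (0 : R).
Proof.
move=> x0; rewrite (_ : 0 = pr set0) /tail2; last by rewrite /pr measure0.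
rewrite (_ : (fun n => _) = (fun n => mean (\1_[set w | 2 ^+ n * x < `|V w|]))); last first.
  by apply/funext => n; rewrite mean_indic.
apply: mean_cvg_indic => //.
- by move=> n; exact: bm_indic.
- by move=> n w; rewrite indicE; case: (_ \in _); rewrite ?normr1 ?normr0.
- move=> w; have v0 : 0 < x / (`|V w| + 1) by rewrite divr_gt0 // ltr_wpDl.
  have := near_infty_natSinv_lt (PosNum v0); apply: filterS => n /= hn.
  rewrite !indicE in_set0 (memNset _) //= => hlt.
  have v1 : 0 < `|V w| + 1 by rewrite ltr_wpDl.
  move: hn; rewrite ltr_pdivlMr // mulrC ltr_pdivrMr ?ltr0n // => hn.
  have : n.+1%:R <= 2 ^+ n :> R by rewrite -natrX ler_nat ltn_expl.
  move=> /(ler_wpM2l (ltW x0)); rewrite mulrC in hlt; lra.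
Qed.

Let k1 : R := (1 - cos 1)^-1.
(** The sum of the geometric series k1 2^(-alpha n), which adds up the dyadic steps of
    [tail2_le]. *)
Definition tailC : R := k1 / (1 - 2 `^ (- alpha)).

Let k1_gt0 : 0 < k1.
Proof.
have pi2 := pi_ge2 R.
by rewrite invr_gt0 subr_gt0 -[ltRHS]cos0 ltr_cos ?in_itv /=; lra.
Qed.

Let pow2_lt1 : 2 `^ (- alpha) < 1 :> R.
Proof.
rewrite powRN invf_lt1 ?powR_gt0 //.
have : (1 : R) `^ alpha < 2 `^ alpha by rewrite gt0_ltr_powR ?nnegrE // ltr1n.
by rewrite powR1.
Qed.

Lemma tailC_gt0 : 0 < tailC. Proof. by rewrite divr_gt0 ?subr_gt0. Qed.

(** For y < |V| <= 2 y the angle |V| / y lies between 1 and 2, where 1 - cos is at least 1 - cos 1,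
    while the mean of 1 - cos (V / y) is at most y^(-alpha). So [tail2 y] exceeds [tail2 (2 * y)] by
    at most k1 y^(-alpha), and the dyadic steps are summed down from a tail that vanishes at
    infinity. *)
Lemma tail2_le (x : R) : 0 < x -> tail2 x <= tailC * x `^ (- alpha).
Proof.
have step y : 0 < y -> tail2 y <= tail2 (2 * y) + k1 * y `^ (- alpha).
  move=> y0; rewrite /tail2.
  have sub : [set w | y < `|V w|] `<=`
      [set w | 2 * y < `|V w|] `|` ([set w | y < `|V w|] `\` [set w | 2 * y < `|V w|]).
    by move=> w /= h; have [h2|h2] := ltP (2 * y) `|V w|; [left|right; split => //; apply/negP; rewrite -leNgt].
  have mD : measurable ([set w | y < `|V w|] `\` [set w | 2 * y < `|V w|]) by exact: measurableD.
  apply: le_trans (le_pr _ _ _ sub) _ => //; first exact: measurableU.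
  apply: le_trans (prU_le _ _ _) _ => //; rewrite lerD2l.
  have y'0 : 0 < y^-1 by rewrite invr_gt0.
  have := mean_1Bcos_le y'0; rewrite -powR_inv1 ?(ltW y0) // -powRrM mulN1r => hm.
  have c0 : 0 < 1 - cos 1 :> R by rewrite -invr_gt0.
  rewrite /k1 [leRHS]mulrC ler_pdivlMr // [leLHS]mulrC; apply: le_trans hm.
  apply: (markov_mean P mD (bm_1Bcos _)).
    by move=> w; rewrite subr_ge0 cos_le1.
  move=> w /= [h1 /negP]; rewrite -leNgt => h2.
  rewrite powR_inv1 ?(ltW y0) // lerD2l lerN2 cos_norm_mul ?(ltW y'0) //.
  have [a1 a2] : 1 < y^-1 * `|V w| /\ y^-1 * `|V w| <= 2.
    by rewrite mulrC ltr_pdivlMr // mul1r ler_pdivrMr.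
  have pi2 := pi_ge2 R.
  by rewrite ltW // ltr_cos // in_itv /=; lra.
move=> x0; pose g y := tail2 y - tailC * y `^ (- alpha).
have gstep y : 0 < y -> g y <= g (2 * y).
  move=> y0; rewrite /g powRM ?(ltW y0) //.
  have := step y y0; have -> : k1 = tailC * (1 - 2 `^ (- alpha)).
    by rewrite /tailC divfK // gt_eqF // subr_gt0.
  lra.
have gle n : g x <= tail2 (2 ^+ n * x).
  have gn : g x <= g (2 ^+ n * x).
    elim: n => [|n IH]; first by rewrite expr0 mul1r.
    by rewrite exprS -mulrA (le_trans IH) // gstep // mulr_gt0 // exprn_gt0.
  apply: (le_trans gn); rewrite /g gerBl mulr_ge0 ?powR_ge0 //; exact: ltW tailC_gt0.
have : g x <= 0.
  by apply: (cvgr_to_ge (tail2_cvg0 x0)); exact: nearW.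
by rewrite /g subr_le0.
Qed.

Lemma expR_powR_diff_cvg (K : R) : 0 <= K ->
  (expR (- (K * t `^ alpha)) - 1) / t `^ alpha @[t --> 0^'+] --> - K.
Proof.
move=> K0; apply/cvgrPdist_le => e e0.
have K21 : 0 < K ^+ 2 + 1 by rewrite ltr_wpDl ?sqr_ge0.
have e' : 0 < e / (K ^+ 2 + 1) by rewrite divr_gt0.
have /cvgrPdist_le /(_ _ e') hP := powR_cvg0 (R := R) alpha0.
near=> t; have t0 : 0 < t by near: t; exact: nbhs_right_gt.
have u0 : 0 < t `^ alpha by rewrite powR_gt0.
have hu : t `^ alpha <= e / (K ^+ 2 + 1).
  near: t; apply: filterS hP => t; rewrite sub0r normrN; apply: le_trans.
  exact: ler_norm.
move: hu u0; set u := t `^ alpha; rewrite ler_pdivlMr // => hu u0.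
have /expRN_le_quadratic /andP[h1 h2] : 0 <= K * u by rewrite mulr_ge0 // ltW.
have -> : - K - (expR (- (K * u)) - 1) / u = - (expR (- (K * u)) - 1 + K * u) / u.
  by field; rewrite gt_eqF.
rewrite normrM normrN (gtr0_norm (_ : 0 < u^-1)) ?invr_gt0 // ler_pdivrMr // ger0_norm; last by lra.
have : K ^+ 2 * u <= e by apply: le_trans hu; rewrite mulrC ler_wpM2l ?(ltW u0) // lerDl.
move=> /(ler_wpM2r (ltW u0)); apply: le_trans; rewrite exprMn in h2; lra.
Unshelve. all: by end_near. Qed.

(** At frequencies proportional to [t] every cosine mean is 1 - K t^alpha + o(t^alpha), a property
    that the recursion [mean_polyMXaddC_cos] preserves. *)
Lemma trig_poly_cvg (r : {poly R}) (m : R) : exists L : R,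
  (mean (fun w => r.[cos (t * V w)] * cos ((m * t) * V w)) - r.[1]) / t `^ alpha
    @[t --> 0^'+] --> L.
Proof.
elim/poly_ind: r m => [|r c IH] m.
  exists 0; apply: cvg_near_cst; apply: nearW => t.
  under eq_fun do rewrite horner0 mul0r.
  by rewrite mean_cst horner0 subr0 mul0r.
have [L1 h1] := IH (m + 1); have [L2 h2] := IH (m - 1).
exists (2^-1 * (L1 + L2) + c * (- `|m| `^ alpha)).
have h3 := expR_powR_diff_cvg (powR_ge0 `|m| alpha).
pose q s t := (mean (fun w => r.[cos (t * V w)] * cos (s * t * V w)) - r.[1]) / t `^ alpha.
pose q3 t := (expR (- (`|m| `^ alpha * t `^ alpha)) - 1) / t `^ alpha.
apply: (@cvg_trans _ ((fun t => 2^-1 * (q (m + 1) t + q (m - 1) t) + c * q3 t) @ 0^'+)); last first.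
  apply: cvgD; apply: cvgM; [exact: cvg_cst|exact: cvgD|exact: cvg_cst|exact: h3].
apply: near_eq_cvg; near=> t; have t0 : 0 < t by near: t; exact: nbhs_right_gt.
rewrite /q /q3 mean_polyMXaddC_cos // hornerMXaddC mulr1.
have -> : m * t + t = (m + 1) * t by ring.
have -> : m * t - t = (m - 1) * t by ring.
rewrite hcos normrM powRM // (gtr0_norm t0).
have : t `^ alpha != 0 by rewrite gt_eqF // powR_gt0.
move: (t `^ alpha) (expR _) (mean _) (mean _) => u E M1 M2 u0.
by field.
Unshelve. all: by end_near. Qed.

(** The factor 1 - cos has mean at most t^alpha, so a uniform error in the approximation of [f] by a
    polynomial survives the division by t^alpha. *)
Lemma trig_cont_cvg (f : R -> R) : continuous f -> exists L : R,
  mean (fun w => (1 - cos (t * V w)) * f (cos (t * V w))) / t `^ alpha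
    @[t --> 0^'+] --> L.
Proof.
move=> cf; apply: real_cauchy_cvg => e e0.
have e20 : 0 < e / 2 by rewrite divr_gt0.
have [p hp] := weierstrass_approx cf e20.
have [L hL] := trig_poly_cvg ((1 - 'X) * p) 0; exists L.
near=> t; have t0 : 0 < t by near: t; exact: nbhs_right_gt.
have u0 : 0 < t `^ alpha by rewrite powR_gt0.
have hp' : `|mean (fun w => (1 - cos (t * V w)) * p.[cos (t * V w)]) / t `^ alpha - L| <= e / 2.
  near: t; have /cvgrPdist_le /(_ _ e20) := hL; apply: filterS => t.
  rewrite distrC; congr (`|_ / _ - _| <= _).
  rewrite hornerM !hornerE subrr mul0r subr0; congr (fun f => mean f).
  by apply/funext => w; rewrite !mul0r cos0 mulr1 hornerM !hornerE.
have bmf g : continuous g -> bounded_measurable (fun w => (1 - cos (t * V w)) * g (cos (t * V w))).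
  by move=> cg; apply: bmM; [exact: bm_1Bcos|exact: bm_comp_cos].
have bmp := bmf _ (continuous_horner (p := p)).
have hd : `|mean (fun w => (1 - cos (t * V w)) * f (cos (t * V w))) / t `^ alpha -
    mean (fun w => (1 - cos (t * V w)) * p.[cos (t * V w)]) / t `^ alpha| <= e / 2.
  rewrite -mulrBl normrM (gtr0_norm (_ : 0 < (t `^ alpha)^-1)) ?invr_gt0 // ler_pdivrMr //.
  rewrite -(meanB P (bmf f cf) bmp).
  apply: (@le_trans _ _ (e / 2 * mean (fun w => 1 - cos (t * V w)))); last first.
    by rewrite ler_wpM2l ?(ltW e20) // mean_1Bcos_le.
  rewrite -(meanZ P _ (bm_1Bcos t)).
  have bz := bmZ (e / 2) (bm_1Bcos t); have bd := bmB (bmf f cf) bmp.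
  have hw w : `|(1 - cos (t * V w)) * f (cos (t * V w)) - (1 - cos (t * V w)) * p.[cos (t * V w)]|
      <= e / 2 * (1 - cos (t * V w)).
    rewrite -mulrBr normrM ger0_norm ?subr_ge0 ?cos_le1 // mulrC.
    by rewrite ler_wpM2r ?subr_ge0 ?cos_le1 // hp // cos_geN1 cos_le1.
  rewrite ler_norml; apply/andP; split.
    rewrite -mulN1r -(meanZ P _ bz); apply: ler_mean => //; first exact: bmZ.
    by move=> w; have := hw w; rewrite ler_norml mulN1r => /andP[].
  by apply: ler_mean => // w; have := hw w; rewrite ler_norml => /andP[].
by rewrite [e]splitr; apply: le_trans (ler_distD _ _ _) (lerD hd hp').
Unshelve. all: by end_near. Qed.

Lemma near_div_pinfty (c : R) (Q : R -> Prop) : 0 < c ->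
  (\forall t \near 0^'+, Q t) -> \forall x \near +oo, Q (c / x).
Proof.
move=> c0 [r /= r0 hr]; near=> x.
have x0 : 0 < x by near: x; exact: nbhs_pinfty_gt.
have cx0 : 0 < c / x by rewrite divr_gt0.
apply: hr => //=; rewrite sub0r normrN gtr0_norm // ltr_pdivrMr // mulrC -ltr_pdivrMr //.
by near: x; apply: nbhs_pinfty_gt; exact: num_real.
Unshelve. all: by end_near. Qed.

(* The cut-off vanishes when the angle is at most [dl] and is 1 when it lies
   between [ka * dl] and pi, so that its mean at frequency [dl / x] compares with
   the tail at [x] and at [ka * x]; angles beyond pi are absorbed by [tail2_le]. *)
Lemma tail2_sandwich (dl ka : R) : 0 < dl <= 1 -> 1 < ka <= 2 ->
  exists M : R -> R, [/\ exists L : R, M t / t `^ alpha @[t --> 0^'+] --> L,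
    forall x, 0 < x -> M (dl / x) <= tail2 x &
    forall x, 0 < x -> tail2 (ka * x) <= M (dl / x) + tail2 (pi * x / dl)].
Proof.
move=> /andP[dl0 dl1] /andP[ka1 ka2].
have pi2 := pi_ge2 R.
have kadl : dl < ka * dl by rewrite ltr_pMl.
have kadl2 : ka * dl <= 2 by nra.
have cd : cos (ka * dl) < cos dl by rewrite ltr_cos // in_itv /=; lra.
have cd1 : cos dl < 1 by rewrite -[ltRHS]cos0 ltr_cos // in_itv /=; lra.
pose m u := Num.max 0 (Num.min 1 ((cos dl - u) / (cos dl - cos (ka * dl)))).
have cm : continuous m.
  rewrite /m; apply: (continuous_max_cst (g := fun u => Num.min 1 _)) => u.
  apply: (@continuous_min _ R (cst 1) (fun u => (cos dl - u) / (cos dl - cos (ka * dl))) u).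
    exact: cst_continuous.
  by apply: cvgM; [apply: cvgB; [exact: cvg_cst|exact: cvg_id]|exact: cvg_cst].
have m0 u : 0 <= m u by rewrite le_max lexx.
have m1 u : m u <= 1 by rewrite ge_max ler01 ge_min lexx.
have mz u : cos dl <= u -> m u = 0.
  move=> hu; rewrite /m max_l // ge_min; apply/orP; right.
  by rewrite mulr_le0_ge0 // ?invr_ge0; lra.
have mo u : u <= cos (ka * dl) -> m u = 1.
  move=> hu; rewrite /m min_l ?max_r //; rewrite ler_pdivlMr; lra.
(* [m] vanishes where 1 - u is at most 1 - cos dl, so truncating the denominator there is harmless:
   [f] is continuous and [(1 - u) * f u = m u], as [trig_cont_cvg] requires. *)
pose f u := m u / Num.max (1 - cos dl) (1 - u).
have den0 u : 0 < Num.max (1 - cos dl) (1 - u) by rewrite lt_max subr_gt0 cd1.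
have cf : continuous f.
  move=> u; apply: cvgM; first exact: cm.
  apply: cvgV; first by rewrite gt_eqF.
  apply: (continuous_max_cst (g := fun u => 1 - u)) => v; apply: cvgB; [exact: cvg_cst|exact: cvg_id].
have fm u : (1 - u) * f u = m u.
  rewrite /f; have [hu|hu] := leP (cos dl) u; first by rewrite mz // mul0r mulr0.
  by rewrite max_r; [field; lra|lra].
have bm t : bounded_measurable (fun w => m (cos (t * V w))) by exact: bm_comp_cos.
exists (fun t => mean (fun w => m (cos (t * V w)))); split.
- have [L hL] := trig_cont_cvg cf; exists L.
  by under eq_fun do under eq_fun do rewrite -fm.
- move=> x x0; apply: mean_le_pr => // w /= /negP; rewrite -leNgt => hw.
  rewrite mz // cos_norm_mul ?divr_ge0 ?(ltW dl0) ?(ltW x0) //.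
  have h1 : dl / x * `|V w| <= dl by rewrite mulrAC ler_pdivrMr // ler_wpM2l // ltW.
  have h2 : 0 <= dl / x * `|V w| by rewrite mulr_ge0 // divr_ge0 // ltW.
  by apply: ler_cos_pi => //; lra.
- move=> x x0; rewrite /tail2.
  have mD : measurable ([set w | ka * x < `|V w|] `\` [set w | pi * x / dl < `|V w|]).
    exact: measurableD.
  have hD := @markov_mean _ _ _ P _ _ 1 mD (bm (dl / x)) _ _.
  apply: (@le_trans _ _ (pr ([set w | ka * x < `|V w|] `\` [set w | pi * x / dl < `|V w|]) +
     pr [set w | pi * x / dl < `|V w|])).
    apply: le_trans (prU_le P mD (mtail _)); apply: le_pr => //; first exact: measurableU.
    by move=> w /= h; have [|] := ltP (pi * x / dl) `|V w|; [right|left; split => //; apply/negP; rewrite -leNgt].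
  rewrite lerD2r -[leLHS]mul1r; apply: hD => // w /= [h1 /negP]; rewrite -leNgt => h2.
  rewrite mo // cos_norm_mul ?divr_ge0 ?(ltW x0) ?(ltW dl0) //.
  have h3 : ka * dl < dl / x * `|V w|.
    by rewrite mulrAC ltr_pdivlMr // mulrAC mulrC ltr_pM2l.
  have h4 : dl / x * `|V w| <= pi.
    by move: h2; rewrite ler_pdivlMr // mulrAC ler_pdivrMr // mulrC.
  by rewrite ltW // ltr_cos ?in_itv /=; lra.
Qed.

Let combine (e k C D B X Z : R) : 1 < k -> (k - 1) * C <= e / 4 -> k * D <= e / 4 ->
  Z <= X + D -> X <= C -> X <= B + e / 4 -> k * Z <= B + e / 4 + e / 4 + e / 4.
Proof.
move=> k1' kC kD ZX XC XB.
have : k * Z <= k * (X + D) by rewrite ler_wpM2l //; lra.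
have : (k - 1) * X <= (k - 1) * C by rewrite ler_wpM2l //; lra.
lra.
Qed.

Let close_norm (e A B : R) : 0 < e -> A - e / 4 <= B -> B <= A + e / 4 + e / 4 + e / 4 ->
  - e <= B - A <= e.
Proof. by move=> *; apply/andP; split; lra. Qed.

Let scale_le (u A L e : R) : 0 <= u <= 1 -> 0 < e -> A - L <= e -> u * A <= u * L + e.
Proof. by move=> *; nra. Qed.

Let scale_ge (u A L e : R) : 0 <= u <= 1 -> 0 < e -> - e <= A - L -> u * L - e <= u * A.
Proof. by move=> *; nra. Qed.

(** The sandwich at x from below and at x / ka from above encloses x^alpha times the tail near
    dl^alpha L. A small [dl] makes the angles beyond pi negligible, and [ka] close to 1 makes the
    two sides agree. *)
Lemma tail2_cvg : exists c : R, x `^ alpha * tail2 x @[x --> +oo] --> c.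
Proof.
apply: real_cauchy_cvg => e e0.
have [C C0 tle] : exists2 C : R, 0 < C & forall x : R, 0 < x -> tail2 x <= C * x `^ (- alpha).
  by exists tailC; [exact: tailC_gt0|exact: tail2_le].
have p20 : 0 < 2 `^ alpha :> R by rewrite powR_gt0.
have e' : 0 < e / 4 / (2 `^ alpha * C) by rewrite !divr_gt0 // mulr_gt0.
near (0 : R)^'+ => dl.
have dl0 : 0 < dl by near: dl; exact: nbhs_right_gt.
have dl1 : dl <= 1 by near: dl; exact: nbhs_right_le.
have hdl : 2 `^ alpha * C * dl `^ alpha <= e / 4.
  rewrite mulrC -ler_pdivlMr ?mulr_gt0 //.
  near: dl; have /cvgrPdist_le /(_ _ e') := powR_cvg0 (R := R) alpha0.
  by apply: filterS => t; rewrite sub0r normrN; apply: le_trans; exact: ler_norm.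
have dla1 : dl `^ alpha <= 1.
  have := ge0_ler_powR (ltW alpha0) _ _ dl1; rewrite !nnegrE powR1.
  by apply; [exact: ltW|exact: ler01].
have dla0 : 0 < dl `^ alpha by rewrite powR_gt0.
(* [k] is ka^alpha. The first bound ensures ka <= 2; the second makes multiplication by [k] cost at
   most e / 4 on a quantity bounded by [C]. *)
pose k := Num.min (2 `^ alpha) (1 + e / 4 / C).
have k1' : 1 < k.
  rewrite lt_min; apply/andP; split; last by rewrite ltrDl !divr_gt0.
  have : (1 : R) `^ alpha < 2 `^ alpha by rewrite gt0_ltr_powR ?nnegrE // ltr1n.
  by rewrite powR1.
pose ka := k `^ alpha^-1.
have kaE : ka `^ alpha = k by rewrite /ka -powRrM mulVf ?gt_eqF // powRr1 //; lra.
have ka1 : 1 < ka.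
  have : (1 : R) `^ alpha^-1 < ka by rewrite gt0_ltr_powR ?nnegrE ?invr_gt0 //; lra.
  by rewrite powR1.
have ka2 : ka <= 2.
  have : ka <= (2 `^ alpha) `^ alpha^-1.
    by rewrite ge0_ler_powR ?nnegrE ?invr_ge0 ?(ltW alpha0) ?(ltW p20) // ?ge_min ?lexx //; lra.
  by rewrite -powRrM mulfV ?gt_eqF // powRr1.
have ka0 : 0 < ka by exact: lt_trans ka1.
have ka_neq0 : ka != 0 by rewrite gt_eqF.
have dl_neq0 : dl != 0 by rewrite gt_eqF.
have [M [[L hL] hup hlo]] := tail2_sandwich (dl := dl) (ka := ka) (ltac:(by rewrite dl0 dl1)) (ltac:(by rewrite ka1 ka2)).
exists (dl `^ alpha * L).
have e40 : 0 < e / 4 by rewrite divr_gt0.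
have near1 : \forall t \near 0^'+, `|M t / t `^ alpha - L| <= e / 4.
  by have /cvgrPdist_le /(_ _ e40) := hL; apply: filterS => t; rewrite distrC.
have ME y : 0 < y -> y `^ alpha * M (dl / y) = dl `^ alpha * (M (dl / y) / (dl / y) `^ alpha).
  move=> y0; have -> : dl `^ alpha = (dl / y) `^ alpha * y `^ alpha.
    by rewrite -powRM ?divr_ge0 ?(ltW dl0) ?(ltW y0) // divfK // gt_eqF.
  have : (dl / y) `^ alpha != 0 by rewrite gt_eqF // powR_gt0 // divr_gt0.
  by move=> ?; field.
have C1 y : 0 < y -> y `^ alpha * tail2 y <= C.
  move=> y0; apply: (@le_trans _ _ (y `^ alpha * (C * y `^ (- alpha)))).
    by rewrite ler_wpM2l ?powR_ge0 // tle.
  rewrite mulrCA powRN divff ?mulr1 // gt_eqF // powR_gt0 //.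
near=> x; have x0 : 0 < x by near: x; exact: nbhs_pinfty_gt.
have x_neq0 : x != 0 by rewrite gt_eqF.
have y0 : 0 < x / ka by rewrite divr_gt0.
have n1 : `|M (dl / x) / (dl / x) `^ alpha - L| <= e / 4.
  near: x; exact: (near_div_pinfty (Q := fun t => `|M t / t `^ alpha - L| <= e / 4)).
have n2 : `|M (dl / (x / ka)) / (dl / (x / ka)) `^ alpha - L| <= e / 4.
  have -> : dl / (x / ka) = dl * ka / x by rewrite invf_div mulrA.
  near: x; apply: (near_div_pinfty (Q := fun t => `|M t / t `^ alpha - L| <= e / 4)) => //.
  by rewrite mulr_gt0.
move: n1 n2; rewrite !ler_norml => /andP[n1 _] /andP[_ n2].
have low : dl `^ alpha * L - e / 4 <= x `^ alpha * tail2 x.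
  apply: (@le_trans _ _ (x `^ alpha * M (dl / x))); last first.
    by rewrite ler_wpM2l ?powR_ge0 // hup.
  by rewrite ME //; apply: scale_ge; rewrite ?(ltW dla0).
have high : x `^ alpha * tail2 x <= dl `^ alpha * L + e / 4 + e / 4 + e / 4.
  have xE : x = ka * (x / ka) by rewrite mulrC divfK.
  have h := hlo _ y0; rewrite -xE in h.
  have hM := hup _ y0.
  (* Angles beyond pi: the tail at pi y / dl is at most C (dl / y)^alpha. *)
  have t1 : (x / ka) `^ alpha * tail2 (pi * (x / ka) / dl) <= C * dl `^ alpha.
    have p0 : 0 < pi * (x / ka) / dl by rewrite divr_gt0 // mulr_gt0 // pi_gt0.
    apply: le_trans (_ : (x / ka) `^ alpha * (C * (pi * (x / ka) / dl) `^ (- alpha)) <= _).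
      by rewrite ler_wpM2l ?powR_ge0 // tle.
    rewrite mulrCA ler_wpM2l ?(ltW C0) // powRN ler_pdivrMr ?powR_gt0 //.
    rewrite -powRM ?(ltW dl0) ?(ltW p0) // ge0_ler_powR ?(ltW alpha0) ?nnegrE ?(ltW y0) //.
      by rewrite mulr_ge0 ?(ltW dl0) ?(ltW p0).
    have -> : dl * (pi * (x / ka) / dl) = pi * (x / ka) by rewrite mulrC divfK.
    by rewrite ler_peMl ?(ltW y0) // (le_trans _ (pi_ge2 R)) // ler1n.
  have t2 : x `^ alpha = k * (x / ka) `^ alpha.
    by rewrite {1}xE powRM ?(ltW y0) ?(ltW ka0) ?kaE.
  rewrite t2 -mulrA.
  have t3 : (x / ka) `^ alpha * tail2 x <= (x / ka) `^ alpha * M (dl / (x / ka)) + C * dl `^ alpha.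
    apply: le_trans (_ : (x / ka) `^ alpha * (M (dl / (x / ka)) + tail2 (pi * (x / ka) / dl)) <= _).
      by rewrite ler_wpM2l ?powR_ge0.
    by rewrite mulrDr lerD2l.
  have t4 : (x / ka) `^ alpha * M (dl / (x / ka)) <= C.
    by apply: le_trans (C1 _ y0); rewrite ler_wpM2l ?powR_ge0.
  have t5 : (x / ka) `^ alpha * M (dl / (x / ka)) <= dl `^ alpha * L + e / 4.
    by rewrite ME //; apply: scale_le; rewrite ?(ltW dla0).
  have k2 : k <= 2 `^ alpha by rewrite ge_min lexx.
  have k3 : (k - 1) * C <= e / 4.
    rewrite -ler_pdivlMr // lerBlDl ge_min lexx orbT //.
  have C2 : k * (C * dl `^ alpha) <= e / 4.
    apply: (le_trans _ hdl); rewrite -mulrA ler_wpM2r // mulr_ge0 ?(ltW C0) ?(ltW dla0) //.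
  exact: (combine k1' k3 C2 t3 t4 t5).
exact: close_norm.
Unshelve. all: by end_near. Qed.

End stable_tail.

(** * Positivity of the tail constant and symmetry *)

Section stable_tail_asymptotics.
Context d (T : measurableType d) (R : realType) (P : probability T R).
Variables (alpha : R) (V : T -> R).
Local Notation mean := (mean P).
Local Notation pr := (pr P).
Hypothesis halpha : 0 < alpha < 2.
Hypothesis mV : measurable_fun setT V.
Hypothesis hcos : forall t : R, mean (fun w => cos (t * V w)) = expR (- (`|t| `^ alpha)).

Let alpha0 : 0 < alpha. Proof. by case/andP: halpha. Qed.

(** Here [u] is t^alpha and [a] is 2^alpha. The left side of the last hypothesis is at least (4 - a)
    u - 4 u^2; the terms 4 u^2 and 2 k u each take at most a quarter of (4 - a) u, and the remaining
    half, divided by 8, is the bound. *)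
Let arith (u a k E1 E2 Tl : R) : 0 < u -> 0 < 4 - a -> u <= (4 - a) / 16 ->
  k <= (4 - a) / 8 -> E1 <= 1 - u + u ^+ 2 -> 1 - a * u <= E2 ->
  4 * (1 - E1) - (1 - E2) <= 8 * Tl + 2 * k * u -> u * ((4 - a) / 16) <= Tl.
Proof.
move=> u0 a0 ua ka h1 h2 h3.
have h4 : u ^+ 2 <= u * ((4 - a) / 16) by rewrite expr2 ler_wpM2l // ltW.
have h5 : k * u <= u * ((4 - a) / 8) by rewrite mulrC ler_wpM2l // ltW.
lra.
Qed.

Lemma mean_1Bcos_sqr (t : R) :
  mean (fun w => 2 * (1 - cos (t * V w)) ^+ 2) =
  4 * (1 - expR (- (`|t| `^ alpha))) - (1 - expR (- (`|2 * t| `^ alpha))).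
Proof.
rewrite -!(mean_1Bcos mV hcos).
have b1 := bm_1Bcos mV t; have b2 := bm_1Bcos mV (2 * t).
rewrite -(meanZ P _ b1) -(meanB P (bmZ _ b1) b2); congr (fun f => mean f).
apply/funext => w; have -> : 2 * t * V w = (t * V w) *+ 2 by rewrite mulr2n; ring.
by rewrite cos_mulr2n !mulr2n; ring.
Qed.

(* Since alpha < 2, the mean of 2 (1 - cos)^2 = 4 (1 - cos) - (1 - cos(2 .)) is of
   order t^alpha, whereas small angles contribute little to it. *)
Lemma tail2_lower : exists2 b : R, 0 < b &
  \forall x \near +oo, b <= x `^ alpha * tail2 P V x.
Proof.
have pi2 := pi_ge2 R.
have g0 : 0 < 4 - 2 `^ alpha :> R.
  have h4 : (2 : R) `^ 2 = 4 by rewrite (@powR_mulrn _ 2 2) // expr2; ring.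
  have ln2 : 0 < ln 2 :> R by rewrite ln_gt0 // ltr1n.
  case/andP: halpha => _ a2.
  by rewrite subr_gt0 -h4 /powR pnatr_eq0 /= ltr_expR ltr_pM2r.
have g8 : 0 < (4 - 2 `^ alpha) / 8 :> R by rewrite divr_gt0.
have g16 : 0 < (4 - 2 `^ alpha) / 16 :> R by rewrite divr_gt0.
near (0 : R)^'+ => dl.
have dl0 : 0 < dl by near: dl; exact: nbhs_right_gt.
have dl1 : dl <= 1 by near: dl; exact: nbhs_right_le.
have hdl : 1 - cos dl <= (4 - 2 `^ alpha) / 8.
  near: dl; have : cos x @[x --> (0 : R)^'+] --> (cos 0 : R).
    by apply: cvg_at_right_filter; exact: continuous_cos.
  move=> /cvgrPdist_le /(_ _ g8); apply: filterS => t; rewrite cos0.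
  by apply: le_trans; exact: ler_norm.
have dlpi : dl <= pi by lra.
exists (dl `^ alpha * ((4 - 2 `^ alpha) / 16)).
  by rewrite mulr_gt0 // powR_gt0.
have key t : 0 < t -> t `^ alpha <= (4 - 2 `^ alpha) / 16 ->
    t `^ alpha * ((4 - 2 `^ alpha) / 16) <= tail2 P V (dl / t).
  move=> t0 hu; have u0 : 0 < t `^ alpha by rewrite powR_gt0.
  have /andP[_ e1] := expRN_le_quadratic (ltW u0).
  have e2 : 1 - 2 `^ alpha * t `^ alpha <= expR (- ((2 * t) `^ alpha)).
    by rewrite powRM ?(ltW t0) // expR_ge1Dx.
  apply: (arith u0 g0 hu hdl e1 e2).
  have -> : 4 * (1 - expR (- t `^ alpha)) - (1 - expR (- (2 * t) `^ alpha)) =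
      mean (fun w => 2 * (1 - cos (t * V w)) ^+ 2).
    by rewrite mean_1Bcos_sqr !gtr0_norm // mulr_gt0.
  have mA : measurable [set w | dl / t < `|V w|].
    rewrite (_ : [set _ | _] = (fun w => `|V w|) @^-1` `]dl / t, +oo[%classic).
      by rewrite -[X in measurable X]setTI; apply: measurableT_comp.
    by apply/seteqP; split => w /=; rewrite in_itv /= andbT.
  have b1 := bm_1Bcos mV t.
  (* The function 2 (1 - cos)^2 is at most 8 everywhere, and at most 2 (1 - cos dl) (1 - cos) at
     angles up to dl. *)
  apply: (@le_trans _ _ (8 * tail2 P V (dl / t) + 2 * (1 - cos dl) * mean (fun w => 1 - cos (t * V w)))).
    rewrite /tail2 -(mean_indic P mA) -(meanZ P _ (bm_indic R mA)) -(meanZ P _ b1).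
    rewrite -(meanD P (bmZ _ (bm_indic R mA)) (bmZ _ b1)).
    apply: ler_mean.
    - by apply: bmZ; under eq_fun do rewrite expr2; exact: bmM.
    - by apply: bmD; apply: bmZ => //; exact: bm_indic.
    - move=> w; rewrite indicE; have c1 := cos_le1 (t * V w); have c2 := cos_geN1 (t * V w).
      have [_|] := boolP (w \in _).
        have c3 : 0 <= (1 - cos dl) * (1 - cos (t * V w)).
          by rewrite mulr_ge0 // subr_ge0 // cos_le1.
        rewrite mulr1 -mulrA; move: c1 c2 c3; move: (cos _) => c c1 c2 c3; nra.
      rewrite notin_setE /= => /negP; rewrite -leNgt ler_pdivlMr // mulrC => hw.
      have : cos dl <= cos (t * V w).
        by rewrite (cos_norm_mul _ _ (ltW t0)) ler_cos_pi // mulr_ge0 // ltW.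
      move: c1; move: (cos (t * V w)) (cos dl) => c k c1 ck; nra.
  rewrite lerD2l; apply: ler_wpM2l; last exact: (mean_1Bcos_le mV hcos).
  by rewrite mulr_ge0 // subr_ge0 cos_le1.
near=> x; have x0 : 0 < x by near: x; exact: nbhs_pinfty_gt.
have xa0 : 0 < x `^ alpha by rewrite powR_gt0.
have := key (dl / x); rewrite divr_gt0 // => /(_ isT).
rewrite powRM ?invr_ge0 ?(ltW x0) ?(ltW dl0) //.
have -> : x^-1 `^ alpha = (x `^ alpha)^-1 by rewrite -powR_inv1 ?(ltW x0) // powRAC powR_inv1 ?powR_ge0.
have -> : dl / (dl / x) = x by rewrite invf_div mulrCA divff ?mulr1 // gt_eqF.
have hx : dl `^ alpha / x `^ alpha <= (4 - 2 `^ alpha) / 16.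
  rewrite ler_pdivrMr // mulrC -ler_pdivrMr //.
  by near: x; exact: nbhs_pinfty_powR_ge.
move=> /(_ hx); rewrite mulrAC ler_pdivrMr //.
by rewrite [leRHS]mulrC.
Unshelve. all: by end_near. Qed.

Hypothesis hsin : forall t : R, mean (fun w => sin (t * V w)) = 0.

Lemma stable_symmetric (x : R) : pr [set w | V w < - x] = pr [set w | x < V w].
Proof.
have mN : measurable_fun setT (fun w => - V w) by apply: measurableT_comp.
have hs : same_trig P V (fun w => - V w).
  split=> // t; first by congr (fun f => mean f); apply/funext => w; rewrite mulrN cosN.
  rewrite hsin -[LHS](hsin (- t)); congr (fun f => mean f); apply/funext => w.
  by rewrite mulrN mulNr.
rewrite (same_trig_gt x hs); congr pr; apply/seteqP; split => w /=; lra.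
Qed.

Lemma tail2E (x : R) : 0 <= x -> tail2 P V x = 2 * pr [set w | x < V w].
Proof.
move=> x0; rewrite mulr_natl mulr2n -{2}stable_symmetric -prU.
- congr pr; apply/seteqP; split => w /=; rewrite lter_normr; last first.
    by move=> [->//|h]; apply/orP; right; lra.
  by move=> /orP[|h]; [left|right; lra].
- rewrite (_ : [set _ | _] = V @^-1` `]x, +oo[%classic); last first.
    by apply/seteqP; split => w /=; rewrite in_itv /= andbT.
  by rewrite -[X in measurable X]setTI; apply: mV.
- rewrite (_ : [set _ | _] = V @^-1` `]-oo, - x[%classic); last first.
    by apply/seteqP; split => w /=; rewrite in_itv.
  by rewrite -[X in measurable X]setTI; apply: mV.
- by apply/seteqP; split => w //= [? ?]; lra.
Qed.

Lemma stable_tail_cvg : exists2 c : R, 0 < c &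
  x `^ alpha * pr [set w | x < V w] @[x --> +oo] --> c.
Proof.
have [c hc] := tail2_cvg halpha mV hcos; have [b b0 hb] := tail2_lower.
have bc : b <= c by exact: cvgr_to_ge hc hb.
exists (2^-1 * c); first by rewrite mulr_gt0 ?invr_gt0 // (lt_le_trans b0).
apply: (@cvg_trans _ ((fun x => 2^-1 * (x `^ alpha * tail2 P V x)) @ +oo)); last first.
  by apply: cvgM; [exact: cvg_cst|exact: hc].
apply: near_eq_cvg; near=> x; have x0 : 0 <= x by near: x; exact: nbhs_pinfty_ge.
by rewrite tail2E //; field.
Unshelve. all: by end_near. Qed.

Lemma stable_tail_le : exists2 C : R, 0 < C &
  forall x : R, 0 < x -> pr [set w | x < V w] <= C * x `^ (- alpha).
Proof.
exists (tailC alpha); first exact: (tailC_gt0 halpha).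
move=> x x0; apply: le_trans (tail2_le halpha mV hcos x0).
by rewrite (tail2E (ltW x0)) ler_peMl ?pr_ge0 // ler1n.
Qed.

End stable_tail_asymptotics.

(** * Local bound through the Fejer kernel *)

Section local_bound.
Variable R : realType.

(** Midpoint convexity of the inverse power 1 / al, applied to the two values and raised back to the
    power al. *)
Lemma powR_midpoint_concave (al x : R) : 0 < al <= 1 -> 1 <= x ->
  (x - 1) `^ al + (x + 1) `^ al <= 2 * x `^ al.
Proof.
move=> /andP[al0 al1] x1.
set u := (x - 1) `^ al; set v := (x + 1) `^ al.
have u0 : 0 <= u by exact: powR_ge0.
have v0 : 0 <= v by exact: powR_ge0.
have p1 : 1 <= al^-1 by rewrite invf_ge1.
have half01 : (0 <= (2^-1 : R) <= 1) by rewrite invr_ge0 ler0n /= invf_le1 // ler1n.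
have := @convex_powR R al^-1 p1 (Itv01 (andP half01).1 (andP half01).2) u v.
rewrite !inE /= !in_itv /= !andbT => /(_ u0 v0).
rewrite convRE [X in X `^ _ <= _]convRE /= /unstable.onem.
rewrite -!powRrM mulfV ?gt_eqF // !powRr1; [|lra|lra].
have -> : 2^-1 * (x - 1) + (1 - 2^-1) * (x + 1) = x by field.
move=> /(ge0_ler_powR (ltW al0)); rewrite !nnegrE => h.
have {h} := h (powR_ge0 _ _) (ltac:(lra)).
rewrite -powRrM mulVf ?gt_eqF // powRr1; last by lra.
lra.
Qed.

Definition stable_cf (al t s : R) : R := expR (- (`|s * t| `^ al)).

(** Concavity of s^al in the exponent, then the arithmetic-geometric mean inequality for the two
    exponentials. The condition [1 <= s] keeps all three points on the half-line; across 0 the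
    convexity fails. *)
Lemma stable_cf_convex (al t s : R) : 0 < al <= 1 -> 1 <= s ->
  2 * stable_cf al t s <= stable_cf al t (s - 1) + stable_cf al t (s + 1).
Proof.
move=> hal s1; have s0 : 0 <= s by lra.
have sp0 : 0 <= s + 1 by lra.
have sm0 : 0 <= s - 1 by lra.
rewrite /stable_cf !normrM !powRM // (ger0_norm s0) (ger0_norm sp0) (ger0_norm sm0).
set A := _ * _ `^ al; set B := (s - 1) `^ al * _; set C := (s + 1) `^ al * _.
have h : B + C <= 2 * A.
  rewrite /A /B /C -mulrDl mulrA ler_wpM2r ?powR_ge0 //.
  exact: powR_midpoint_concave.
clearbody A B C; have hB : expR (- B) = expR (- B / 2) ^+ 2 by rewrite -expRM_natl; congr expR; field.
have hC : expR (- C) = expR (- C / 2) ^+ 2 by rewrite -expRM_natl; congr expR; field.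
have hBC : expR (- A) <= expR (- B / 2) * expR (- C / 2).
  by rewrite -expRD ler_expR; lra.
rewrite hB hC; have := sqr_ge0 (expR (- B / 2) - expR (- C / 2)).
rewrite sqrrB; move: hBC; move: (expR (- A)) (expR (- B / 2)) (expR (- C / 2)) => a b c; lra.
Qed.

Variables (d : measure_display) (T : measurableType d) (P : probability T R).
Variables (alpha : R) (V : T -> R).
Local Notation mean := (mean P).
Local Notation pr := (pr P).
Hypothesis halpha : 0 < alpha <= 1.
Hypothesis mV : measurable_fun setT V.
Hypothesis hcos : forall t : R, mean (fun w => cos (t * V w)) = expR (- (`|t| `^ alpha)).
Local Notation phi := (stable_cf alpha).

(** Minus half the second difference of the characteristic function. At integers [s] it is a Fourier
    coefficient of the law of t V modulo 2 pi weighted by 1 - cos (t V), see [mean_1Bcos_cos]. *)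
Definition cf_defect (t s : R) : R := phi t s - 2^-1 * (phi t (s + 1) + phi t (s - 1)).

Lemma mean_1Bcos_cos (t s : R) :
  mean (fun w => (1 - cos (t * V w)) * cos (s * t * V w)) = cf_defect t s.
Proof.
have h s' : bounded_measurable (fun w => cos (s' * t * V w)) by exact: bm_cos.
have e s' : mean (fun w => cos (s' * t * V w)) = phi t s' by rewrite hcos.
rewrite /cf_defect -!e -(meanD P (h _) (h _)).
rewrite -(meanZ P _ (bmD (h _) (h _))) -(meanB P (h _) (bmZ _ (bmD (h _) (h _)))).
congr (fun f => mean f); apply/funext => w.
have -> : (s + 1) * t * V w = s * t * V w + t * V w by ring.
have -> : (s - 1) * t * V w = s * t * V w - t * V w by ring.
by rewrite cosD cosB; move: (cos _) (cos _) (sin _) (sin _) => *; field.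
Qed.

Lemma cf_defectN (t s : R) : cf_defect t (- s) = cf_defect t s.
Proof.
have even (f : R -> R) : (forall x, f (- x) = f x) ->
    f (- s) - 2^-1 * (f (- s + 1) + f (- s - 1)) = f s - 2^-1 * (f (s + 1) + f (s - 1)).
  move=> fN; rewrite (_ : - s + 1 = - (s - 1)); last by ring.
  rewrite (_ : - s - 1 = - (s + 1)); last by ring.
  by rewrite !fN (addrC (f (s - 1))).
by apply: (even (phi t)) => x; rewrite /stable_cf mulNr normrN.
Qed.

Lemma cf_defect0 (t : R) : cf_defect t 0 = 1 - phi t 1.
Proof.
rewrite /cf_defect /stable_cf add0r sub0r mul0r normr0 powR0 ?oppr0 ?expR0; last first.
  by rewrite gt_eqF //; case/andP: halpha.
by rewrite mulN1r normrN mul1r; field.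
Qed.

Let second_diff_sum (F : nat -> R) (m : nat) :
  \sum_(0 <= k < m) 2^-1 * (F k - 2 * F k.+1 + F k.+2) =
  2^-1 * ((F 0 - F 1) - (F m - F m.+1)).
Proof.
elim: m => [|m IH]; first by rewrite big_nil; lra.
by rewrite big_nat_recr // IH /=; lra.
Qed.

(** Convexity gives all the terms the same sign, so the sum of absolute values telescopes. *)
Lemma sum_cf_defect (t : R) (m : nat) :
  \sum_(0 <= k < m) `|cf_defect t k.+1%:R| <= 2^-1 * (1 - phi t 1).
Proof.
have -> : \sum_(0 <= k < m) `|cf_defect t k.+1%:R| =
    2^-1 * ((phi t 0%:R - phi t 1%:R) - (phi t m%:R - phi t m.+1%:R)).
  rewrite -(second_diff_sum (fun k => phi t k%:R)); apply: eq_bigr => k _.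
  have := stable_cf_convex t halpha (s := k.+1%:R); rewrite ler1n => /(_ isT).
  have e1 : k.+1%:R - 1 = k%:R :> R by rewrite -natr1 addrK.
  rewrite /cf_defect [k.+1%:R + 1]natr1 e1.
  move: (phi t k%:R) (phi t k.+1%:R) (phi t k.+2%:R) => a b c h.
  by rewrite ler0_norm; lra.
have -> : phi t 0 = 1.
  rewrite /stable_cf mul0r normr0 powR0 ?oppr0 ?expR0 //.
  by rewrite gt_eqF //; case/andP: halpha.
rewrite ler_wpM2l ?invr_ge0 // gerBl subr_ge0 /stable_cf ler_expR lerN2.
rewrite ge0_ler_powR ?nnegrE ?normr_ge0 //; first by case/andP: halpha => /ltW.
by rewrite !normrM ler_wpM2r // !normr_nat ler_nat.
Qed.

(** The diagonal term is [1 - phi t 1], and by evenness each side of it is bounded by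
    [sum_cf_defect]. *)
Lemma sum_cf_defect_diff (t : R) (n j : nat) : (j < n)%N ->
  \sum_(0 <= l < n) `|cf_defect t (j%:R - l%:R)| <= 2 * (1 - phi t 1).
Proof.
move=> jn; rewrite (big_cat_nat (n := j)) //=; last exact: ltnW.
rewrite (big_ltn jn) subrr cf_defect0.
have f1 : 0 <= 1 - phi t 1.
  by rewrite subr_ge0 /stable_cf -expR0 ler_expR oppr_le0 powR_ge0.
have h1 : \sum_(0 <= l < j) `|cf_defect t (j%:R - l%:R)| <= 2^-1 * (1 - phi t 1).
  rewrite big_nat_rev /=; apply: le_trans (sum_cf_defect t j).
  rewrite le_eqVlt; apply/orP; left; apply/eqP; apply: eq_big_nat => i /andP[_ ij].
  by congr `|cf_defect t _|; rewrite add0n natrB // opprB addrC subrK.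
have h2 : \sum_(j.+1 <= l < n) `|cf_defect t (j%:R - l%:R)| <= 2^-1 * (1 - phi t 1).
  rewrite -{1}[j.+1]add0n big_addn; apply: le_trans (sum_cf_defect t (n - j.+1)).
  rewrite le_eqVlt; apply/orP; left; apply/eqP; apply: eq_big_nat => k _.
  rewrite -cf_defectN; by congr `|cf_defect t _|; rewrite addnS -addSn natrD opprB addrK.
rewrite (ger0_norm f1); lra.
Qed.

(** The bracket is |sum_j (-1)^j exp (i j t V)|^2, an unnormalised Fejer kernel centred at pi. The
    weight 1 - cos turns the coefficients of the double sum into second differences, each row of
    which is summable with a bound uniform in [n]. *)
Lemma mean_fejer_le (t : R) (n : nat) :
  mean (fun w => (1 - cos (t * V w)) *
    ((\sum_(0 <= j < n) (-1) ^+ j * cos (j%:R * (t * V w))) ^+ 2 +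
     (\sum_(0 <= j < n) (-1) ^+ j * sin (j%:R * (t * V w))) ^+ 2)) <=
  n%:R * (2 * (1 - phi t 1)).
Proof.
have bmt s : bounded_measurable (fun w => (1 - cos (t * V w)) * cos (s * t * V w)).
  by apply: bmM; [exact: bm_1Bcos|exact: bm_cos].
rewrite (_ : (fun w => _) = fun w => \sum_(0 <= j < n) \sum_(0 <= l < n)
    ((-1) ^+ j * (-1) ^+ l * ((1 - cos (t * V w)) * cos ((j%:R - l%:R) * t * V w)))).
  rewrite mean_sum => [|j]; last by apply: bm_sum => l; exact: bmZ.
  rewrite [leRHS](_ : _ = \sum_(0 <= j < n) 2 * (1 - phi t 1)); last first.
    by rewrite sumr_const_nat subn0 mulr_natl.
  rewrite big_nat [leRHS]big_nat; apply: ler_sum => j /andP[_ jn].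
  rewrite mean_sum => [|l]; last exact: bmZ.
  apply: le_trans (sum_cf_defect_diff t jn); apply: ler_sum => l _.
  rewrite meanZ // mean_1Bcos_cos; apply: le_trans (ler_norm _) _.
  by rewrite !normrM !normrX normrN normr1 !expr1n !mul1r.
apply/funext => w; rewrite !expr2 !mulr_suml -big_split mulr_sumr /=.
apply: eq_bigr => j _; rewrite !mulr_sumr -big_split mulr_sumr /=.
apply: eq_bigr => l _.
have -> : (j%:R - l%:R) * t * V w = j%:R * (t * V w) - l%:R * (t * V w) by ring.
by rewrite cosB; ring.
Qed.

Lemma cos_natpi (j : nat) (x : R) : (-1) ^+ j * cos (j%:R * x) = cos (j%:R * (x - pi)).
Proof.
have h y : cos (y + j%:R * pi) = (-1) ^+ j * cos y.
  elim: j y => [|j IH] y; first by rewrite mul0r addr0 expr0 mul1r.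
  rewrite -natr1 mulrDl mul1r addrA cosDpi IH exprS; ring.
have -> : j%:R * x = j%:R * (x - pi) + j%:R * pi by ring.
by rewrite h mulrA -exprD -signr_odd oddD addbb expr0 mul1r.
Qed.

(* The Fejer kernel is at least n cos(1) on an arc of half-width 1/n around pi. *)
Lemma arc_pr_le (t : R) (n : nat) : 0 < t -> (0 < n)%N ->
  pr [set w | `|t * V w - pi| <= n%:R^-1] <= 2 / cos 1 ^+ 2 * t `^ alpha / n%:R.
Proof.
move=> t0 n0; have nR : 0 < n%:R :> R by rewrite ltr0n.
have mA : measurable [set w | `|t * V w - pi| <= n%:R^-1].
  rewrite (_ : [set _ | _] = (fun w => `|t * V w - pi|) @^-1` `]-oo, n%:R^-1]%classic).
    rewrite -[X in measurable X]setTI; apply: measurableT_comp => //.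
    by apply: measurable_funB => //; apply: measurable_funM.
  by apply/seteqP; split => w /=; rewrite in_itv.
have bk : bounded_measurable (fun w => (1 - cos (t * V w)) *
    ((\sum_(0 <= j < n) (-1) ^+ j * cos (j%:R * (t * V w))) ^+ 2 +
     (\sum_(0 <= j < n) (-1) ^+ j * sin (j%:R * (t * V w))) ^+ 2)).
  apply: bmM; first exact: bm_1Bcos.
  by apply: bmD; under eq_fun do rewrite expr2; apply: bmM; apply: bm_sum => j;
    apply: bmZ; under eq_fun do rewrite mulrA; [exact: bm_cos..|exact: bm_sin|exact: bm_sin].
have := @markov_mean _ _ _ P _ _ (n%:R ^+ 2 * cos 1 ^+ 2) mA bk.
have pos w : 0 <= (1 - cos (t * V w)) *
    ((\sum_(0 <= j < n) (-1) ^+ j * cos (j%:R * (t * V w))) ^+ 2 +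
     (\sum_(0 <= j < n) (-1) ^+ j * sin (j%:R * (t * V w))) ^+ 2).
  by rewrite mulr_ge0 ?subr_ge0 ?cos_le1 // addr_ge0 // sqr_ge0.
move=> /(_ pos) => h; have {}h := h _.
have low : forall w, [set w | `|t * V w - pi| <= n%:R^-1] w -> n%:R ^+ 2 * cos 1 ^+ 2 <= (1 - cos (t * V w)) *
    ((\sum_(0 <= j < n) (-1) ^+ j * cos (j%:R * (t * V w))) ^+ 2 +
     (\sum_(0 <= j < n) (-1) ^+ j * sin (j%:R * (t * V w))) ^+ 2).
  move=> w /=; set x := t * V w => hx.
  have pi2 := pi_ge2 R.
  have hj (j : nat) : (j <= n)%N -> cos 1 <= cos (j%:R * (x - pi)).
    move=> jn; rewrite -[cos (_ * _)]cos_norm normrM normr_nat.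
    have h1 : j%:R * `|x - pi| <= 1.
      apply: (@le_trans _ _ (n%:R * n%:R^-1)); last by rewrite divff // gt_eqF.
      by apply: ler_pM => //; rewrite ler_nat.
    by apply: ler_cos_pi; rewrite ?mulr_ge0 //; lra.
  (* The arc is within 1 of pi, where the cosine is negative: the weight does not spoil the lower
     bound. *)
  have c1 : 1 <= 1 - cos x.
    have := hj 1%N n0; rewrite mul1r.
    have -> : x = (x - pi) + pi by ring.
    by rewrite cosDpi addrK; have := cos1_gt0 R; lra.
  have hs : n%:R * cos 1 <= \sum_(0 <= j < n) (-1) ^+ j * cos (j%:R * x).
    rewrite [leLHS](_ : _ = \sum_(0 <= j < n) cos 1); last first.
      by rewrite sumr_const_nat subn0 mulr_natl.
    rewrite big_nat [leRHS]big_nat; apply: ler_sum => j /andP[_ jn].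
    by rewrite cos_natpi hj // ltnW.
  have h2 : n%:R ^+ 2 * cos 1 ^+ 2 <= (\sum_(0 <= j < n) (-1) ^+ j * cos (j%:R * x)) ^+ 2.
    rewrite -exprMn lerXn2r ?nnegrE ?mulr_ge0 ?(ltW (cos1_gt0 R)) ?(ltW nR) //.
    by apply: le_trans hs; rewrite mulr_ge0 ?(ltW (cos1_gt0 R)).
  apply: (le_trans h2); apply: (@le_trans _ _ (1 * (\sum_(0 <= j < n) (-1) ^+ j * cos (j%:R * x)) ^+ 2)).
    by rewrite mul1r.
  by rewrite ler_pM ?sqr_ge0 // lerDl sqr_ge0.
have {}h := le_trans (h low) (mean_fejer_le t n).
have hphi : 1 - phi t 1 <= t `^ alpha.
  by rewrite /stable_cf mul1r gtr0_norm //; have := expR_ge1Dx (- (t `^ alpha)); lra.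
have {}h : n%:R ^+ 2 * cos 1 ^+ 2 * pr [set w | `|t * V w - pi| <= n%:R^-1] <= n%:R * (2 * t `^ alpha).
  by apply: (le_trans h); rewrite ler_wpM2l ?(ltW nR) // ler_wpM2l.
have den : 0 < n%:R ^+ 2 * cos 1 ^+ 2 :> R by rewrite mulr_gt0 ?exprn_gt0 ?cos1_gt0.
rewrite mulrC -ler_pdivlMr // in h; apply: (le_trans h).
rewrite le_eqVlt; apply/orP; left; apply/eqP; field.
by rewrite !gt_eqF ?cos1_gt0.
Qed.

(** The frequency pi / x sends the point x to the angle pi and the half-width z to pi z / x. With n
    the integer part of x / (pi z), positive because [pi * z <= x], this is at most 1 / n; and 1 / n
    is at most 2 pi z / x, which gives the constant. *)
Lemma stable_local_bound : exists2 K : R, 0 < K & forall x z : R,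
  0 < z -> pi * z <= x -> pr [set w | `|V w - x| <= z] <= K * z * x `^ (- alpha) / x.
Proof.
have pi0 := pi_gt0 R.
exists (2 / cos 1 ^+ 2 * (pi `^ alpha * (2 * pi))).
  by rewrite !mulr_gt0 ?invr_gt0 ?exprn_gt0 ?powR_gt0 ?cos1_gt0.
move=> x z z0 zx; have x0 : 0 < x by apply: lt_le_trans zx; rewrite mulr_gt0.
have pz0 : 0 < pi * z by rewrite mulr_gt0.
pose n := Num.truncn (x / (pi * z)).
have n1 : 1 <= x / (pi * z) by rewrite ler_pdivlMr // mul1r.
have n0 : (0 < n)%N by rewrite truncn_gt0.
have nR : 0 < n%:R :> R by rewrite ltr0n.
have /andP[hn1 hn2] : n%:R <= x / (pi * z) < n.+1%:R by rewrite truncn_itv // ltW // (lt_le_trans ltr01).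
have t0 : 0 < pi / x by rewrite divr_gt0.
have mA (y u v : R) : measurable [set w | `|y * V w - u| <= v].
  rewrite (_ : [set _ | _] = (fun w => `|y * V w - u|) @^-1` `]-oo, v]%classic).
    rewrite -[X in measurable X]setTI; apply: measurableT_comp => //.
    by apply: measurable_funB => //; apply: measurable_funM.
  by apply/seteqP; split => w /=; rewrite in_itv.
apply: (@le_trans _ _ (pr [set w | `|pi / x * V w - pi| <= n%:R^-1])).
  apply: le_pr => //; first by have := mA 1 x z; under eq_fun do rewrite mul1r.
  move=> w /= hw.
  have -> : pi / x * V w - pi = pi / x * (V w - x) by field; rewrite gt_eqF.
  rewrite normrM (gtr0_norm t0).
  apply: (@le_trans _ _ (pi / x * z)); first by rewrite ler_wpM2l // ltW.
  rewrite -[leRHS]mul1r ler_pdivlMr // mulrC.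
  move: hn1; rewrite ler_pdivlMr // => hn1.
  by rewrite mulrAC mulrA ler_pdivrMr // mul1r.
apply: (le_trans (arc_pr_le t0 n0)).
rewrite powRM ?invr_ge0 ?(ltW pi0) ?(ltW x0) //.
have -> : x^-1 `^ alpha = x `^ (- alpha) by rewrite -powR_inv1 ?(ltW x0) // -powRrM mulN1r.
have hn : n%:R^-1 <= 2 * pi * z / x.
  have h1 : x < 2 * (pi * z) * n%:R.
    move: hn2; rewrite ltr_pdivrMr // => h; apply: (lt_le_trans h).
    rewrite -mulrA mulrC mulrCA ler_wpM2l ?(ltW pz0) // -natr1.
    have : 1 <= n%:R :> R by rewrite ler1n.
    lra.
  rewrite -div1r ler_pdivrMr // mulrAC ler_pdivlMr // mul1r; apply: ltW.
  by apply: lt_le_trans h1 _; rewrite mulrA.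
have pos : 0 <= 2 / cos 1 ^+ 2 * (pi `^ alpha * x `^ (- alpha)).
  by rewrite !mulr_ge0 ?invr_ge0 ?sqr_ge0 ?powR_ge0.
apply: (le_trans (ler_wpM2l pos hn)).
rewrite le_eqVlt; apply/orP; left; apply/eqP; ring.
Qed.

End local_bound.

(** * Color processes on three points *)

Lemma ord3P (Q : 'I_3 -> Prop) :
  Q ord0 -> Q (lift ord0 ord0) -> Q ord_max -> forall i, Q i.
Proof.
move=> q0 q1 q2 [[|[|[|//]]] hi].
- by rewrite (_ : Ordinal hi = ord0) //; apply/val_inj.
- by rewrite (_ : Ordinal hi = lift ord0 ord0) //; apply/val_inj.
- by rewrite (_ : Ordinal hi = ord_max) //; apply/val_inj.
Qed.

Section three_point_color_processes.
Variable R : realType.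

Let bw (p : R) (b : bool) : R := if b then p else 1 - p.

Definition coloring_weight (I : finType) (p : R) (pi : {set {set I}})
    (y : {ffun I -> bool}) : R :=
  \sum_(c : {ffun {set I} -> bool} | [ffun i => c (finset.pblock pi i)] == y)
    \prod_(B : {set I}) (if c B then p else 1 - p).

(** The constraint on the colors splits block by block, so the sum of products is a product of sums:
    a set containing no point contributes p + (1 - p) = 1, and one whose points disagree contributes
    0. *)
Lemma coloring_weightE (I : finType) (p : R) (pi : {set {set I}})
    (y : {ffun I -> bool}) : coloring_weight p pi y =
  \prod_(B : {set I}) \sum_(b : bool)
    (if [forall i, (finset.pblock pi i == B) ==> (y i == b)] then bw p b else 0).
Proof.
rewrite bigA_distr_bigA /coloring_weight big_mkcond /=; apply: eq_bigr => c _.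
case: ifPn => [/eqP hc|hc].
  apply: eq_bigr => B _; rewrite (_ : [forall i, _]) //.
  by apply/forallP => i; apply/implyP => /eqP <-; rewrite -hc ffunE.
have [i hi] : exists i, c (finset.pblock pi i) != y i.
  apply/existsP; apply: contraNT hc; rewrite negb_exists => /forallP h.
  by apply/eqP/ffunP => i; rewrite ffunE; apply/eqP; have := h i; rewrite negbK.
rewrite (bigD1 (finset.pblock pi i)) //= (_ : [forall i, _] = false) ?mul0r //.
apply/negbTE/forallPn; exists i; rewrite eqxx /=; apply: contra hi => /eqP ->.
exact: eqxx.
Qed.

Let i0 : 'I_3 := ord0.
Let i1 : 'I_3 := lift ord0 ord0.
Let i2 : 'I_3 := ord_max.

Let forall3 (Q : 'I_3 -> bool) : [forall i, Q i] = [&& Q i0, Q i1 & Q i2].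
Proof.
apply/forallP/and3P => [h|[h0 h1 h2]]; first by split.
by apply: ord3P.
Qed.

(** The booleans tell which pairs of points share a block. Only five triples are compatible with
    transitivity, one for each partition of three points, and the order of the tests tells them
    apart. *)
Definition block_weight (e01 e02 e12 : bool) (p : R) (y : {ffun 'I_3 -> bool}) : R :=
  if e01 && e12 then (if (y i0 == y i1) && (y i1 == y i2) then bw p (y i0) else 0)
  else if e01 then (if y i0 == y i1 then bw p (y i0) * bw p (y i2) else 0)
  else if e02 then (if y i0 == y i2 then bw p (y i0) * bw p (y i1) else 0)
  else if e12 then (if y i1 == y i2 then bw p (y i1) * bw p (y i0) else 0)
  else bw p (y i0) * bw p (y i1) * bw p (y i2).

Lemma coloring_weight3 (p : R) (pi : {set {set 'I_3}}) (y : {ffun 'I_3 -> bool}) :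
  coloring_weight p pi y =
  block_weight (finset.pblock pi i0 == finset.pblock pi i1)
    (finset.pblock pi i0 == finset.pblock pi i2)
    (finset.pblock pi i1 == finset.pblock pi i2) p y.
Proof.
rewrite coloring_weightE; set B0 := finset.pblock pi i0.
set B1 := finset.pblock pi i1; set B2 := finset.pblock pi i2.
pose g B := \sum_(b : bool)
    (if [forall i, (finset.pblock pi i == B) ==> (y i == b)] then bw p b else 0).
have gE B : g B = \sum_(b : bool) (if [&& (B0 == B) ==> (y i0 == b),
    (B1 == B) ==> (y i1 == b) & (B2 == B) ==> (y i2 == b)] then bw p b else 0).
  by apply: eq_bigr => b _; rewrite forall3.
have g1 B : B0 != B -> B1 != B -> B2 != B -> g B = 1.
  move=> /negbTE h0 /negbTE h1 /negbTE h2; rewrite gE big_bool h0 h1 h2 /= /bw; ring.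
rewrite -/(\prod_B g B) /block_weight.
have [e01|n01] := eqVneq B0 B1; have [e12|n12] := eqVneq B1 B2 => /=.
- rewrite (bigD1 B0) //= big1 ?mulr1; last first.
    by move=> B nB; apply: g1; rewrite -?e12 -?e01 eq_sym.
  rewrite gE big_bool -e12 -e01 eqxx /=.
  by case: (y i0); case: (y i1); case: (y i2); rewrite /= /bw ?addr0 ?add0r.
- rewrite (bigD1 B0) //= (bigD1 B2) /=; last by rewrite e01 eq_sym.
  rewrite big1 ?mulr1; last first.
    by move=> B /andP[nB nB2]; apply: g1; rewrite -?e01 eq_sym.
  rewrite !gE !big_bool -e01 eqxx /= (eq_sym B2 B0) e01 (negbTE n12) eqxx /=.
  by case: (y i0); case: (y i1); case: (y i2);
    rewrite /= /bw ?addr0 ?add0r ?mul0r.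
- have n02 : B0 != B2 by rewrite -e12.
  rewrite (negbTE n02) (bigD1 B1) //= (bigD1 B0) //=.
  rewrite big1 ?mulr1; last first.
    by move=> B /andP[nB nB2]; apply: g1; rewrite -?e12 eq_sym.
  rewrite !gE !big_bool -e12 !eqxx /= (eq_sym B1 B0) (negbTE n01) /=.
  by case: (y i0); case: (y i1); case: (y i2);
    rewrite /= /bw ?addr0 ?add0r ?mul0r.
- have [e02|n02] := eqVneq B0 B2.
    rewrite (bigD1 B0) //= (bigD1 B1) /=; last by rewrite eq_sym.
    rewrite big1 ?mulr1; last first.
      by move=> B /andP[nB nB2]; apply: g1; rewrite -?e02 eq_sym.
    rewrite !gE !big_bool -e02 !eqxx /= (eq_sym B1 B0) (negbTE n01) /=.
    by case: (y i0); case: (y i1); case: (y i2);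
      rewrite /= /bw ?addr0 ?add0r ?mul0r.
  rewrite (bigD1 B0) //= (bigD1 B1) /=; last by rewrite eq_sym.
  rewrite (bigD1 B2) /=; last by rewrite eq_sym n02 eq_sym.
  rewrite big1 ?mulr1; last first.
    by move=> B /andP[/andP[nB nB1] nB2]; apply: g1; rewrite eq_sym.
  rewrite !gE !big_bool !eqxx /= (eq_sym B1 B0) (eq_sym B2 B0) (eq_sym B2 B1).
  rewrite (negbTE n01) (negbTE n02) (negbTE n12) /=.
  by case: (y i0); case: (y i1); case: (y i2);
    rewrite /= /bw ?addr0 ?add0r ?mul0r ?mulrA.
Qed.

(** [qf] weighs the partition with one block, [qd] the one into singletons, and [qij] the one whose
    only pair is {i, j}. *)
Definition mixture3 (p qf q01 q02 q12 qd : R) (y : {ffun 'I_3 -> bool}) : R :=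
  qf * block_weight true true true p y + q01 * block_weight true false false p y +
  q02 * block_weight false true false p y + q12 * block_weight false false true p y +
  qd * block_weight false false false p y.

Variables (d : measure_display) (T : measurableType d) (P : probability T R).
Variable Y : 'I_3 -> T -> bool.

Lemma color_process_mixture3 : color_process P Y ->
  exists (p qf q01 q02 q12 qd : R),
    [/\ 0 <= p <= 1, [/\ 0 <= qf, 0 <= q01, 0 <= q02, 0 <= q12 & 0 <= qd],
        qf + q01 + q02 + q12 + qd = 1 &
        forall y : {ffun 'I_3 -> bool}, P [set w | forall i, Y i w = y i] =
          (mixture3 p qf q01 q02 q12 qd y)%:E].
Proof.
move=> [p [q [p01 [q0 _ q1] hy]]].
pose e01 (pi : {set {set 'I_3}}) := finset.pblock pi i0 == finset.pblock pi i1.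
pose e02 (pi : {set {set 'I_3}}) := finset.pblock pi i0 == finset.pblock pi i2.
pose e12 (pi : {set {set 'I_3}}) := finset.pblock pi i1 == finset.pblock pi i2.
(* The five classes follow the nested tests of [block_weight], hence are disjoint and exhaustive
   among all families [pi]. *)
pose cf pi := e01 pi && e12 pi.
pose c01 pi := ~~ cf pi && e01 pi.
pose c02 pi := [&& ~~ e01 pi & e02 pi].
pose c12 pi := [&& ~~ e01 pi, ~~ e02 pi & e12 pi].
pose cd pi := [&& ~~ e01 pi, ~~ e02 pi & ~~ e12 pi].
have split_sum (F : {set {set 'I_3}} -> R) : \sum_pi F pi =
    \sum_(pi | cf pi) F pi + \sum_(pi | c01 pi) F pi + \sum_(pi | c02 pi) F pi +
    \sum_(pi | c12 pi) F pi + \sum_(pi | cd pi) F pi.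
  rewrite [\sum_(pi | cf pi) _]big_mkcond [\sum_(pi | c01 pi) _]big_mkcond
    [\sum_(pi | c02 pi) _]big_mkcond [\sum_(pi | c12 pi) _]big_mkcond
    [\sum_(pi | cd pi) _]big_mkcond -!big_split /=; apply: eq_bigr => pi _.
  rewrite /cf /c01 /c02 /c12 /cd /cf.
  by case: (e01 pi); case: (e02 pi); case: (e12 pi); rewrite /= ?addr0 ?add0r.
exists p, (\sum_(pi | cf pi) q pi), (\sum_(pi | c01 pi) q pi), (\sum_(pi | c02 pi) q pi),
  (\sum_(pi | c12 pi) q pi), (\sum_(pi | cd pi) q pi); split => //.
- by split; apply: sumr_ge0 => pi _; exact: q0.
- by rewrite -split_sum.
- move=> y; rewrite hy; congr EFin; rewrite /divide_and_color_law split_sum.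
  rewrite /mixture3 !mulr_suml; congr (_ + _ + _ + _ + _); apply: eq_bigr => pi;
    rewrite -/(coloring_weight p pi y) coloring_weight3 -/(e01 pi) -/(e02 pi) -/(e12 pi)
      /c01 /c02 /c12 /cd /cf /block_weight.
  + by case: (e01 pi); case: (e12 pi).
  + by case: (e01 pi); case: (e12 pi).
  + by case: (e01 pi); case: (e02 pi).
  + by case: (e01 pi); case: (e02 pi); case: (e12 pi).
  + by case: (e01 pi); case: (e02 pi); case: (e12 pi).
Qed.

Lemma mixture3_color_process (p qf q01 q02 q12 qd : R) : 0 <= p <= 1 ->
  [/\ 0 <= qf, 0 <= q01, 0 <= q02, 0 <= q12 & 0 <= qd] ->
  qf + q01 + q02 + q12 + qd = 1 ->
  (forall y : {ffun 'I_3 -> bool}, P [set w | forall i, Y i w = y i] =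
          (mixture3 p qf q01 q02 q12 qd y)%:E) ->
  color_process P Y.
Proof.
move=> p01 [qf0 q010 q020 q120 qd0] q1 hy.
(* Each partition is given by the fibres of a map, so that sharing a block means having the same
   image. *)
pose part (f : 'I_3 -> 'I_3) := preim_partition f [set: 'I_3]%SET.
have partP f : finset.partition (part f) [set: 'I_3]%SET by exact: preim_partitionP.
have pblE f i j : (finset.pblock (part f) i == finset.pblock (part f) j) = (f i == f j).
  have /and3P[/eqP cov triv _] := partP f.
  rewrite eq_pblock ?cov ?finset.in_setT //.
  rewrite pblock_equivalence_partition ?finset.in_setT //.
  by apply: in3W => x y z; split => // /eqP ->.
pose ff (i : 'I_3) := i0.
pose f01 (i : 'I_3) := if i == i1 then i0 else i.
pose f02 (i : 'I_3) := if i == i2 then i0 else i.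
pose f12 (i : 'I_3) := if i == i2 then i1 else i.
pose dl (f : 'I_3 -> 'I_3) (pi : {set {set 'I_3}}) : R := (pi == part f)%:R.
exists p, (fun pi => qf * dl ff pi + q01 * dl f01 pi + q02 * dl f02 pi +
  q12 * dl f12 pi + qd * dl id pi).
have sumdl f (F : {set {set 'I_3}} -> R) : \sum_pi dl f pi * F pi = F (part f).
  rewrite (bigD1 (part f)) //= big1 => [|pi /negbTE h]; last by rewrite /dl h mul0r.
  by rewrite /dl eqxx mul1r addr0.
have sumq (F : {set {set 'I_3}} -> R) : \sum_pi (qf * dl ff pi + q01 * dl f01 pi +
    q02 * dl f02 pi + q12 * dl f12 pi + qd * dl id pi) * F pi =
    qf * F (part ff) + q01 * F (part f01) + q02 * F (part f02) + q12 * F (part f12) +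
    qd * F (part id).
  rewrite -!sumdl !mulr_sumr -!big_split /=; apply: eq_bigr => pi _; ring.
have dl0 f pi : 0 <= dl f pi by rewrite /dl ler0n.
split => //.
  split => [pi|pi npi|].
  - by rewrite !addr_ge0 // mulr_ge0.
  - have dlz f : dl f pi = 0.
      by rewrite /dl; case: eqP => // h; move: npi; rewrite h partP.
    by rewrite !dlz !mulr0 !addr0.
  - have := sumq (fun=> 1); rewrite !mulr1 q1 => <-.
    by apply: eq_bigr => pi _; rewrite mulr1.
move=> y; rewrite hy; congr EFin; rewrite /divide_and_color_law.
rewrite (sumq (coloring_weight p ^~ y)) !coloring_weight3 !pblE /mixture3.
by [].
Qed.

End three_point_color_processes.

(** * Color processes in terms of pattern probabilities *)

Section three_events.
Context d (T : measurableType d) (R : realType) (P : probability T R).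
Variable Y : 'I_3 -> T -> bool.
Local Notation pr := (pr P).
Hypothesis mY : forall i, measurable [set w | Y i w].

Let i0 : 'I_3 := ord0.
Let i1 : 'I_3 := lift ord0 ord0.
Let i2 : 'I_3 := ord_max.

(** [None] leaves a coordinate free, so that marginals are patterns too and inclusion-exclusion is a
    set of rewriting rules. *)
Definition coord_is (o : option bool) (i : 'I_3) : set T :=
  [set w | if o is Some b then Y i w = b else True].

Definition pattern (o0 o1 o2 : option bool) : set T :=
  coord_is o0 i0 `&` coord_is o1 i1 `&` coord_is o2 i2.

Lemma measurable_coord_is o i : measurable (coord_is o i).
Proof.
case: o => [[]|]; rewrite /coord_is.
- exact: mY.
- rewrite (_ : [set w | Y i w = false] = ~` [set w | Y i w]); first exact: measurableC.
  by apply/seteqP; split => w /=; [move=> ->|move/negP/negbTE].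
- by rewrite (_ : [set _ | _] = setT) //; apply/seteqP; split.
Qed.

Lemma measurable_pattern o0 o1 o2 : measurable (pattern o0 o1 o2).
Proof. by apply: measurableI; [apply: measurableI|]; exact: measurable_coord_is. Qed.

Let prI_coord_is (A : set T) i : measurable A ->
  pr (A `&` coord_is (Some false) i) = pr (A `&` coord_is None i) - pr (A `&` coord_is (Some true) i).
Proof.
move=> mA; have m b : measurable (A `&` coord_is (Some b) i).
  by apply: measurableI => //; exact: measurable_coord_is.
rewrite (_ : A `&` coord_is None i = (A `&` coord_is (Some false) i) `|` (A `&` coord_is (Some true) i)).
  rewrite prU ?addrK //; apply/seteqP; split => w //= [[_ h] [_]].
  by rewrite /coord_is /= h.
apply/seteqP; split => w /=.
  by move=> [Aw _]; rewrite /coord_is /=; case: (Y i w); [right|left].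
by move=> [] [].
Qed.

Lemma pattern_false0 o1 o2 : pr (pattern (Some false) o1 o2) =
  pr (pattern None o1 o2) - pr (pattern (Some true) o1 o2).
Proof.
rewrite /pattern; have mA : measurable (coord_is o1 i1 `&` coord_is o2 i2).
  by apply: measurableI; exact: measurable_coord_is.
have h := prI_coord_is i0 mA.
by rewrite -!setIA ![coord_is _ i0 `&` _]setIC.
Qed.

Lemma pattern_false1 o0 o2 : pr (pattern o0 (Some false) o2) =
  pr (pattern o0 None o2) - pr (pattern o0 (Some true) o2).
Proof.
rewrite /pattern; have mA : measurable (coord_is o0 i0 `&` coord_is o2 i2).
  by apply: measurableI; exact: measurable_coord_is.
have h := prI_coord_is i1 mA.
by rewrite ![coord_is o0 i0 `&` coord_is _ i1 `&` _]setIAC.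
Qed.

Lemma pattern_false2 o0 o1 : pr (pattern o0 o1 (Some false)) =
  pr (pattern o0 o1 None) - pr (pattern o0 o1 (Some true)).
Proof.
by apply: prI_coord_is; apply: measurableI; exact: measurable_coord_is.
Qed.

Definition ffun3 (b0 b1 b2 : bool) : {ffun 'I_3 -> bool} :=
  [ffun i => if i == i0 then b0 else if i == i1 then b1 else b2].

Lemma pr_ffun3 (y : {ffun 'I_3 -> bool}) : P [set w | forall i, Y i w = y i] =
  (pr (pattern (Some (y i0)) (Some (y i1)) (Some (y i2))))%:E.
Proof.
rewrite -pr_fin; last exact: measurable_pattern.
congr (P _); apply/seteqP; split => w /=; first by move=> h; rewrite /pattern /coord_is /= !h.
by move=> [[h0 h1] h2]; apply: ord3P.
Qed.

(** In the opposite patterns 001 and 110 only [q01] and [qd] intervene, and the factors u1 = p and 1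
    - u1 = 1 - p cancel [qd]: the difference of the two sides is
    [q01 * (p * (1 - p) * (1 - 2 * p))]. *)
Lemma color_process_pattern : color_process P Y ->
  pr (pattern (Some true) None None) <= 2^-1 ->
  pr (pattern (Some true) None None) * pr (pattern (Some false) (Some false) (Some true)) <=
  (1 - pr (pattern (Some true) None None)) * pr (pattern (Some true) (Some true) (Some false)).
Proof.
move=> /color_process_mixture3 [p [qf [q01 [q02 [q12 [qd [/andP[p0 p1] [qf0 q010 q020 q120 qd0] q1 hy]]]]]]].
have val b0 b1 b2 : pr (pattern (Some b0) (Some b1) (Some b2)) =
    mixture3 p qf q01 q02 q12 qd (ffun3 b0 b1 b2).
  by apply: EFin_inj; rewrite -hy pr_ffun3 !ffunE.
have -> : pr (pattern (Some true) None None) = p.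
  have e1 := pattern_false2 (Some true) None.
  have e2 := pattern_false1 (Some true) (Some true).
  have e3 := pattern_false1 (Some true) (Some false).
  have v1 := val true true true; have v2 := val true true false.
  have v3 := val true false true; have v4 := val true false false.
  rewrite /mixture3 /block_weight !ffunE /= in v1 v2 v3 v4.
  have qdE : qd = 1 - qf - q01 - q02 - q12 by lra.
  rewrite qdE in v1 v2 v3 v4.
  have s1 : pr (pattern (Some true) None None) =
    pr (pattern (Some true) (Some true) (Some true)) + pr (pattern (Some true) (Some false) (Some true)) +
    pr (pattern (Some true) (Some true) (Some false)) + pr (pattern (Some true) (Some false) (Some false)) by lra.
  rewrite s1 v1 v2 v3 v4; ring.
move=> p2; rewrite !val /mixture3 /block_weight !ffunE /=.
rewrite -subr_ge0 (_ : _ - _ = q01 * (p * (1 - p) * (1 - 2 * p))); last by ring.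
by rewrite !mulr_ge0 //; lra.
Qed.

(** With p = u1 and one weight q2 for the three pairs, P(100) = q2 p (1 - p) + qd p (1 - p)^2 and
    P(110) = q2 p (1 - p) + qd p^2 (1 - p) are solved for qd and q2. The last three inequalities
    make qd, q2 and qf nonnegative, in this order. *)
Lemma exchangeable_color_process (u1 u2 u3 : R) :
  [/\ pr (pattern (Some true) None None) = u1, pr (pattern None (Some true) None) = u1 &
      pr (pattern None None (Some true)) = u1] ->
  [/\ pr (pattern (Some true) (Some true) None) = u2,
      pr (pattern (Some true) None (Some true)) = u2 &
      pr (pattern None (Some true) (Some true)) = u2] ->
  pr (pattern (Some true) (Some true) (Some true)) = u3 ->
  0 < u1 -> u1 < 2^-1 -> u2 - u3 <= u1 - 2 * u2 + u3 ->
  u1 * (u1 - 2 * u2 + u3) <= (1 - u1) * (u2 - u3) ->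
  3 * (u2 - u3) * (1 - 2 * u1) + (u1 - 2 * u2 + u3 - (u2 - u3)) <= u1 * (1 - u1) * (1 - 2 * u1) ->
  color_process P Y.
Proof.
move=> [h100 h010 h001] [h110 h101 h011] h111 u10 u12 r12 hq hf.
have h000 : pr (pattern None None None) = 1.
  by rewrite -(prT P); congr pr; apply/seteqP; split => w //= _; split.
pose r1 := u1 - 2 * u2 + u3; pose r2 := u2 - u3.
have p10 : 0 < 1 - u1 by lra.
have p20 : 0 < 1 - 2 * u1 by lra.
have pp : 0 < u1 * (1 - u1) by rewrite mulr_gt0.
pose qd := (r1 - r2) / (u1 * (1 - u1) * (1 - 2 * u1)).
pose q2 := (r2 - qd * u1 ^+ 2 * (1 - u1)) / (u1 * (1 - u1)).
have k2 : qd * (u1 * (1 - u1) * (1 - 2 * u1)) = r1 - r2.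
  by rewrite /qd divfK // gt_eqF // mulr_gt0.
have k1 : q2 * (u1 * (1 - u1)) = r2 - qd * u1 ^+ 2 * (1 - u1).
  by rewrite /q2 divfK // gt_eqF.
have qd0 : 0 <= qd by rewrite divr_ge0 ?subr_ge0 // ltW // mulr_gt0.
have q20 : 0 <= q2.
  rewrite divr_ge0 ?(ltW pp) //.
  rewrite -(pmulr_lge0 _ p20) (_ : _ * _ = (1 - u1) * r2 - u1 * r1); first by rewrite subr_ge0.
  have -> : (r2 - qd * u1 ^+ 2 * (1 - u1)) * (1 - 2 * u1) =
      r2 * (1 - 2 * u1) - u1 * (qd * (u1 * (1 - u1) * (1 - 2 * u1))) by ring.
  by rewrite k2; ring.
have qf0 : 0 <= 1 - 3 * q2 - qd.
  have p3 : 0 < u1 * (1 - u1) * (1 - 2 * u1) by rewrite mulr_gt0.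
  rewrite -(pmulr_lge0 _ p3).
  have -> : (1 - 3 * q2 - qd) * (u1 * (1 - u1) * (1 - 2 * u1)) =
    u1 * (1 - u1) * (1 - 2 * u1) - 3 * (q2 * (u1 * (1 - u1))) * (1 - 2 * u1) -
    qd * (u1 * (1 - u1) * (1 - 2 * u1)) by ring.
  rewrite k1 k2.
  (* Three times this term is the margin that [hf] gives away. *)
  have e : 0 <= qd * u1 ^+ 2 * (1 - u1) * (1 - 2 * u1).
    exact: (mulr_ge0 (mulr_ge0 (mulr_ge0 qd0 (sqr_ge0 u1)) (ltW p10)) (ltW p20)).
  rewrite /r1 /r2 in e *; lra.
apply: (@mixture3_color_process _ _ _ _ _ u1 (1 - 3 * q2 - qd) q2 q2 q2 qd).
- by rewrite ltW //=; lra.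
- by split.
- by ring.
move=> y; rewrite pr_ffun3; congr EFin; rewrite /mixture3 /block_weight.
(* The two defining equations are expanded into monomials, in which the eight remaining identities
   are linear. *)
have k1' : q2 * u1 - q2 * u1 ^+ 2 = r2 - qd * u1 ^+ 2 + qd * u1 ^+ 3.
  have -> : q2 * u1 - q2 * u1 ^+ 2 = q2 * (u1 * (1 - u1)) by ring.
  by rewrite k1; ring.
have k2' : qd * u1 - 3 * (qd * u1 ^+ 2) + 2 * (qd * u1 ^+ 3) = r1 - r2.
  by rewrite -k2; ring.
rewrite /r1 /r2 in k1' k2'.
case: (y i0); case: (y i1); case: (y i2) => /=;
  rewrite ?pattern_false2 ?pattern_false1 ?pattern_false0 ?h000 ?h100 ?h010 ?h001 ?h110 ?h101 ?h011 ?h111;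
  lra.
Qed.

End three_events.

(** * Independence and exchangeability *)

Section independence.
Context d (T : measurableType d) (R : realType) (P : probability T R).

Lemma mutually_independent_pr (S : 'I_4 -> {RV P >-> R}) (B0 : set R)
    (B : 'I_3 -> set R) : mutually_independent S ->
  measurable B0 -> (forall i, measurable (B i)) ->
  pr P [set w | B0 (S ord0 w) /\ forall i, B i (S (lift ord0 i) w)] =
  pr P [set w | B0 (S ord0 w)] * \prod_(i < 3) pr P [set w | B i (S (lift ord0 i) w)].
Proof.
move=> hind mB0 mB.
pose C (k : 'I_4) := if unlift ord0 k is Some i then B i else B0.
have C0 : C ord0 = B0 by rewrite /C unlift_none.
have CS i : C (lift ord0 i) = B i by rewrite /C liftK.
have mC k : measurable (C k) by rewrite /C; case: (unlift ord0 k).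
have mpre k : measurable (S k @^-1` C k) by rewrite -[X in measurable X]setTI; exact: measurable_funPT.
have := hind [set: 'I_4]%SET C mC.
rewrite (_ : \bigcap_(i in _) _ =
  [set w | B0 (S ord0 w) /\ forall i, B i (S (lift ord0 i) w)]); last first.
  apply/seteqP; split => w /=.
    move=> h; split; first by have := h ord0; rewrite /= C0 finset.in_setT; apply.
    by move=> i; have := h (lift ord0 i); rewrite /= CS finset.in_setT; apply.
  move=> [h0 h] k _ /=; case: (unliftP ord0 k) => [j ->|->]; first by rewrite CS.
  by rewrite C0.
move=> h; rewrite /pr {}h.
rewrite (eq_bigl predT) => [|k]; last by rewrite finset.in_setT.
rewrite (eq_bigr (fun k => (pr P (S k @^-1` C k))%:E)) => [|k _]; last exact: pr_fin.
rewrite prodEFin /= big_ord_recl /= C0; congr (_ * _).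
by apply: eq_bigr => i _; rewrite CS.
Qed.

End independence.

(** * Exchangeability through discretisation of the common factor *)

Section exchangeability.
Context d (T : measurableType d) (R : realType) (P : probability T R).
Variables (U : T -> R) (V : 'I_3 -> T -> R) (F : R -> R) (a b : R).
Local Notation mean := (mean P).
Local Notation pr := (pr P).
Hypothesis mU : measurable_fun setT U.
Hypothesis mV : forall i, measurable_fun setT (V i).
Hypothesis hind : forall (B0 : set R) (B : 'I_3 -> set R), measurable B0 ->
  (forall i, measurable (B i)) ->
  pr [set w | B0 (U w) /\ forall i, B i (V i w)] =
  pr [set w | B0 (U w)] * \prod_(i < 3) pr [set w | B i (V i w)].
Hypothesis hF : forall i x, pr [set w | x < V i w] = F x.
Hypotheses (a0 : 0 < a) (b0 : 0 < b).

Let measurable_pre (W : T -> R) (B : set R) : measurable_fun setT W ->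
  measurable B -> measurable [set w | B (W w)].
Proof. by move=> mW mB; rewrite -[X in measurable X]setTI; exact: mW. Qed.

Let measurable_box (B0 : set R) (B : 'I_3 -> set R) : measurable B0 ->
  (forall i, measurable (B i)) -> measurable [set w | B0 (U w) /\ forall i, B i (V i w)].
Proof.
move=> mB0 mB; rewrite (_ : [set _ | _] = [set w | B0 (U w)] `&`
    \bigcap_(i in setT) [set w | B i (V i w)]); last first.
  by apply/seteqP; split => w /= [h1 h2]; split => // i; [move=> _; exact: h2|exact: h2].
apply: measurableI; first exact: measurable_pre.
by apply: fin_bigcap_measurable => // i _; exact: measurable_pre.
Qed.

(* On the cell [k <= (U + N) * N < k + 1] the factor U is replaced by the left
   end point [k / N - N] of the range it determines. *)
Let cell (N k : nat) : set R := [set u | k%:R <= (u + N%:R) * N%:R < k%:R + 1].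

Let cell_val (N k : nat) : R := k%:R / N%:R - N%:R.

Let side (c : pred 'I_3) (h : R) (N k : nat) (i : 'I_3) : set R :=
  if c i then `]((h - a * cell_val N k) / b), +oo[%classic else setT.

Let measurable_cell N k : measurable (cell N k).
Proof.
rewrite (_ : cell N k = (fun u => (u + N%:R) * N%:R) @^-1` `[k%:R, k%:R + 1[%classic); last first.
  by apply/seteqP; split => u /=; rewrite in_itv.
rewrite -[X in measurable X]setTI.
have mf : measurable_fun setT (fun u : R => (u + N%:R) * N%:R).
  by apply: measurable_funM => //; apply: measurable_funD.
exact: mf.
Qed.

Let measurable_side c h N k i : measurable (side c h N k i).
Proof. by rewrite /side; case: ifP. Qed.

(** With N = n + 1, the 2 N^2 cells of length 1 / N cover the values of the factor from -N to N. *)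
Let approx (c : pred 'I_3) (h : R) (n : nat) (w : T) : R :=
  \sum_(k < (2 * n.+1 ^ 2)%N) \1_[set w | cell n.+1 k (U w) /\
    forall i, side c h n.+1 k i (V i w)] w.

Let mean_approx c h n : mean (approx c h n) =
  \sum_(k < (2 * n.+1 ^ 2)%N) pr [set w | cell n.+1 k (U w)] *
    F ((h - a * cell_val n.+1 k) / b) ^+ #|c|.
Proof.
rewrite /approx mean_sum => [|k]; last first.
  by apply: bm_indic; apply: measurable_box => //; exact: measurable_side.
apply: eq_bigr => k _; rewrite mean_indic; last by apply: measurable_box => //; exact: measurable_side.
rewrite (hind (measurable_cell _ _) (measurable_side c h n.+1 k)).
congr (_ * _); rewrite -prodr_const [RHS]big_mkcond; apply: eq_bigr => i _.
rewrite /side unfold_in; case: ifP => _; last exact: prT.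
by rewrite -(hF i); congr pr; apply/seteqP; split => w /=; rewrite in_itv /= andbT.
Qed.

Let approxE c h n w (k : nat) : (k < 2 * n.+1 ^ 2)%N -> cell n.+1 k (U w) ->
  approx c h n w = [forall i, c i ==> ((h - a * cell_val n.+1 k) / b < V i w)]%:R.
Proof.
move=> kn hk; rewrite /approx (bigD1 (Ordinal kn)) //= big1 ?addr0 => [|j jk]; last first.
  rewrite indicE (_ : _ \in _ = false) //; apply/negbTE; rewrite notin_setE /= => -[hj _].
  move: hk hj jk; rewrite /cell /= => /andP[k1 k2] /andP[j1 j2].
  rewrite -val_eqE /= neq_ltn => /orP[] jk.
    have : j%:R + 1 <= k%:R :> R by rewrite natr1 ler_nat.
    lra.
  have : k%:R + 1 <= j%:R :> R by rewrite natr1 ler_nat.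
  lra.
rewrite indicE; congr (_%:R); congr nat_of_bool; apply/idP/forallP.
  move=> /set_mem /= [_ h1] i; apply/implyP => ci; have := h1 i.
  by rewrite /side ci /= in_itv /= andbT.
move=> h1; apply/mem_set => /=; split => // i; rewrite /side.
by case: ifP => // ci; rewrite /= in_itv /= andbT; have := h1 i; rewrite ci.
Qed.

Let approx0 c h n w : ~ (0 <= (U w + n.+1%:R) * n.+1%:R < (2 * n.+1 ^ 2)%:R) ->
  approx c h n w = 0.
Proof.
move=> hw; apply: big1 => k _; rewrite indicE (_ : _ \in _ = false) //.
apply/negbTE; rewrite notin_setE /= => -[/andP[h1 h2] _]; apply: hw.
rewrite (le_trans _ h1) ?ler0n //=; apply: (lt_le_trans h2).
by rewrite natr1 ler_nat.
Qed.

Let approx_cell n w : 0 <= (U w + n.+1%:R) * n.+1%:R < (2 * n.+1 ^ 2)%:R ->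
  exists2 k, (k < 2 * n.+1 ^ 2)%N & cell n.+1 k (U w).
Proof.
move=> /andP[h1 h2]; have h3 := truncn_itv h1.
exists (Num.truncn ((U w + n.+1%:R) * n.+1%:R)).
  by case/andP: h3 => h3 _; rewrite -(ltr_nat R) (le_lt_trans h3).
by move: h3; rewrite /cell /= natr1.
Qed.

Let measurable_all_gt (c : pred 'I_3) (h : R) :
  measurable [set w | forall i, c i -> h < a * U w + b * V i w].
Proof.
rewrite (_ : [set _ | _] = \bigcap_(i in setT) (if c i then
    [set w | h < a * U w + b * V i w] else setT)); last first.
  apply/seteqP; split => w /= hw i; last by move=> ci; have := hw i Logic.I; rewrite ci.
  by move=> _; have := hw i; case: ifP => // _; apply.
apply: fin_bigcap_measurable => // i _; case: ifP => // _.
rewrite (_ : [set _ | _] = (fun w => a * U w + b * V i w) @^-1` `]h, +oo[%classic).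
  rewrite -[X in measurable X]setTI.
  have mf : measurable_fun setT (fun w => a * U w + b * V i w).
    by apply: measurable_funD; apply: measurable_funM.
  exact: mf.
by apply/seteqP; split => w /=; rewrite in_itv /= andbT.
Qed.

(** Rounding [U] down by less than 1 / (n + 1) never creates an exceedance, and a strict exceedance
    persists once the mesh is fine enough: at each point the approximation is eventually exact. *)
Let approx_cvg c h : mean (approx c h n) @[n --> \oo] -->
  pr [set w | forall i, c i -> h < a * U w + b * V i w].
Proof.
apply: mean_cvg_indic.
- exact: measurable_all_gt.
- move=> n; rewrite /approx; apply: bm_sum => k; apply: bm_indic; exact: measurable_box.
- move=> n w; have [/approx_cell [k kn hk]|/negP hn] := boolP (0 <= (U w + n.+1%:R) * n.+1%:R < (2 * n.+1 ^ 2)%:R).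
    by rewrite (approxE _ _ kn hk); case: [forall _, _]; rewrite ?normr1 ?normr0.
  by rewrite approx0 ?normr0.
- move=> w.
  have cell_bounds n k : cell n.+1 k (U w) -> cell_val n.+1 k <= U w < cell_val n.+1 k + n.+1%:R^-1.
    move=> /andP[]; have n0 : 0 < n.+1%:R :> R by rewrite ltr0n.
    rewrite -ler_pdivrMr // => h1; rewrite -ltr_pdivlMr // mulrDl mul1r => h2.
    move: h1 h2; rewrite /cell_val; move: (k%:R / n.+1%:R : R) (n.+1%:R^-1 : R) (n.+1%:R : R) => x y z h1 h2.
    by apply/andP; split; lra.
  have range : \forall n \near \oo, 0 <= (U w + n.+1%:R) * n.+1%:R < (2 * n.+1 ^ 2)%:R.
    have := nbhs_infty_ger `|U w|; apply: filterS => n hn.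
    have n1 : `|U w| < n.+1%:R by rewrite -natr1; lra.
    move: n1; rewrite ltr_norml => /andP[n1 n2].
    have n0 : 0 < n.+1%:R :> R by rewrite ltr0n.
    rewrite natrM natrX expr2 mulrA ltr_pM2r //; apply/andP; split; last by lra.
    by rewrite mulr_ge0 ?ler0n //; lra.
  rewrite indicE; have [/set_mem /= hw|] := boolP (w \in _).
    have gap : \forall n \near \oo, forall i, c i -> a * n.+1%:R^-1 < a * U w + b * V i w - h.
      have gap1 i : \forall n \near \oo, c i -> a * n.+1%:R^-1 < a * U w + b * V i w - h.
        have [ci|nci] := boolP (c i); last by apply: nearW.
        have p0 : 0 < (a * U w + b * V i w - h) / a by rewrite divr_gt0 // subr_gt0 hw.
        have := near_infty_natSinv_lt (PosNum p0); apply: filterS => n /= hn _.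
        by rewrite mulrC -ltr_pdivlMr.
      exact: filter_forall.
    near=> n; have /approx_cell [k kn hk] : 0 <= (U w + n.+1%:R) * n.+1%:R < (2 * n.+1 ^ 2)%:R by near: n; exact: range.
    have /andP[v1 v2] := cell_bounds _ _ hk.
    rewrite (approxE _ _ kn hk) (_ : [forall i, _] = true) //; apply/forallP => i; apply/implyP => ci.
    rewrite ltr_pdivrMr //.
    have g : a * n.+1%:R^-1 < a * U w + b * V i w - h.
      by move: i ci; near: n; exact: gap.
    have v3 : a * U w < a * cell_val n.+1 k + a * n.+1%:R^-1 by rewrite -mulrDr ltr_pM2l.
    move: g v3; move: (a * n.+1%:R^-1) (a * cell_val n.+1 k) => e v g v3.
    by rewrite mulrC; lra.
  rewrite notin_setE /= => nw; near=> n.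
  have /approx_cell [k kn hk] : 0 <= (U w + n.+1%:R) * n.+1%:R < (2 * n.+1 ^ 2)%:R by near: n; exact: range.
  have /andP[v1 v2] := cell_bounds _ _ hk.
  rewrite (approxE _ _ kn hk) (_ : [forall i, _] = false) //; apply/negbTE/negP => /forallP hall.
  apply: nw => i ci; have := hall i; rewrite ci /= ltr_pdivrMr //.
  have : a * cell_val n.+1 k <= a * U w by rewrite ler_pM2l.
  by move: (a * cell_val n.+1 k) => v ? ?; lra.
Unshelve. all: by end_near. Qed.

(** This replaces conditioning on [U]: the discretised probabilities are sums of products in which
    the set of coordinates enters through its cardinal only. *)
Lemma exchangeable_gt (c c' : pred 'I_3) (h : R) : #|c| = #|c'| ->
  pr [set w | forall i, c i -> h < a * U w + b * V i w] =
  pr [set w | forall i, c' i -> h < a * U w + b * V i w].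
Proof.
move=> cc'; have h1 := @approx_cvg c h; have h2 := @approx_cvg c' h.
have e : (fun n => mean (approx c h n)) = (fun n => mean (approx c' h n)).
  by apply/funext => n; rewrite !mean_approx cc'.
rewrite e in h1; apply: cvg_unique h1 h2; exact: norm_hausdorff.
Qed.

End exchangeability.

(** * Exceedances in the one-factor model *)

Section tail_limits.
Context d (T : measurableType d) (R : realType) (P : probability T R).
Variables (F : R -> R) (alpha c : R).
Local Notation pr := (pr P).

Definition symmetric_tail (W : T -> R) : Prop :=
  [/\ measurable_fun setT W, forall x, pr [set w | x < W w] = F x &
      forall x, pr [set w | W w < - x] = F x].

Hypothesis alpha0 : 0 < alpha.
Hypothesis hF : x `^ alpha * F x @[x --> +oo] --> c.

Lemma measurable_gt (W : T -> R) (x : R) : measurable_fun setT W ->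
  measurable [set w | x < W w].
Proof.
move=> mW; rewrite (_ : [set _ | _] = W @^-1` `]x, +oo[%classic).
  by rewrite -[X in measurable X]setTI; exact: mW.
by apply/seteqP; split => w /=; rewrite in_itv /= andbT.
Qed.

Lemma measurable_lt (W : T -> R) (x : R) : measurable_fun setT W ->
  measurable [set w | W w < x].
Proof.
move=> mW; rewrite (_ : [set _ | _] = W @^-1` `]-oo, x[%classic).
  by rewrite -[X in measurable X]setTI; exact: mW.
by apply/seteqP; split => w /=; rewrite in_itv.
Qed.

Lemma cvg_scale_pinfty (k : R) : 0 < k -> k * h @[h --> +oo] --> +oo.
Proof.
move=> k0; apply/cvgryPge => A; near=> h.
have hh : A / k <= h by near: h; apply: nbhs_pinfty_ge; exact: num_real.
by rewrite mulrC -ler_pdivrMr.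
Unshelve. all: by end_near. Qed.

Lemma tail_scale (k : R) : 0 < k ->
  h `^ alpha * F (k * h) @[h --> +oo] --> c * k `^ (- alpha).
Proof.
move=> k0.
have h1 : (k * h) `^ alpha * F (k * h) @[h --> +oo] --> c.
  exact: (cvg_comp _ _ (cvg_scale_pinfty k0) hF).
apply: (@cvg_trans _ ((fun h => ((k * h) `^ alpha * F (k * h)) * k `^ (- alpha)) @ +oo)); last first.
  by apply: cvgM; [exact: h1|exact: cvg_cst].
apply: near_eq_cvg; near=> h; have h0 : 0 < h by near: h; exact: nbhs_pinfty_gt.
rewrite powRM ?(ltW k0) ?(ltW h0) // powRN.
have : k `^ alpha != 0 by rewrite gt_eqF // powR_gt0.
by move: (k `^ alpha) (h `^ alpha) (F _) => x y z x0; field.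
Unshelve. all: by end_near. Qed.

Lemma powR_scaleN (k y : R) : 0 < k -> 0 < y ->
  (y / k) `^ (- alpha) = k `^ alpha * y `^ (- alpha).
Proof.
move=> k0 y0; rewrite powRM ?invr_ge0 ?(ltW k0) ?(ltW y0) // mulrC; congr (_ * _).
by rewrite -powR_inv1 ?(ltW k0) // -powRrM mulN1r opprK.
Qed.

Lemma gt_tail_cvg (W : T -> R) (k y : R) : symmetric_tail W -> 0 < k -> 0 < y ->
  h `^ alpha * pr [set w | y * h < k * W w] @[h --> +oo] --> c * (k `^ alpha * y `^ (- alpha)).
Proof.
move=> [mW hW _] k0 y0; rewrite -powR_scaleN //.
rewrite (_ : (fun h => _) = (fun h => h `^ alpha * F (y / k * h))); last first.
  apply/funext => h; congr (_ * _); rewrite -hW; congr pr; apply/seteqP.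
  by split => w /=; rewrite mulrAC ltr_pdivrMr // [_ * k]mulrC.
by apply: tail_scale; rewrite divr_gt0.
Qed.

Lemma lt_tail_cvg (W : T -> R) (k y : R) : symmetric_tail W -> 0 < k -> 0 < y ->
  h `^ alpha * pr [set w | k * W w < - (y * h)] @[h --> +oo] --> c * (k `^ alpha * y `^ (- alpha)).
Proof.
move=> [mW _ hW] k0 y0; rewrite -powR_scaleN //.
rewrite (_ : (fun h => _) = (fun h => h `^ alpha * F (y / k * h))); last first.
  apply/funext => h; congr (_ * _); rewrite -hW; congr pr; apply/seteqP.
  have -> : - (y / k * h) = - (y * h) / k by rewrite mulrAC mulNr.
  by split => w /=; rewrite ltr_pdivlMr // [_ * k]mulrC.
by apply: tail_scale; rewrite divr_gt0.
Qed.

Lemma tail_vanish (f : R -> R) (l : R) : h `^ alpha * f h @[h --> +oo] --> l ->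
  f h @[h --> +oo] --> 0.
Proof.
move=> hf; have h1 := powR_inv_cvg0 alpha0.
apply: (@cvg_trans _ ((fun h => h `^ (- alpha) * (h `^ alpha * f h)) @ +oo)); last first.
  by rewrite -(mul0r l); apply: cvgM; [exact: h1|exact: hf].
apply: near_eq_cvg; near=> h; have h0 : 0 < h by near: h; exact: nbhs_pinfty_gt.
by rewrite powRN mulKf // gt_eqF // powR_gt0.
Unshelve. all: by end_near. Qed.

Lemma le_one_cvg (W : T -> R) (k y : R) : symmetric_tail W -> 0 < k -> 0 < y ->
  pr [set w | k * W w <= y * h] @[h --> +oo] --> (1 : R).
Proof.
move=> hW k0 y0; have [mW _ _] := hW.
rewrite (_ : (fun h => _) = (fun h => 1 - pr [set w | y * h < k * W w])); last first.
  apply/funext => h; rewrite -prC; last by apply: measurable_gt; exact: measurable_funM.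
  by congr pr; apply/seteqP; split => w /=; rewrite leNgt => /negP.
rewrite -[X in _ --> X]subr0; apply: cvgB; first exact: cvg_cst.
exact: tail_vanish (gt_tail_cvg hW k0 y0).
Qed.

Lemma gt_one_cvg (W : T -> R) (k y : R) : symmetric_tail W -> 0 < k -> 0 < y ->
  pr [set w | - (y * h) < k * W w] @[h --> +oo] --> (1 : R).
Proof.
move=> hW k0 y0; have [mW _ _] := hW.
(* The complement is a non-strict inequality while [lt_tail_cvg] concerns strict ones; halving [y]
   absorbs the boundary. *)
have y20 : 0 < y / 2 by rewrite divr_gt0.
have mkW : measurable_fun setT (fun w => k * W w) by exact: measurable_funM.
apply: (@squeeze_cvgr _ _ _ _ (fun h => 1 - pr [set w | k * W w < - (y / 2 * h)]) (fun=> 1)).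
- near=> h; have h0 : 0 < h by near: h; exact: nbhs_pinfty_gt.
  apply/andP; split; last by apply: pr_le1; exact: measurable_gt.
  rewrite -prC; last exact: measurable_lt.
  apply: le_pr; [by apply: measurableC; exact: measurable_lt|exact: measurable_gt|].
  move=> w /= /negP; rewrite -leNgt => hw; apply: lt_le_trans hw.
  by rewrite ltrN2 ltr_pM2r // ltr_pdivrMr // ltr_pMr // ltr1n.
- rewrite -[X in _ --> X]subr0; apply: cvgB; first exact: cvg_cst.
  exact: tail_vanish (lt_tail_cvg hW k0 y20).
- exact: cvg_cst.
Unshelve. all: by end_near. Qed.

Lemma mid_one_cvg (W : T -> R) (k y : R) : symmetric_tail W -> 0 < k -> 0 < y ->
  pr [set w | - (y * h) < k * W w <= y * h] @[h --> +oo] --> (1 : R).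
Proof.
move=> hW k0 y0; have [mW _ _] := hW.
have mkW : measurable_fun setT (fun w => k * W w) by exact: measurable_funM.
apply: (@cvg_trans _ ((fun h => pr [set w | - (y * h) < k * W w] - pr [set w | y * h < k * W w]) @ +oo)).
  apply: near_eq_cvg; near=> h; have h0 : 0 < h by near: h; exact: nbhs_pinfty_gt.
  have e : [set w | - (y * h) < k * W w] =
      [set w | - (y * h) < k * W w <= y * h] `|` [set w | y * h < k * W w].
    apply/seteqP; split => w /=.
      by move=> hw; rewrite hw /=; have [|] := ltP (y * h) (k * W w); [right|left].
    move=> [/andP[]//|]; apply: lt_trans.
    have yh : 0 < y * h by exact: mulr_gt0.
    lra.
  rewrite e prU ?addrK //.
  - rewrite (_ : [set _ | _] = [set w | - (y * h) < k * W w] `\` [set w | y * h < k * W w]).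
      by apply: measurableD; exact: measurable_gt.
    apply/seteqP; split => w /=.
      by move=> /andP[h1 h2]; split => //; apply/negP; rewrite -leNgt.
    by move=> [h1 /negP]; rewrite -leNgt h1.
  - exact: measurable_gt.
  - by apply/seteqP; split => w //= [/andP[_ h1] h2]; lra.
have h1 := cvgB (gt_one_cvg hW k0 y0) (tail_vanish (gt_tail_cvg hW k0 y0)).
rewrite subr0 in h1; exact: h1.
Unshelve. all: by end_near. Qed.

End tail_limits.

(** * Finite unions of events, finite sums of limits and double limits *)

Section finite_unions.
Context d (T : measurableType d) (R : realType) (P : probability T R).
Variable B : nat -> set T.
Hypothesis mB : forall k, measurable (B k).

Let prefix (m : nat) : set T := [set w | exists2 k, (k < m)%N & B k w].

Let prefix0 : prefix 0 = set0.
Proof. by apply/seteqP; split => w //= []. Qed.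

Let prefixS m : prefix m.+1 = prefix m `|` B m.
Proof.
apply/seteqP; split => w /=.
  by move=> [k]; rewrite ltnS leq_eqVlt => /orP[/eqP ->|km] h; [right|left; exists k].
by move=> [[k km h]|h]; [exists k => //; exact: ltnW|exists m].
Qed.

Lemma measurable_prefix m : measurable (prefix m).
Proof.
elim: m => [|m IH]; first by rewrite prefix0.
by rewrite prefixS; exact: measurableU.
Qed.

Lemma pr_prefix_le m : pr P (prefix m) <= \sum_(0 <= k < m) pr P (B k).
Proof.
elim: m => [|m IH]; first by rewrite prefix0 /pr measure0 big_nil.
rewrite prefixS big_nat_recr //=; apply: le_trans (prU_le P (measurable_prefix m) (mB m)) _.
by rewrite lerD2r.
Qed.

Lemma sum_pr_le m (E : set T) : measurable E ->
  (forall k, (k < m)%N -> B k `<=` E) ->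
  (forall j k, (j < k)%N -> (k < m)%N -> B j `&` B k = set0) ->
  \sum_(0 <= k < m) pr P (B k) <= pr P E.
Proof.
move=> mE BE disj; have -> : \sum_(0 <= k < m) pr P (B k) = pr P (prefix m).
  elim: m BE disj => [|m IH] BE disj; first by rewrite prefix0 /pr measure0 big_nil.
  rewrite prefixS prU //; [|exact: measurable_prefix|].
    rewrite big_nat_recr //= IH // => [k km|j k jk km]; first by apply: BE; exact: ltnW.
    by apply: disj => //; exact: ltnW.
  apply/seteqP; split => w //= [[k km hk] hm].
  by have := disj k m km (ltnSn m); rewrite predeqE => /(_ w) [+ _]; apply.
apply: le_pr => //; first exact: measurable_prefix.
by move=> w [k km]; exact: BE.
Qed.

End finite_unions.

Lemma cvg_sum_nat (R : realType) (U : Type) (G : set_system U) {FG : Filter G}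
    (m n : nat) (f : nat -> U -> R) (l : nat -> R) :
  (forall k, (m <= k < n)%N -> f k x @[x --> G] --> l k) ->
  \sum_(m <= k < n) f k x @[x --> G] --> \sum_(m <= k < n) l k.
Proof.
have seqP (s : seq nat) : (forall k, k \in s -> f k x @[x --> G] --> l k) ->
    \sum_(k <- s) f k x @[x --> G] --> \sum_(k <- s) l k.
  elim: s => [|k s IH] h.
    by under eq_fun do rewrite big_nil; rewrite big_nil; exact: cvg_cst.
  under eq_fun do rewrite big_cons; rewrite big_cons; apply: cvgD.
    by apply: h; rewrite inE eqxx.
  by apply: IH => j js; apply: h; rewrite inE js orbT.
by move=> h; apply: seqP => k; rewrite mem_index_iota; exact: h.
Qed.

Section asymptotic_bounds.
Variable R : realType.

Lemma powR_cvg1 (U : Type) (G : set_system U) {FG : Filter G} (f : U -> R) (r : R) :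
  f x @[x --> G] --> (1 : R) -> f x `^ r @[x --> G] --> (1 : R).
Proof.
move=> hf; have cln : ln (f x) @[x --> G] --> (0 : R).
  by rewrite -ln1; apply: (cvg_comp _ _ hf); exact: continuous_ln.
have : expR (r * ln (f x)) @[x --> G] --> (1 : R).
  have rln : r * ln (f x) @[x --> G] --> r * 0 by apply: cvgM; [exact: cvg_cst|exact: cln].
  rewrite mulr0 in rln; rewrite -expR0.
  exact: (cvg_comp _ _ rln (@continuous_expR R 0)).
apply: cvg_trans; apply: near_eq_cvg.
have f0 : \forall x \near G, 0 < f x by exact: (cvgr_gt (1 : R) hf 0 ltr01).
by apply: filterS f0 => x x0; rewrite /powR gt_eqF.
Qed.

Lemma cvgM1 (U : Type) (G : set_system U) {FG : Filter G} (f g : U -> R) (l : R) :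
  f x @[x --> G] --> l -> g x @[x --> G] --> (1 : R) -> f x * g x @[x --> G] --> l.
Proof. by move=> hf hg; rewrite -(mulr1 l); apply: cvgM. Qed.

(** A double limit: [h] tends to infinity at fixed [e], then [e] to 0. The lower bound [g] may
    depend on [e]. *)
Lemma eventually_ge (f l : R -> R) (L : R) : l e @[e --> 0^'+] --> L ->
  (\forall e \near 0^'+, exists2 g : R -> R, g h @[h --> +oo] --> l e &
     \forall h \near +oo, g h <= f h) ->
  forall e : R, 0 < e -> \forall h \near +oo, L - e <= f h.
Proof.
move=> lL hg e e0; have e20 : 0 < e / 2 by rewrite divr_gt0.
have /cvgrPdist_le /(_ _ e20) near_l := lL.
near (0 : R)^'+ => x.
have hx : `|L - l x| <= e / 2 by near: x; exact: near_l.
have [g gl gf] : exists2 g : R -> R, g h @[h --> +oo] --> l x &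
     \forall h \near +oo, g h <= f h by near: x; exact: hg.
have /cvgrPdist_le /(_ _ e20) gl' := gl.
near=> h.
have h1 : g h <= f h by near: h; exact: gf.
have h2 : `|l x - g h| <= e / 2 by near: h; exact: gl'.
move: hx h2; rewrite !ler_norml => /andP[_ ?] /andP[_ ?]; lra.
Unshelve. all: by end_near. Qed.

Lemma eventually_le (f l : R -> R) (L : R) : l e @[e --> 0^'+] --> L ->
  (\forall e \near 0^'+, exists2 g : R -> R, g h @[h --> +oo] --> l e &
     \forall h \near +oo, f h <= g h) ->
  forall e : R, 0 < e -> \forall h \near +oo, f h <= L + e.
Proof.
move=> lL hg e e0.
have := @eventually_ge (fun h => - f h) (fun e => - l e) (- L).
have lN : - l e @[e --> 0^'+] --> - L by apply: cvgN.
move=> /(_ lN) h; have {}h := h _ e e0.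
apply: filterS (h _) => [x|]; first by rewrite -opprD lerN2.
apply: filterS hg => x [g gl gf]; exists (fun h => - g h); first exact: cvgN.
by apply: filterS gf => y; rewrite lerN2.
Qed.

Lemma cvg_of_bounds (f : R -> R) (L : R) :
  (forall e : R, 0 < e -> \forall h \near +oo, L - e <= f h) ->
  (forall e : R, 0 < e -> \forall h \near +oo, f h <= L + e) ->
  f h @[h --> +oo] --> L.
Proof.
move=> h1 h2; apply/cvgrPdist_le => e e0; near=> h.
have l1 : L - e <= f h by near: h; exact: h1.
have l2 : f h <= L + e by near: h; exact: h2.
by rewrite ler_norml; apply/andP; split; lra.
Unshelve. all: by end_near. Qed.

End asymptotic_bounds.

(** * Exceedance probabilities of first and second order *)

Section one_factor_model.
Context d (T : measurableType d) (R : realType) (P : probability T R).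
Variables (U : T -> R) (V : 'I_3 -> T -> R) (F : R -> R) (alpha a b c : R).
Local Notation pr := (pr P).
Hypothesis hU : symmetric_tail P F U.
Hypothesis hV : forall i, symmetric_tail P F (V i).
Hypothesis hind : forall (B0 : set R) (B : 'I_3 -> set R), measurable B0 ->
  (forall i, measurable (B i)) ->
  pr [set w | B0 (U w) /\ forall i, B i (V i w)] =
  pr [set w | B0 (U w)] * \prod_(i < 3) pr [set w | B i (V i w)].
Hypotheses (alpha0 : 0 < alpha) (a0 : 0 < a) (b0 : 0 < b).
Hypothesis hab : a `^ alpha + b `^ alpha = 1.
Hypothesis hF : x `^ alpha * F x @[x --> +oo] --> c.
Local Notation A := (a `^ alpha).
Local Notation B := (b `^ alpha).

Let i0 : 'I_3 := ord0.
Let i1 : 'I_3 := lift ord0 ord0.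
Let i2 : 'I_3 := ord_max.

Let mU : measurable_fun setT U. Proof. by case: hU. Qed.
Let mV i : measurable_fun setT (V i). Proof. by case: (hV i). Qed.

Definition gt_set (k x : R) : set R := [set u | x < k * u].
Definition lt_set (k x : R) : set R := [set u | k * u < x].
Definition mid_set (k x : R) : set R := [set u | - x < k * u <= x].
Definition le_set (k x : R) : set R := [set u | k * u <= x].

Lemma measurable_gt_set k x : measurable (gt_set k x).
Proof. by apply: measurable_gt; exact: measurable_funM. Qed.

Lemma measurable_lt_set k x : measurable (lt_set k x).
Proof. by apply: measurable_lt; exact: measurable_funM. Qed.

Lemma measurable_le_set k x : measurable (le_set k x).
Proof.
rewrite (_ : le_set k x = ~` gt_set k x).
  by apply: measurableC; exact: measurable_gt_set.
by apply/seteqP; split => u; rewrite /le_set /gt_set /= leNgt => /negP.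
Qed.

Lemma measurable_mid_set k x : measurable (mid_set k x).
Proof.
rewrite (_ : mid_set k x = gt_set k (- x) `&` le_set k x).
  by apply: measurableI; [exact: measurable_gt_set|exact: measurable_le_set].
by apply/seteqP; split => u; rewrite /mid_set /gt_set /le_set /= => /andP.
Qed.

Hint Resolve measurable_gt_set measurable_lt_set measurable_le_set measurable_mid_set : core.

Definition box (B0 B1 B2 B3 : set R) : set T :=
  [set w | [/\ B0 (U w), B1 (V i0 w), B2 (V i1 w) & B3 (V i2 w)]].

Let i2E : lift ord0 (lift ord0 ord0) = i2. Proof. exact/val_inj. Qed.

Let box_fun (B1 B2 B3 : set R) (i : 'I_3) : set R :=
  if i == i0 then B1 else if i == i1 then B2 else B3.

Lemma box_pr (B0 B1 B2 B3 : set R) :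
  measurable B0 -> measurable B1 -> measurable B2 -> measurable B3 ->
  pr (box B0 B1 B2 B3) = pr [set w | B0 (U w)] * pr [set w | B1 (V i0 w)] *
    pr [set w | B2 (V i1 w)] * pr [set w | B3 (V i2 w)].
Proof.
move=> m0 m1 m2 m3; have mB i : measurable (box_fun B1 B2 B3 i).
  by rewrite /box_fun; case: ifP => _ //; case: ifP.
have := hind m0 mB; rewrite !big_ord_recl big_ord0 mulr1 i2E /= !mulrA => <-.
congr pr; apply/seteqP; split => w /=.
  by move=> [h0 h1 h2 h3]; split => //; apply: ord3P.
move=> [h0 h]; split => //; [exact: (h i0)|exact: (h i1)|exact: (h i2)].
Qed.

Lemma measurable_box (B0 B1 B2 B3 : set R) :
  measurable B0 -> measurable B1 -> measurable B2 -> measurable B3 ->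
  measurable (box B0 B1 B2 B3).
Proof.
move=> m0 m1 m2 m3.
have mp (W : T -> R) (C : set R) : measurable_fun setT W -> measurable C -> measurable [set w | C (W w)].
  by move=> mW mC; rewrite -[X in measurable X]setTI; exact: mW.
rewrite (_ : box _ _ _ _ = [set w | B0 (U w)] `&` [set w | B1 (V i0 w)] `&`
    [set w | B2 (V i1 w)] `&` [set w | B3 (V i2 w)]).
  by repeat apply: measurableI; exact: mp.
by apply/seteqP; split => w /=; [move=> [? ? ? ?]|move=> [[[? ?] ?] ?]].
Qed.

Definition exceed (s : pred 'I_3) (h : R) : set T :=
  [set w | forall i, s i -> h < a * U w + b * V i w].

Lemma measurable_exceed s h : measurable (exceed s h).
Proof.
have mX i : measurable [set w | h < a * U w + b * V i w].
  by apply: measurable_gt; apply: measurable_funD; exact: measurable_funM.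
rewrite (_ : exceed s h = \bigcap_(i in setT) (if s i then
    [set w | h < a * U w + b * V i w] else setT)); last first.
  apply/seteqP; split => w /= hw i; last by move=> si; have := hw i Logic.I; rewrite si.
  by move=> _; have := hw i; case: ifP => // _; apply.
by apply: fin_bigcap_measurable => // i _; case: ifP.
Qed.

Let powR_1D (r : R) : (1 + e) `^ r @[e --> 0^'+] --> (1 : R).
Proof.
apply: powR_cvg1; rewrite -[X in _ --> X]addr0; apply: cvgD; first exact: cvg_cst.
by apply: cvg_at_right_filter; exact: cvg_id.
Qed.

Let powR_1B (r : R) : (1 - e) `^ r @[e --> 0^'+] --> (1 : R).
Proof.
apply: powR_cvg1; rewrite -[X in _ --> X]subr0; apply: cvgB; first exact: cvg_cst.
by apply: cvg_at_right_filter; exact: cvg_id.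
Qed.

Let prT1 (W : T -> R) : pr [set w | setT (W w)] = 1.
Proof. exact: prT. Qed.

(** A factor slightly above h suffices, when no individual term falls below -e h. *)
Lemma exceed3_ge (e : R) : 0 < e ->
  \forall h \near +oo, c * A - e <= h `^ alpha * pr (exceed predT h).
Proof.
move: e; apply: (eventually_ge (l := fun e => c * (A * (1 + e) `^ (- alpha)))).
  under eq_fun do rewrite mulrA.
  by apply: cvgM1; [exact: cvg_cst|exact: powR_1D].
near=> e; have e0 : 0 < e by near: e; exact: nbhs_right_gt.
exists (fun h => h `^ alpha * pr (box (gt_set a ((1 + e) * h)) (gt_set b (- (e * h)))
    (gt_set b (- (e * h))) (gt_set b (- (e * h))))).
  under eq_fun do rewrite box_pr // !mulrA.
  do 3 (apply: cvgM1; last exact: (gt_one_cvg alpha0 hF)).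
  by apply: (gt_tail_cvg hF) => //; lra.
near=> h; have h0 : 0 < h by near: h; exact: nbhs_pinfty_gt.
rewrite ler_wpM2l ?powR_ge0 //; apply: le_pr.
- exact: measurable_box.
- exact: measurable_exceed.
- move=> w [hw0 hw1 hw2 hw3] i _; rewrite /gt_set /= in hw0 hw1 hw2 hw3.
  have {}hw1 : - (e * h) < b * V i w.
    by move: i; apply: ord3P.
  rewrite mulrDl mul1r in hw0; lra.
Unshelve. all: by end_near. Qed.

Let mgt (W : T -> R) (k x : R) : measurable_fun setT W -> measurable [set w | x < k * W w].
Proof. by move=> mW; apply: measurable_gt; exact: measurable_funM. Qed.

(** Either summand may be the large one. Capping the factor at e h in the second box makes the two
    boxes disjoint, and the constants add up to c (A + B) = c. *)
Lemma exceed1_ge (e : R) : 0 < e ->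
  \forall h \near +oo, c - e <= h `^ alpha * pr (exceed (pred1 i0) h).
Proof.
move: e; apply: (eventually_ge (l := fun e => c * (A * (1 + e) `^ (- alpha)) + c * (B * (1 + e) `^ (- alpha)))).
  under eq_fun do rewrite -mulrDr -mulrDl hab mul1r.
  by apply: cvgM1; [exact: cvg_cst|exact: powR_1D].
near=> e; have e0 : 0 < e by near: e; exact: nbhs_right_gt.
have e1 : 0 < 1 + e by lra.
exists (fun h => h `^ alpha * (pr (box (gt_set a ((1 + e) * h)) (gt_set b (- (e * h))) setT setT) +
    pr (box (mid_set a (e * h)) (gt_set b ((1 + e) * h)) setT setT))).
  under eq_fun do rewrite !box_pr // !prT1 !mulr1 mulrDr !mulrA.
  apply: cvgD.
    by apply: cvgM1; [exact: (gt_tail_cvg hF)|exact: (gt_one_cvg alpha0 hF)].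
  under eq_fun do rewrite mulrAC.
  by apply: cvgM1; [exact: (gt_tail_cvg hF)|exact: (mid_one_cvg alpha0 hF)].
near=> h; have h0 : 0 < h by near: h; exact: nbhs_pinfty_gt.
rewrite ler_wpM2l ?powR_ge0 // -prU.
- apply: le_pr; [by apply: measurableU; exact: measurable_box|exact: measurable_exceed|].
  move=> w [] [hw0 hw1 _ _] i /= /eqP ->; rewrite /gt_set /mid_set /= in hw0 hw1.
    by rewrite mulrDl mul1r in hw0; lra.
  by move: hw0 => /andP[hw0 _]; rewrite mulrDl mul1r in hw1; lra.
- exact: measurable_box.
- exact: measurable_box.
- apply/seteqP; split => w //= [[hw0 _ _ _] [hw1 _ _ _]].
  rewrite /gt_set /mid_set /= in hw0 hw1; move: hw1 => /andP[_ hw1].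
  by rewrite mulrDl mul1r in hw0; lra.
Unshelve. all: by end_near. Qed.

Lemma box_vanish (k k' x x' : R) : 0 < k -> 0 < k' -> 0 < x -> 0 < x' ->
  forall W W' : T -> R, symmetric_tail P F W -> symmetric_tail P F W' ->
  h `^ alpha * (pr [set w | x * h < k * W w] * pr [set w | x' * h < k' * W' w])
    @[h --> +oo] --> (0 : R).
Proof.
move=> k0 k'0 x0 x'0 W W' hW hW'; under eq_fun do rewrite mulrA.
rewrite -(mulr0 (c * (k `^ alpha * x `^ (- alpha)))); apply: cvgM.
  exact: (gt_tail_cvg hF).
exact: (tail_vanish alpha0 (gt_tail_cvg hF hW' k'0 x'0)).
Qed.

(** If the factor stays below (1 - e) h then both individual terms exceed e h, which costs a second
    power of h^(-alpha). *)
Lemma exceed2_le (e : R) : 0 < e ->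
  \forall h \near +oo, h `^ alpha * pr (exceed (predC1 i2) h) <= c * A + e.
Proof.
move: e; apply: (eventually_le (l := fun e => c * (A * (1 - e) `^ (- alpha)) + 0)).
  under eq_fun do rewrite addr0 mulrA.
  by apply: cvgM1; [exact: cvg_cst|exact: powR_1B].
near=> e; have e0 : 0 < e by near: e; exact: nbhs_right_gt.
have e1 : 0 < 1 - e by rewrite subr_gt0; near: e; exact: nbhs_right_lt.
exists (fun h => h `^ alpha * (pr [set w | (1 - e) * h < a * U w] +
    pr (box setT (gt_set b (e * h)) (gt_set b (e * h)) setT))).
  under eq_fun do rewrite !box_pr // !prT1 mul1r mulr1 mulrDr.
  by apply: cvgD; [exact: (gt_tail_cvg hF)|exact: box_vanish].
near=> h; have h0 : 0 < h by near: h; exact: nbhs_pinfty_gt.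
rewrite ler_wpM2l ?powR_ge0 //.
have mbox := measurable_box measurableT (measurable_gt_set b (e * h)) (measurable_gt_set b (e * h)) measurableT.
apply: le_trans (prU_le P (mgt a ((1 - e) * h) mU) mbox).
apply: le_pr; [exact: measurable_exceed|by apply: measurableU => //; exact: mgt|].
move=> w hw; have h1 := hw i0 isT; have h2 := hw i1 isT.
have [hU'|hU'] := ltP ((1 - e) * h) (a * U w); first by left.
by right; split => //; rewrite /gt_set /=; rewrite mulrBl mul1r in hU'; lra.
Unshelve. all: by end_near. Qed.

Lemma exceed1_le (e : R) : 0 < e ->
  \forall h \near +oo, h `^ alpha * pr (exceed (pred1 i0) h) <= c + e.
Proof.
move: e; apply: (eventually_le (l := fun e => c * (A * (1 - e) `^ (- alpha)) +
    c * (B * (1 - e) `^ (- alpha)) + 0)).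
  under eq_fun do rewrite addr0 -mulrDr -mulrDl hab mul1r.
  by apply: cvgM1; [exact: cvg_cst|exact: powR_1B].
near=> e; have e0 : 0 < e by near: e; exact: nbhs_right_gt.
have e1 : 0 < 1 - e by rewrite subr_gt0; near: e; exact: nbhs_right_lt.
exists (fun h => h `^ alpha * (pr [set w | (1 - e) * h < a * U w] +
    pr [set w | (1 - e) * h < b * V i0 w] +
    pr (box (gt_set a (e * h)) (gt_set b (e * h)) setT setT))).
  under eq_fun do rewrite !box_pr // !prT1 !mulr1 !mulrDr.
  apply: cvgD; last exact: box_vanish.
  by apply: cvgD; exact: (gt_tail_cvg hF).
near=> h; have h0 : 0 < h by near: h; exact: nbhs_pinfty_gt.
rewrite ler_wpM2l ?powR_ge0 //.
have mbox := measurable_box (measurable_gt_set a (e * h)) (measurable_gt_set b (e * h)) measurableT measurableT.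
have m0 := mgt a ((1 - e) * h) mU; have m1 := mgt b ((1 - e) * h) (mV i0).
apply: le_trans (_ : pr (([set w | (1 - e) * h < a * U w] `|` [set w | (1 - e) * h < b * V i0 w]) `|`
   box (gt_set a (e * h)) (gt_set b (e * h)) setT setT) <= _); last first.
  apply: le_trans (prU_le P (measurableU _ _ m0 m1) mbox) _.
  by rewrite lerD2r; exact: prU_le.
apply: le_pr; [exact: measurable_exceed|by apply: measurableU => //; exact: measurableU|].
move=> w hw; have h1 := hw i0 (eqxx _).
have [hU'|hU'] := ltP ((1 - e) * h) (a * U w); first by left; left.
have [hV'|hV'] := ltP ((1 - e) * h) (b * V i0 w); first by left; right.
by right; split => //; rewrite /gt_set /=; rewrite mulrBl mul1r in hU' hV'; lra.
Unshelve. all: by end_near. Qed.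

Lemma exceed1_cvg : h `^ alpha * pr (exceed (pred1 i0) h) @[h --> +oo] --> c.
Proof. by apply: cvg_of_bounds; [exact: exceed1_ge|exact: exceed1_le]. Qed.

Let exceed_mono h : pr (exceed predT h) <= pr (exceed (predC1 i2) h).
Proof.
by apply: le_pr; [exact: measurable_exceed|exact: measurable_exceed|move=> w hw i _; exact: hw].
Qed.

Lemma exceed2_cvg : h `^ alpha * pr (exceed (predC1 i2) h) @[h --> +oo] --> c * A.
Proof.
apply: cvg_of_bounds => e e0; last exact: exceed2_le.
apply: filterS (exceed3_ge e0) => h /le_trans; apply.
by rewrite ler_wpM2l ?powR_ge0.
Qed.

Lemma exceed3_cvg : h `^ alpha * pr (exceed predT h) @[h --> +oo] --> c * A.
Proof.
apply: cvg_of_bounds => e e0; first exact: exceed3_ge.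
apply: filterS (exceed2_le e0) => h; apply: le_trans.
by rewrite ler_wpM2l ?powR_ge0.
Qed.

(** The value of a U / h at which v = (a U / h)^(-alpha) equals k / n: the cells cut at these levels
    all have asymptotic weight c A / n. *)
Definition cell_bound (n k : nat) : R := (k%:R / n%:R) `^ (- alpha^-1).

(** The integrand of I(alpha) at v = k / n. *)
Definition cell_exponent (n k : nat) : R := (cell_bound n k - 1) `^ (- alpha).

(** The point v = 0 stands for an infinite threshold, whereas [cell_bound n 0] is 0 by the
    convention on powers of 0: hence the separate empty case. *)
Let thr (n k : nat) (h : R) : set R :=
  if k is 0 then set0 else gt_set a (cell_bound n k * h).

Let cell (n k : nat) (h : R) : set R := thr n k.+1 h `\` thr n k h.

Lemma cell_bound_powR n k : (0 < k)%N -> (0 < n)%N ->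
  cell_bound n k `^ (- alpha) = k%:R / n%:R.
Proof.
move=> k0 n0; rewrite /cell_bound -powRrM mulrNN mulVf ?gt_eqF // powRr1 //.
Qed.

Lemma cell_bound_gt0 n k : (0 < k)%N -> (0 < n)%N -> 0 < cell_bound n k.
Proof. by move=> k0 n0; rewrite powR_gt0 // divr_gt0 // ltr0n. Qed.

Lemma cell_bound_le n j k : (0 < j)%N -> (0 < n)%N -> (j <= k)%N ->
  cell_bound n k <= cell_bound n j.
Proof.
move=> j0 n0 jk; have k0 : (0 < k)%N by exact: leq_trans jk.
have nR : 0 < n%:R :> R by rewrite ltr0n.
have jR : 0 < j%:R :> R by rewrite ltr0n.
have kR : 0 < k%:R :> R by rewrite ltr0n.
rewrite /cell_bound !powRN lef_pV2 ?posrE ?powR_gt0 ?divr_gt0 //.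
rewrite ge0_ler_powR ?nnegrE ?invr_ge0 ?(ltW alpha0) ?divr_ge0 //.
by rewrite ler_pM2r ?invr_gt0 // ler_nat.
Qed.

Lemma cell_bound_gt1 n k : (0 < k < n)%N -> 1 < cell_bound n k.
Proof.
move=> /andP[k0 kn]; have nR : 0 < n%:R :> R by rewrite ltr0n (ltn_trans k0).
have kR : 0 < k%:R :> R by rewrite ltr0n.
rewrite /cell_bound powRN invf_gt1 ?powR_gt0 ?divr_gt0 //.
have : (k%:R / n%:R) `^ alpha^-1 < (1 : R) `^ alpha^-1.
  rewrite gt0_ltr_powR ?nnegrE ?invr_gt0 ?divr_ge0 //.
  by rewrite ltr_pdivrMr // mul1r ltr_nat.
by rewrite powR1.
Qed.

Let measurable_thr n k h : measurable (thr n k h).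
Proof. by case: k => [|k] /=. Qed.

Let measurable_cell n k h : measurable (cell n k h).
Proof. exact: measurableD. Qed.

Hint Resolve measurable_cell : core.

Let mUset (C : set R) : measurable C -> measurable [set w | C (U w)].
Proof. by move=> mC; rewrite -[X in measurable X]setTI; exact: mU. Qed.

Let thr_cvg n k : (0 < n)%N ->
  h `^ alpha * pr [set w | thr n k h (U w)] @[h --> +oo] --> c * (A * (k%:R / n%:R)).
Proof.
move=> n0; case: k => [|k].
  rewrite mul0r !mulr0; apply: cvg_near_cst; apply: nearW => h.
  by rewrite (_ : [set _ | _] = set0) // /pr measure0 mulr0.
rewrite -(cell_bound_powR (ltn0Sn k) n0); apply: (gt_tail_cvg hF) => //.
exact: cell_bound_gt0.
Qed.

Let thr_mono n j k h : (0 < n)%N -> 0 < h -> (j <= k)%N -> thr n j h `<=` thr n k h.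
Proof.
move=> n0 h0; case: j => [|j] jk u //=; case: k jk => [//|k] jk /=.
by apply: le_lt_trans; rewrite ler_pM2r // cell_bound_le.
Qed.

Let cell_cvg n k : (0 < n)%N ->
  h `^ alpha * pr [set w | cell n k h (U w)] @[h --> +oo] --> c * (A * n%:R^-1).
Proof.
move=> n0; have nR : n%:R != 0 :> R by rewrite pnatr_eq0 -lt0n.
have -> : c * (A * n%:R^-1) = c * (A * (k.+1%:R / n%:R)) - c * (A * (k%:R / n%:R)).
  by rewrite -natr1; field.
apply: (@cvg_trans _ ((fun h => h `^ alpha * pr [set w | thr n k.+1 h (U w)] -
   h `^ alpha * pr [set w | thr n k h (U w)]) @ +oo)); last first.
  by apply: cvgB; exact: thr_cvg.
apply: near_eq_cvg; near=> h; have h0 : 0 < h by near: h; exact: nbhs_pinfty_gt.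
rewrite -mulrBr; congr (_ * _).
rewrite (_ : [set w | thr n k.+1 h (U w)] =
  [set w | cell n k h (U w)] `|` [set w | thr n k h (U w)]); last first.
  apply/seteqP; split => w /=.
    by have [|] := pselect (thr n k h (U w)); [right|left; split].
  by move=> [[]//|hw]; exact: (@thr_mono n k k.+1 h n0 h0 (leqnSn k) _ hw).
rewrite prU ?addrK //; [exact: mUset|exact: mUset|].
by apply/seteqP; split => w //= [[_ h1] h2].
Unshelve. all: by end_near. Qed.

Definition two_exceed (h : R) : set T := exceed (predC1 i2) h `\` exceed predT h.

Lemma measurable_two_exceed h : measurable (two_exceed h).
Proof. by apply: measurableD; exact: measurable_exceed. Qed.

Lemma two_exceedE h w : two_exceed h w <->
  [/\ h < a * U w + b * V i0 w, h < a * U w + b * V i1 w & a * U w + b * V i2 w <= h].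
Proof.
split=> [[h1 h2]|[h1 h2 h3]].
  have g0 := h1 i0 isT; have g1 := h1 i1 isT; split => //.
  by rewrite leNgt; apply/negP => g2; apply: h2 => i _; move: i; exact: ord3P.
split; first by apply: ord3P => // /eqP.
by move=> h4; have := h4 i2 isT; rewrite ltNge h3.
Qed.

Lemma pr_two_exceed h : pr (two_exceed h) = pr (exceed (predC1 i2) h) - pr (exceed predT h).
Proof.
have m2 := measurable_exceed predT h.
rewrite (_ : exceed (predC1 i2) h = two_exceed h `|` exceed predT h); last first.
  apply/seteqP; split => w.
    by move=> hw; have [|] := pselect (exceed predT h w); [right|left; split].
  by move=> [[]//|hw] i _; exact: hw.
rewrite prU ?addrK //; first exact: measurable_two_exceed.
by apply/seteqP; split => w //= [[_ h1] h2].
Qed.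

Let cell_box (n k : nat) (x h : R) : set T :=
  box (cell n k h) (gt_set b (- (x * h))) (gt_set b (- (x * h)))
    (lt_set b (- ((cell_bound n k - 1) * h))).

(** Disjoint boxes inside the event. In the cell [k] the third individual term is required to be
    below -(cell_bound n k - 1) h, which pulls X3 back for the largest factor of the cell, hence for
    all of them. *)
Lemma two_exceed_ge (n : nat) (e : R) : (2 <= n)%N -> 0 < e ->
  \forall h \near +oo,
    c ^+ 2 * (B ^+ 2 * (n.-1%:R / n%:R) ^+ 2 +
       A * B * \sum_(1 <= k < n.-1) n%:R^-1 * cell_exponent n k) - e <=
    h `^ alpha * h `^ alpha * pr (two_exceed h).
Proof.
move=> n2 e0; have n0 : (0 < n)%N by exact: ltnW.
have n1 : (0 < n.-1 < n)%N by case: n n2 {n0} => [//|[//|n]] _; rewrite /= ltnSn.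
have x1 := cell_bound_gt1 n1; set x := cell_bound n n.-1 in x1.
(* In the box of index 0, [dl <= x - 1] keeps the first two coordinates above h when a U is as low
   as -dl h, and [dl <= 1/2] keeps the third one at most h. *)
pose dl := Num.min (x - 1) 2^-1.
have dl0 : 0 < dl by rewrite lt_min subr_gt0 x1 invr_gt0 ltr0n.
have dlx : dl <= x - 1 by rewrite ge_min lexx.
have dlh : dl <= 2^-1 by rewrite ge_min lexx orbT.
(* The cell of index 0 is unbounded and is left out; its index is reused for the box with two large
   individual terms. *)
pose Bx k h := if k is 0
  then box (mid_set a (dl * h)) (gt_set b (x * h)) (gt_set b (x * h)) (le_set b (2^-1 * h))
  else cell_box n k (x - 1) h.
pose l k := if k is 0 then c ^+ 2 * (B ^+ 2 * (n.-1%:R / n%:R) ^+ 2)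
  else c ^+ 2 * (A * B * (n%:R^-1 * cell_exponent n k)).
have mBx h k : measurable (Bx k h) by case: k => [|k]; exact: measurable_box.
have xm0 : 0 < x - 1 by rewrite subr_gt0.
have x0 : 0 < x by lra.
have lim : \sum_(0 <= k < n.-1) h `^ alpha * h `^ alpha * pr (Bx k h) @[h --> +oo] -->
    \sum_(0 <= k < n.-1) l k.
  apply: cvg_sum_nat => -[|k] /andP[_ kn].
    have -> : l 0%N = c * (B * x `^ (- alpha)) * (c * (B * x `^ (- alpha))).
      rewrite /x cell_bound_powR //.
      by rewrite /l; ring.
    rewrite /Bx; under eq_fun do rewrite box_pr //.
    rewrite (_ : (fun h => _) = (fun h => (h `^ alpha * pr [set w | gt_set b (x * h) (V i0 w)]) *
      (h `^ alpha * pr [set w | gt_set b (x * h) (V i1 w)]) * pr [set w | mid_set a (dl * h) (U w)] *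
      pr [set w | le_set b (2^-1 * h) (V i2 w)])); last by apply/funext => h; ring.
    apply: cvgM1; last by apply: (le_one_cvg alpha0 hF) => //; rewrite invr_gt0.
    apply: cvgM1; last exact: (mid_one_cvg alpha0 hF).
    by apply: cvgM; exact: (gt_tail_cvg hF).
  have -> : l k.+1 = c * (A * n%:R^-1) * (c * (B * cell_exponent n k.+1)) by rewrite /l; ring.
  rewrite /Bx /cell_box; under eq_fun do rewrite box_pr //.
  rewrite (_ : (fun h => _) = (fun h => (h `^ alpha * pr [set w | cell n k.+1 h (U w)]) *
    (h `^ alpha * pr [set w | lt_set b (- ((cell_bound n k.+1 - 1) * h)) (V i2 w)]) *
    pr [set w | gt_set b (- ((x - 1) * h)) (V i0 w)] *
    pr [set w | gt_set b (- ((x - 1) * h)) (V i1 w)])); last by apply/funext => h; ring.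
  do 2 (apply: cvgM1; last exact: (gt_one_cvg alpha0 hF)).
  apply: cvgM; first exact: cell_cvg.
  apply: (lt_tail_cvg hF) => //; rewrite subr_gt0; apply: cell_bound_gt1 => /=.
  by apply: (leq_trans kn); exact: leq_pred.
have -> : c ^+ 2 * (B ^+ 2 * (n.-1%:R / n%:R) ^+ 2 +
    A * B * \sum_(1 <= k < n.-1) n%:R^-1 * cell_exponent n k) = \sum_(0 <= k < n.-1) l k.
  rewrite (big_ltn (m := 0)); last by case/andP: n1.
  rewrite mulrDr; congr (_ + _); rewrite mulrA mulr_sumr; apply: eq_big_nat => k /andP[k1 _].
  by case: k k1 => [//|k] _; rewrite /l; ring.
have /cvgrPdist_le /(_ _ e0) near_lim := lim.
near=> h; have h0 : 0 < h by near: h; exact: nbhs_pinfty_gt.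
have hl : `|\sum_(0 <= k < n.-1) l k - \sum_(0 <= k < n.-1) h `^ alpha * h `^ alpha * pr (Bx k h)| <= e.
  by near: h; exact: near_lim.
have sub : \sum_(0 <= k < n.-1) pr (Bx k h) <= pr (two_exceed h).
  apply: (sum_pr_le P (mBx h)); first exact: measurable_two_exceed.
    move=> [|k] kn w; rewrite /Bx /cell_box /box /= => -[hw0 hw1 hw2 hw3];
      apply/two_exceedE; rewrite /gt_set /mid_set /le_set /lt_set /= in hw0 hw1 hw2 hw3.
      move: hw0 => /andP[u1 u2].
      have d1 : dl * h <= x * h - h by rewrite -[X in _ - X]mul1r -mulrBl ler_pM2r.
      have d2 : dl * h <= 2^-1 * h by rewrite ler_pM2r.
      by split; lra.
    move: hw0 => [+ /negP]; rewrite -leNgt /gt_set /= => u1 u2.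
    have xk : x * h <= cell_bound n k.+2 * h by rewrite ler_pM2r // cell_bound_le.
    rewrite /thr /gt_set /= in u1.
    by split; lra.
  move=> j k jk kn; apply/seteqP; split => w //= [hj hk]; exfalso.
  case: k jk kn hk => [//|k] jk kn [[hk1 hk] _ _ _].
  case: j jk hj => [|j] jk [hj _ _ _]; last by case: hj => hj _; apply: hk; exact: (@thr_mono n j.+2 k.+1 h n0 h0 jk _ hj).
  move: hk1 hj; rewrite /thr /gt_set /mid_set /= => hk1 /andP[_ hj].
  have : dl * h <= (x - 1) * h by rewrite ler_pM2r.
  have : x * h <= cell_bound n k.+2 * h by rewrite ler_pM2r // cell_bound_le.
  by rewrite mulrBl mul1r; lra.
rewrite ler_norml in hl; case/andP: hl => _ hl.
apply: (@le_trans _ _ (\sum_(0 <= k < n.-1) h `^ alpha * h `^ alpha * pr (Bx k h))); first by lra.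
by rewrite -mulr_sumr ler_wpM2l // mulr_ge0 // powR_ge0.
Unshelve. all: by end_near. Qed.

Hypothesis alpha1 : alpha < 1.
Hypothesis tail_bound : exists2 C : R, 0 < C & forall x : R, 0 < x -> F x <= C * x `^ (- alpha).
Hypothesis local_bound : exists2 K : R, 0 < K & forall x z : R,
  0 < z -> pi * z <= x -> pr [set w | `|U w - x| <= z] <= K * z * x `^ (- alpha) / x.

Let around (h z : R) : set R := [set u | `|a * u - h| <= z].

Let measurable_around h z : measurable (around h z).
Proof.
rewrite (_ : around h z = (fun u => `|a * u - h|) @^-1` `]-oo, z]%classic).
  have mf : measurable_fun setT (fun u : R => `|a * u - h|).
    by apply: measurableT_comp => //; apply: measurable_funB.
  by rewrite -[X in measurable X]setTI; exact: mf.
by apply/seteqP; split => u /=; rewrite in_itv.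
Qed.

Hint Resolve measurable_around : core.

(* Dyadic layers z/2 < |aU - h| <= z: within a layer one of the independent
   variables V has to exceed z/2 in absolute value. *)
Lemma near_two_exceed_le : exists2 D : R, 0 < D & forall e h : R,
  0 < e -> pi * e <= 1 -> 0 < h ->
  h `^ alpha * h `^ alpha * pr (two_exceed h `&` [set w | around h (e * h) (U w)]) <=
    D * e `^ (1 - alpha).
Proof.
have [C C0 hC] := tail_bound; have [K K0 hK] := local_bound.
have mW h z : measurable (two_exceed h `&` [set w | around h z (U w)]).
  by apply: measurableI; [exact: measurable_two_exceed|exact: mUset].
have al1 : 0 < 1 - alpha by rewrite subr_gt0.
(* Halving z multiplies z^(1 - alpha) by [q]; since [alpha < 1], the layers form a convergent
   geometric series. *)
pose q : R := 2 `^ (- (1 - alpha)).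
have q1 : q < 1.
  rewrite /q powRN invf_lt1 ?powR_gt0 //.
  have : (1 : R) `^ (1 - alpha) < 2 `^ (1 - alpha) by rewrite gt0_ltr_powR ?nnegrE // ltr1n.
  by rewrite powR1.
pose K' := 2 * (K * A) * (C * (2 * b) `^ alpha).
have K'0 : 0 < K' by rewrite !mulr_gt0 // powR_gt0 // mulr_gt0.
have b20 : 0 < 2 * b by rewrite mulr_gt0.
have KA0 : 0 < K * A by rewrite mulr_gt0 // powR_gt0.
exists (K' / (1 - q)); first by rewrite divr_gt0 // subr_gt0.
move=> e h e0 pe h0; have ha0 : 0 < h `^ alpha by rewrite powR_gt0.
pose s := h `^ (- alpha) / h.
have s0 : 0 < s by rewrite divr_gt0 // powR_gt0.
have prU_around z : 0 < z -> pi * z <= h -> pr [set w | around h z (U w)] <= K * A * z * s.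
  move=> z0 zh; have := hK (h / a) (z / a); rewrite divr_gt0 // => /(_ isT).
  rewrite mulrA ler_pM2r ?invr_gt0 // => /(_ zh).
  rewrite powR_scaleN //.
  have -> : K * (z / a) * (A * h `^ (- alpha)) / (h / a) = K * A * z * s.
    by rewrite /s; field; rewrite !gt_eqF.
  apply: le_trans; rewrite le_eqVlt; apply/orP; left; apply/eqP; congr pr.
  apply/seteqP; split => w; rewrite /around /= => hw.
    have -> : U w - h / a = (a * U w - h) / a by field; rewrite gt_eqF.
    by rewrite normrM (gtr0_norm (_ : 0 < a^-1)) ?invr_gt0 // ler_pM2r // invr_gt0.
  have -> : a * U w - h = (U w - h / a) * a by field; rewrite gt_eqF.
  by rewrite normrM (gtr0_norm a0) -ler_pdivlMr.
pose r z := pr (two_exceed h `&` [set w | around h z (U w)]).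
(* A layer costs O(z h^(-alpha - 1)) for the factor, by [local_bound], times O(z^(-alpha)) for the
   individual term. *)
have step z : 0 < z -> pi * z <= h -> r z <= r (z / 2) + K' * z `^ (1 - alpha) * s.
  move=> z0 zh.
  (* Below h - z / 2 the first coordinate needs a large individual term; above h + z / 2 the third
     one needs a very negative one. *)
  pose b1 := box (around h z) (gt_set b (z / 2)) setT setT.
  pose b2 := box (around h z) setT setT (lt_set b (- (z / 2))).
  have m1 : measurable b1 by exact: measurable_box.
  have m2 : measurable b2 by exact: measurable_box.
  have sub : two_exceed h `&` [set w | around h z (U w)] `<=`
      two_exceed h `&` [set w | around h (z / 2) (U w)] `|` (b1 `|` b2).
    move=> w [hw hz]; have [hz2|hz2] := leP (`|a * U w - h|) (z / 2); first by left.
    right; have /two_exceedE [g0 _ g2] := hw.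
    move: hz2; rewrite ltr_normr => /orP[] hz2; [right|left]; split => //;
      rewrite /gt_set /lt_set /=; lra.
  apply: le_trans (le_pr _ _ _ sub) _ => //; first by apply: measurableU => //; exact: measurableU.
  apply: le_trans (prU_le P (mW h (z / 2)) (measurableU _ _ m1 m2)) _; rewrite lerD2l.
  apply: le_trans (prU_le P m1 m2) _.
  have tailV : F (z / 2 / b) <= C * (2 * b) `^ alpha * z `^ (- alpha).
    have zb0 : 0 < z / 2 / b by rewrite !divr_gt0.
    apply: le_trans (hC _ zb0) _; rewrite -[leRHS]mulrA -powR_scaleN //.
    by rewrite invfM mulrA.
  have F0 : 0 <= F (z / 2 / b).
    by have [_ <- _] := hV i0; exact: pr_ge0.
  have p1 : pr b1 <= K * A * z * s * (C * (2 * b) `^ alpha * z `^ (- alpha)).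
    rewrite box_pr // !prT1 !mulr1; apply: ler_pM; rewrite ?pr_ge0 ?prU_around //.
    apply: le_trans tailV; have [_ <- _] := hV i0.
    apply: le_pr; [exact: mgt|exact: measurable_gt|].
    by move=> w; rewrite /gt_set /= (ltr_pdivrMr _ _ b0) [_ * b]mulrC.
  have p2 : pr b2 <= K * A * z * s * (C * (2 * b) `^ alpha * z `^ (- alpha)).
    rewrite box_pr // !prT1 !mulr1; apply: ler_pM; rewrite ?pr_ge0 ?prU_around //.
    apply: le_trans tailV; have [_ _ <-] := hV i2.
    apply: le_pr; [by apply: measurable_lt; exact: measurable_funM|exact: measurable_lt|].
    by move=> w; rewrite /lt_set /= -[X in _ -> is_true (_ < X)]mulNr (ltr_pdivlMr _ _ b0) [_ * b]mulrC.
  apply: le_trans (lerD p1 p2) _.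
  have -> : z `^ (1 - alpha) = z * z `^ (- alpha).
    by rewrite powRD ?powRr1 ?(ltW z0) //; apply/implyP; rewrite gt_eqF.
  by rewrite /K' le_eqVlt; apply/orP; left; apply/eqP; ring.
pose g z := r z - K' / (1 - q) * z `^ (1 - alpha) * s.
have gstep z : 0 < z -> pi * z <= h -> g z <= g (z / 2).
  move=> z0 zh; rewrite /g; have := step z z0 zh.
  have -> : (z / 2) `^ (1 - alpha) = q * z `^ (1 - alpha).
    rewrite powRM ?(ltW z0) // mulrC /q; congr (_ * _).
    by rewrite -powR_inv1 // -powRrM mulN1r.
  have qn : 1 - q != 0 by rewrite gt_eqF // subr_gt0.
  have -> : K' * z `^ (1 - alpha) * s =
      K' / (1 - q) * z `^ (1 - alpha) * s - K' / (1 - q) * (q * z `^ (1 - alpha)) * s by field.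
  lra.
have pi0 := pi_gt0 R.
have eh0 : 0 < e * h by rewrite mulr_gt0.
have peh : pi * (e * h) <= h by rewrite mulrA ler_piMl // ltW.
(* After n halvings only the local bound at e h / 2^n is left, and it vanishes as n grows. *)
have gle n : g (e * h) <= K * A * (e * h) * s / 2 ^+ n.
  have zn0 m : 0 < e * h / 2 ^+ m by rewrite divr_gt0 // exprn_gt0.
  have zn1 m : pi * (e * h / 2 ^+ m) <= h.
    apply: le_trans peh; rewrite mulrA ler_piMr ?mulr_ge0 ?(ltW pi0) ?(ltW e0) ?(ltW h0) //.
    by rewrite invf_le1 ?exprn_gt0 // exprn_ege1 // ler1n.
  have gn : g (e * h) <= g (e * h / 2 ^+ n).
    elim: n => [|n IH]; first by rewrite expr0 divr1.
    apply: (le_trans IH); apply: le_trans (gstep _ (zn0 n) (zn1 n)) _.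
    by rewrite exprSr invfM mulrA.
  apply: (le_trans gn); rewrite /g.
  apply: (@le_trans _ _ (r (e * h / 2 ^+ n))).
    rewrite gerBl; apply: mulr_ge0; last exact: ltW.
    by apply: mulr_ge0; [rewrite ltW // divr_gt0 // subr_gt0|exact: powR_ge0].
  apply: le_trans (_ : pr [set w | around h (e * h / 2 ^+ n) (U w)] <= _).
    by apply: le_pr; [exact: mW|exact: mUset|move=> w []].
  by apply: le_trans (prU_around _ (zn0 n) (zn1 n)) _; rewrite mulrA mulrAC.
have g0 : g (e * h) <= 0.
  set M := K * A * (e * h) * s in gle.
  have M0 : 0 < M by rewrite /M mulr_gt0 // mulr_gt0.
  apply/ler_addgt0Pl => y y0; rewrite addr0.
  pose n := Num.truncn (M / y); apply: le_trans (gle n) _.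
  rewrite ler_pdivrMr ?exprn_gt0 // mulrC -ler_pdivrMr //; apply: ltW.
  apply: (@lt_le_trans _ _ n.+1%:R); first exact: truncnS_gt.
  by rewrite -natrX ler_nat ltn_expl.
have : r (e * h) <= K' / (1 - q) * (e * h) `^ (1 - alpha) * s by rewrite -subr_le0.
have haha : 0 < h `^ alpha * h `^ alpha by rewrite mulr_gt0.
move=> /(ler_wpM2l (ltW haha)) /le_trans; apply.
rewrite powRM ?(ltW e0) ?(ltW h0) // le_eqVlt; apply/orP; left; apply/eqP.
have -> : h `^ (1 - alpha) = h / h `^ alpha.
  by rewrite powRB ?powRr1 ?(ltW h0) //; apply/implyP; rewrite gt_eqF.
have alg (y1 y2 y3 y4 y5 : R) : y1 != 0 -> y4 != 0 -> y5 != 0 ->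
    y1 * y1 * (y3 / y4 * (y2 * (y5 / y1)) * (y1^-1 / y5)) = y3 / y4 * y2.
  by move=> n1 n4 n5; field; rewrite n1 n4 n5.
by rewrite /s powRN; apply: alg; rewrite gt_eqF // subr_gt0.
Qed.

Let thr_pos n m h : (0 < m)%N -> thr n m h = gt_set a (cell_bound n m * h).
Proof. by case: m. Qed.

Let thr_cell n m h u : thr n m h u -> exists2 k, (k < m)%N & cell n k h u.
Proof.
elim: m => [//|m IH] hm; have [h'|h'] := pselect (thr n m h u).
  by have [k km hk] := IH h'; exists k => //; exact: ltnW.
by exists m.
Qed.

(** [D] is fixed before [n], so that the contribution of factors close to h disappears as the mesh
    is refined. *)
Lemma two_exceed_le : exists2 D : R, 0 < D & forall (n : nat) (e : R),
  (2 <= n)%N -> pi * (cell_bound n n.-1 - 1) <= 1 -> 0 < e ->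
  \forall h \near +oo, h `^ alpha * h `^ alpha * pr (two_exceed h) <=
    c ^+ 2 * (B ^+ 2 * ((2 - cell_bound n n.-1) `^ (- alpha)) ^+ 2 +
       A * B * \sum_(1 <= k < n) n%:R^-1 * cell_exponent n k) +
    D * (cell_bound n n.-1 - 1) `^ (1 - alpha) + e.
Proof.
have [D D0 hD] := near_two_exceed_le; exists D => // n e n2 px e0.
have n0 : (0 < n)%N by exact: ltnW.
have n1 : (0 < n.-1 < n)%N by case: n n2 {n0 px} => [//|[//|n]] _; rewrite /= ltnSn.
have x1 := cell_bound_gt1 n1; set x := cell_bound n n.-1 in x1 px *.
pose ep := x - 1.
have ep0 : 0 < ep by rewrite subr_gt0.
have ep1 : ep < 1.
  apply: (@lt_le_trans _ _ (pi * ep)) => //.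
  by rewrite ltr_pMl // (lt_le_trans _ (pi_ge2 R)) // ltr1n.
have em0 : 0 < 1 - ep by rewrite subr_gt0.
have -> : 2 - x = 1 - ep by rewrite /ep; ring.
(* The factor is cut at the levels ep h, (1 - ep) h and x h. [E1] yields the term in B^2, [E2] needs
   three large variables and is negligible, [E3] is the layer around h, and [Bx] covers the rest. *)
pose E1 h := box (le_set a (ep * h)) (gt_set b ((1 - ep) * h)) (gt_set b ((1 - ep) * h)) setT.
pose E2 h := box (gt_set a (ep * h)) (gt_set b (ep * h)) (gt_set b (ep * h)) setT.
pose E3 h := two_exceed h `&` [set w | around h (ep * h) (U w)].
(* The lower end of the cell gives the weakest condition on the third individual term, valid
   throughout the cell; the lower bound used the upper end. *)
pose Bx h k := box (cell n k h) setT setT (lt_set b (- ((cell_bound n k.+1 - 1) * h))).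
have mE1 h : measurable (E1 h) by exact: measurable_box.
have mE2 h : measurable (E2 h) by exact: measurable_box.
have mE3 h : measurable (E3 h).
  by apply: measurableI; [exact: measurable_two_exceed|exact: mUset].
have mBx h k : measurable (Bx h k) by exact: measurable_box.
pose t (h : R) := h `^ alpha * h `^ alpha.
have lim1 : t h * pr (E1 h) @[h --> +oo] --> c ^+ 2 * (B ^+ 2 * ((1 - ep) `^ (- alpha)) ^+ 2).
  have -> : c ^+ 2 * (B ^+ 2 * ((1 - ep) `^ (- alpha)) ^+ 2) =
    c * (B * (1 - ep) `^ (- alpha)) * (c * (B * (1 - ep) `^ (- alpha))) by ring.
  rewrite /E1; under eq_fun do rewrite box_pr // prT1 mulr1.
  rewrite (_ : (fun h => _) = (fun h => (h `^ alpha * pr [set w | gt_set b ((1 - ep) * h) (V i0 w)]) *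
      (h `^ alpha * pr [set w | gt_set b ((1 - ep) * h) (V i1 w)]) *
      pr [set w | le_set a (ep * h) (U w)])); last by apply/funext => h; rewrite /t; ring.
  apply: cvgM1; last exact: (le_one_cvg alpha0 hF).
  by apply: cvgM; exact: (gt_tail_cvg hF).
have lim2 : t h * pr (E2 h) @[h --> +oo] --> (0 : R).
  rewrite /E2; under eq_fun do rewrite box_pr // prT1 mulr1.
  rewrite (_ : (fun h => _) = (fun h => (h `^ alpha * pr [set w | gt_set a (ep * h) (U w)]) *
      (h `^ alpha * (pr [set w | gt_set b (ep * h) (V i0 w)] *
      pr [set w | gt_set b (ep * h) (V i1 w)])))); last by apply/funext => h; rewrite /t; ring.
  rewrite -(mulr0 (c * (A * ep `^ (- alpha)))); apply: cvgM; first exact: (gt_tail_cvg hF).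
  exact: box_vanish.
have limB : \sum_(0 <= k < n.-1) t h * pr (Bx h k) @[h --> +oo] -->
    c ^+ 2 * (A * B * \sum_(1 <= k < n) n%:R^-1 * cell_exponent n k).
  have -> : c ^+ 2 * (A * B * \sum_(1 <= k < n) n%:R^-1 * cell_exponent n k) =
      \sum_(0 <= k < n.-1) c * (A * n%:R^-1) * (c * (B * cell_exponent n k.+1)).
    rewrite big_add1 !mulr_sumr; apply: eq_bigr => k _; ring.
  apply: cvg_sum_nat => k /andP[_ kn].
  rewrite /Bx; under eq_fun do rewrite box_pr // !prT1 !mulr1 mulrA.
  rewrite (_ : (fun h => _) = (fun h => (h `^ alpha * pr [set w | cell n k h (U w)]) *
      (h `^ alpha * pr [set w | lt_set b (- ((cell_bound n k.+1 - 1) * h)) (V i2 w)])));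
    last by apply/funext => h; rewrite /t; ring.
  apply: cvgM; first exact: cell_cvg.
  apply: (lt_tail_cvg hF) => //; rewrite subr_gt0; apply: cell_bound_gt1 => /=.
  by rewrite -ltn_predRL.
pose L := c ^+ 2 * (B ^+ 2 * ((1 - ep) `^ (- alpha)) ^+ 2) + 0 +
  c ^+ 2 * (A * B * \sum_(1 <= k < n) n%:R^-1 * cell_exponent n k).
have limS : t h * pr (E1 h) + t h * pr (E2 h) + \sum_(0 <= k < n.-1) t h * pr (Bx h k)
    @[h --> +oo] --> L by apply: cvgD; [exact: cvgD|exact: limB].
have /cvgrPdist_le /(_ _ e0) near_lim := limS.
near=> h; have h0 : 0 < h by near: h; exact: nbhs_pinfty_gt.
have t0 : 0 <= t h by rewrite mulr_ge0 // powR_ge0.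
have hl : `|L - (t h * pr (E1 h) + t h * pr (E2 h) + \sum_(0 <= k < n.-1) t h * pr (Bx h k))| <= e.
  by near: h; exact: near_lim.
have cover : two_exceed h `<=` ((E1 h `|` E2 h) `|` E3 h) `|`
    [set w | exists2 k, (k < n.-1)%N & Bx h k w].
  move=> w hw; have /two_exceedE [g0 g1 g2] := hw.
  have [u1|u1] := leP (a * U w) (ep * h).
    by left; left; left; split => //; rewrite /gt_set /= mulrBl mul1r; lra.
  have [u2|u2] := leP (a * U w) ((1 - ep) * h).
    left; left; right; split => //; rewrite /gt_set /=; rewrite mulrBl mul1r in u2; lra.
  have [u3|u3] := leP (a * U w) (x * h).
    left; right; split => //; rewrite /around /= ler_norml.
    by rewrite mulrBl mul1r in u2; rewrite /ep mulrBl mul1r in u2 *; apply/andP; split; lra.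
  right; have /thr_cell [k kn hk] : thr n n.-1 h (U w).
    by rewrite thr_pos //; case/andP: n1.
  exists k => //; split => //; case: hk => hk _; rewrite /thr /gt_set /= in hk.
  by rewrite /lt_set /= mulrBl mul1r; lra.
have prle : pr (two_exceed h) <= pr (E1 h) + pr (E2 h) + pr (E3 h) + \sum_(0 <= k < n.-1) pr (Bx h k).
  have mp := measurable_prefix (mBx h) n.-1.
  have m12 : measurable (E1 h `|` E2 h) by exact: measurableU.
  have m123 : measurable (E1 h `|` E2 h `|` E3 h) by exact: measurableU.
  apply: le_trans (le_pr P (measurable_two_exceed h) (measurableU _ _ m123 mp) cover) _.
  apply: le_trans (prU_le P m123 mp) _; apply: lerD; last exact: pr_prefix_le.
  apply: le_trans (prU_le P m12 (mE3 h)) _; rewrite lerD2r; exact: prU_le.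
have h3 : t h * pr (E3 h) <= D * ep `^ (1 - alpha) by exact: hD.
have {}prle := ler_wpM2l t0 prle.
rewrite !mulrDr mulr_sumr in prle.
move: hl prle; rewrite ler_norml -/(t h) /L => /andP[hl _] prle.
rewrite mulrDr; lra.
Unshelve. all: by end_near. Qed.

End one_factor_model.

(** * Riemann sums *)

Section riemann_sums.
Variable R : realType.
Implicit Types (th v w al : R).

(* A primitive of v / sqrt (1 - th v^2). *)
Definition arc_prim th v : R := (1 - Num.sqrt (1 - th * v ^+ 2)) / th.

(** Convexity of the primitive, whose graph lies above its tangent at v. With s and s' the two
    square roots it amounts to th v w + s s' <= 1, the Cauchy-Schwarz inequality for two unit
    vectors. *)
Lemma arc_prim_tangent th v w : 0 < th -> th * v ^+ 2 < 1 -> th * w ^+ 2 <= 1 ->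
  (w - v) * (v / Num.sqrt (1 - th * v ^+ 2)) <= arc_prim th w - arc_prim th v.
Proof.
move=> th0 hv hw; rewrite /arc_prim -mulrBl.
set s := Num.sqrt _; set s' := Num.sqrt (1 - th * w ^+ 2).
have s0 : 0 < s by rewrite sqrtr_gt0 subr_gt0.
have sE : s ^+ 2 = 1 - th * v ^+ 2 by rewrite sqr_sqrtr // subr_ge0 ltW.
have s'E : s' ^+ 2 = 1 - th * w ^+ 2 by rewrite sqr_sqrtr // subr_ge0.
rewrite mulrA ler_pdivrMr // mulrAC ler_pdivlMr //.
have h1 : 0 <= (s - s') ^+ 2 by exact: sqr_ge0.
have h2 : 0 <= th * (v - w) ^+ 2 by rewrite mulr_ge0 ?sqr_ge0 // ltW.
move: h1 h2 sE s'E; rewrite !expr2 => h1 h2 sE s'E; nra.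
Qed.

(** In this rationalised form the value at 1/2 is visibly increasing in [th]. *)
Lemma arc_prim_half th : 0 < th -> th <= 4 ->
  arc_prim th 2^-1 = 4^-1 / (1 + Num.sqrt (1 - th / 4)).
Proof.
move=> th0 th4; rewrite /arc_prim.
have -> : th * 2^-1 ^+ 2 = th / 4 by rewrite expr2; field.
set s := Num.sqrt _.
have s0 : 0 <= s by exact: sqrtr_ge0.
have sE : s ^+ 2 = 1 - th / 4 by rewrite sqr_sqrtr // subr_ge0 ler_pdivrMr // mul1r.
have s1 : 1 + s != 0 by rewrite gt_eqF // ltr_wpDr.
have th1 : th != 0 by rewrite gt_eqF.
apply/eqP; rewrite eqr_div //; apply/eqP.
have -> : (1 - s) * (1 + s) = 1 - s ^+ 2 by ring.
by rewrite sE; field.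
Qed.

Lemma arc_prim_half_lt th th' : 0 < th -> th < th' -> th' <= 4 ->
  arc_prim th 2^-1 < arc_prim th' 2^-1.
Proof.
move=> th0 tt th4; have th'0 := lt_trans th0 tt; have th4' := ltW (lt_le_trans tt th4).
rewrite (arc_prim_half th0 th4') (arc_prim_half th'0 th4).
have pos t : 0 < 1 + Num.sqrt t :> R by rewrite ltr_wpDr ?sqrtr_ge0.
rewrite ltr_pM2l ?invr_gt0 // ltf_pV2 ?posrE ?pos //.
by rewrite ltrD2l ltr_sqrt; lra.
Qed.

Definition tail_ratio al v : R := (v `^ (- al^-1) - 1) `^ (- al).

Lemma tail_ratioE al v : 0 < al -> 0 < v < 1 -> tail_ratio al v = v * (1 - v `^ al^-1) `^ (- al).
Proof.
move=> al0 /andP[v0 v1]; rewrite /tail_ratio (powRN v).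
have g0 : 0 < v `^ al^-1 by rewrite powR_gt0.
have g1 : v `^ al^-1 < 1.
  have : v `^ al^-1 < 1 `^ al^-1 by rewrite gt0_ltr_powR ?nnegrE ?invr_gt0 // ltW.
  by rewrite powR1.
have -> : (v `^ al^-1)^-1 - 1 = (v `^ al^-1)^-1 * (1 - v `^ al^-1).
  by rewrite mulrBr mulr1 mulVf // gt_eqF.
rewrite powRM ?invr_ge0 ?(ltW g0) // ?subr_ge0 ?(ltW g1) //; congr (_ * _).
by rewrite -powRN -powRrM mulrNN mulVf ?gt_eqF // powRr1 // ltW.
Qed.

(** Lowering the exponent from -1/2 to -al raises a power of the base 1 - v^(1/al), which lies below
    1; and that base is at most 1 - th v^2. *)
Lemma ratio_ge al th v : 2^-1 <= al -> 0 < v < 1 -> th * v ^+ 2 <= v `^ al^-1 ->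
  v / Num.sqrt (1 - th * v ^+ 2) <= tail_ratio al v.
Proof.
move=> al2 /andP[v0 v1] h; have al0 : 0 < al by apply: lt_le_trans al2; rewrite invr_gt0.
rewrite tail_ratioE ?v0 // ler_wpM2l ?(ltW v0) //.
have g0 : 0 < v `^ al^-1 by rewrite powR_gt0.
have g1 : v `^ al^-1 < 1.
  have : v `^ al^-1 < 1 `^ al^-1 by rewrite gt0_ltr_powR ?nnegrE ?invr_gt0 // ltW.
  by rewrite powR1.
have s0 : 0 < 1 - v `^ al^-1 by rewrite subr_gt0.
apply: (@le_trans _ _ ((1 - v `^ al^-1) `^ (- 2^-1))).
  rewrite powRN powR12_sqrt ?(ltW s0) // lef_pV2 ?posrE ?sqrtr_gt0 //; last by lra.
  by rewrite ler_sqrt; lra.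
by apply: ger_powR; [apply/andP; split; lra|rewrite lerN2].
Qed.

Lemma ratio_le al th v : 0 < al <= 2^-1 -> 0 < v < 1 -> v `^ al^-1 <= th * v ^+ 2 < 1 ->
  tail_ratio al v <= v / Num.sqrt (1 - th * v ^+ 2).
Proof.
move=> /andP[al0 al2] /andP[v0 v1] /andP[h h'].
rewrite tail_ratioE ?v0 // ler_wpM2l ?(ltW v0) //.
have g0 : 0 < v `^ al^-1 by rewrite powR_gt0.
have s0 : 0 < 1 - v `^ al^-1 by lra.
apply: (@le_trans _ _ ((1 - v `^ al^-1) `^ (- 2^-1))).
  by apply: ger_powR; [apply/andP; split; lra|rewrite lerN2].
rewrite powRN powR12_sqrt ?(ltW s0) // lef_pV2 ?posrE ?sqrtr_gt0 //; last by lra.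
by rewrite ler_sqrt; lra.
Qed.

(** The theta of the overview: theta v^2 = v^(1/al) at v = 1/2, so that on [0, 1/2] the two compare
    according to whether 1/al is below or above 2. *)
Definition half_scale al : R := 4 / 2 `^ al^-1.

Lemma half_scale_gt0 al : 0 < half_scale al.
Proof. by rewrite divr_gt0 // powR_gt0. Qed.

Lemma half_scale_lt4 al : 0 < al -> half_scale al < 4.
Proof.
move=> al0; rewrite /half_scale ltr_pdivrMr ?powR_gt0 // ltr_pMr //.
have : (1 : R) `^ al^-1 < 2 `^ al^-1 by rewrite gt0_ltr_powR ?nnegrE ?invr_gt0 // ltr1n.
by rewrite powR1.
Qed.

Let two_powR2 : (2 : R) `^ 2 = 4.
Proof. by rewrite (@powR_mulrn _ 2 2) // expr2; ring. Qed.

Lemma half_scale_gt1 al : 2^-1 < al -> 1 < half_scale al.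
Proof.
move=> al2; have al0 : 0 < al by apply: lt_trans al2; rewrite invr_gt0.
rewrite /half_scale ltr_pdivlMr ?powR_gt0 // mul1r -two_powR2 /powR pnatr_eq0 /=.
rewrite ltr_expR ltr_pM2r ?ln_gt0 ?ltr1n //.
by rewrite -[ltRHS]invrK ltf_pV2 ?posrE ?invr_gt0.
Qed.

Lemma half_scale_lt1 al : 0 < al < 2^-1 -> half_scale al < 1.
Proof.
move=> /andP[al0 al2].
rewrite /half_scale ltr_pdivrMr ?powR_gt0 // mul1r -two_powR2 /powR pnatr_eq0 /=.
rewrite ltr_expR ltr_pM2r ?ln_gt0 ?ltr1n //.
by rewrite -[ltLHS]invrK ltf_pV2 ?posrE ?invr_gt0.
Qed.

Let pow2E v : 0 <= v -> v `^ 2 = v ^+ 2.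
Proof. by move=> v0; rewrite (@powR_mulrn _ v 2). Qed.

Let theta_sqr al v : 0 <= v -> half_scale al * v ^+ 2 = (2 * v) `^ 2 / 2 `^ al^-1.
Proof. by move=> v0; rewrite pow2E ?mulr_ge0 // /half_scale; field; rewrite gt_eqF // powR_gt0. Qed.

Let theta_le al v : 2^-1 <= al -> 0 < v <= 2^-1 -> half_scale al * v ^+ 2 <= v `^ al^-1.
Proof.
move=> al2 /andP[v0 v2]; have al0 : 0 < al by apply: lt_le_trans al2; rewrite invr_gt0.
rewrite theta_sqr ?(ltW v0) // ler_pdivrMr ?powR_gt0 // mulrC -powRM ?(ltW v0) //.
apply: ger_powR; first by apply/andP; split; lra.
by rewrite -[leRHS]invrK lef_pV2 ?posrE ?invr_gt0.
Qed.

Let theta_ge al v : 0 < al <= 2^-1 -> 0 < v <= 2^-1 -> v `^ al^-1 <= half_scale al * v ^+ 2.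
Proof.
move=> /andP[al0 al2] /andP[v0 v2].
rewrite theta_sqr ?(ltW v0) // ler_pdivlMr ?powR_gt0 // mulrC -powRM ?(ltW v0) //.
apply: ger_powR; first by apply/andP; split; lra.
by rewrite -[leLHS]invrK lef_pV2 ?posrE ?invr_gt0.
Qed.

Let sqr_le_powR al v : 2^-1 <= al -> 0 < v <= 1 -> 1 * v ^+ 2 <= v `^ al^-1.
Proof.
move=> al2 /andP[v0 v1]; have al0 : 0 < al by apply: lt_le_trans al2; rewrite invr_gt0.
rewrite mul1r -pow2E ?(ltW v0) //; apply: ger_powR; first by rewrite v0.
by rewrite -[leRHS]invrK lef_pV2 ?posrE ?invr_gt0.
Qed.

Let powR_le_sqr al v : 0 < al <= 2^-1 -> 0 < v <= 1 -> v `^ al^-1 <= 1 * v ^+ 2.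
Proof.
move=> /andP[al0 al2] /andP[v0 v1].
rewrite mul1r -pow2E ?(ltW v0) //; apply: ger_powR; first by rewrite v0.
by rewrite -[leLHS]invrK lef_pV2 ?posrE ?invr_gt0.
Qed.

Variable m : nat.
(** An even number of cells, so that the change of comparison function at 1/2 falls on a node. *)
Let n : nat := (2 * m.+1)%N.
Let x (k : nat) : R := k%:R / n%:R.

Let nR : 0 < n%:R :> R. Proof. by rewrite ltr0n. Qed.

Let xS k : x k.+1 - x k = n%:R^-1.
Proof. by rewrite /x -mulrBl -natrB // subSnn mul1r. Qed.

Let x_gt0 k : (0 < k)%N -> 0 < x k.
Proof. by move=> k0; rewrite divr_gt0 // ltr0n. Qed.

Let x_ge0 k : 0 <= x k. Proof. by rewrite divr_ge0. Qed.

Let x_lt1 k : (k < n)%N -> x k < 1.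
Proof. by move=> kn; rewrite ltr_pdivrMr // mul1r ltr_nat. Qed.

Let x_half : x m.+1 = 2^-1.
Proof. by rewrite /x /n natrM invfM mulrCA divff ?mulr1 // pnatr_eq0. Qed.

Let x_le k j : (k <= j)%N -> x k <= x j.
Proof. by move=> kj; rewrite ler_pM2r ?invr_gt0 // ler_nat. Qed.

Let sq_lt1 v : 0 <= v -> v < 1 -> 1 * v ^+ 2 < 1.
Proof. by move=> v0 v1; rewrite mul1r exprn_ilt1. Qed.

Let theta_sq_lt1 al v : 0 < al -> 0 <= v <= 2^-1 -> half_scale al * v ^+ 2 < 1.
Proof.
move=> al0 /andP[v0 v2].
have h : v ^+ 2 <= 4^-1.
  have -> : 4^-1 = 2^-1 ^+ 2 :> R by rewrite expr2; field.
  by rewrite lerXn2r ?nnegrE // invr_ge0.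
have := half_scale_lt4 al0; have := half_scale_gt0 al.
move: (half_scale al) (v ^+ 2) h => t u h t0 t4; nra.
Qed.

(** Each term dominates the increment of the primitive over the cell on its left, and the increments
    telescope on each side of 1/2. *)
Lemma ratio_sum_ge al : 2^-1 < al -> (0 < m)%N ->
  arc_prim (half_scale al) 2^-1 - arc_prim 1 2^-1 + arc_prim 1 (x (2 * m)) <=
  \sum_(1 <= k < n.-1) n%:R^-1 * tail_ratio al (x k).
Proof.
move=> al2 m0; have al0 : 0 < al by apply: lt_trans al2; rewrite invr_gt0.
have low th k : 0 < th -> (k.+1 < n)%N -> th * x k.+1 ^+ 2 < 1 -> th * x k ^+ 2 <= 1 ->
    th * x k.+1 ^+ 2 <= x k.+1 `^ al^-1 ->
    arc_prim th (x k.+1) - arc_prim th (x k) <= n%:R^-1 * tail_ratio al (x k.+1).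
  move=> th0 kn h1 h2 h3; have := arc_prim_tangent th0 h1 h2.
  rewrite -(opprB (x k.+1)) xS mulNr => h4.
  have h5 : x k.+1 / Num.sqrt (1 - th * x k.+1 ^+ 2) <= tail_ratio al (x k.+1).
    by apply: ratio_ge => //; [exact: ltW|rewrite x_gt0 // x_lt1].
  have ni : 0 <= n%:R^-1 :> R by rewrite invr_ge0 ltW.
  have := ler_wpM2l ni h5; lra.
rewrite big_add1 /= (_ : n.-1.-1 = (2 * m)%N); last by rewrite /n mulnS.
have m1 : (m.+1 <= 2 * m)%N by lia.
rewrite (big_cat_nat (n := m.+1)) //=.
have x0 : x 0 = 0 by rewrite /x mul0r.
have s1 : arc_prim (half_scale al) 2^-1 <= \sum_(0 <= k < m.+1) n%:R^-1 * tail_ratio al (x k.+1).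
  have e0 : arc_prim (half_scale al) (x 0) = 0 by rewrite /arc_prim x0 expr0n mulr0 subr0 sqrtr1 subrr mul0r.
  rewrite -x_half -[leLHS]subr0 -[X in _ - X <= _]e0 -(telescope_sumr (fun k => arc_prim (half_scale al) (x k))) //.
  apply: ler_sum_nat => k /andP[_ km].
  have xk : x k.+1 <= 2^-1 by rewrite -x_half x_le.
  have xk' : x k <= 2^-1 by rewrite -x_half x_le // ltnW.
  apply: low => //.
  - exact: half_scale_gt0.
  - by rewrite /n; lia.
  - by rewrite theta_sq_lt1 // x_ge0.
  - by rewrite ltW // theta_sq_lt1 // x_ge0.
  - by apply: theta_le; [exact: ltW|rewrite x_gt0].
have s2 : arc_prim 1 (x (2 * m)) - arc_prim 1 2^-1 <=
    \sum_(m.+1 <= k < 2 * m) n%:R^-1 * tail_ratio al (x k.+1).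
  rewrite -x_half -(telescope_sumr (fun k => arc_prim 1 (x k))) //.
  apply: ler_sum_nat => k /andP[mk km].
  have kn : (k.+1 < n)%N by rewrite /n; lia.
  have kn' : (k < n)%N by exact: ltnW.
  apply: low => //.
  - by apply: sq_lt1; [exact: x_ge0|exact: x_lt1].
  - by apply/ltW/sq_lt1; [exact: x_ge0|exact: x_lt1].
  - by apply: sqr_le_powR; [exact: ltW|rewrite x_gt0 // ltW // x_lt1].
lra.
Qed.

(** Here each term is dominated by the increment over the cell on its right. The leading 1 is
    [arc_prim 1 1], that is I(1/2). *)
Lemma ratio_sum_le al : 0 < al < 2^-1 ->
  \sum_(1 <= k < n) n%:R^-1 * tail_ratio al (x k) <=
  1 - (arc_prim 1 2^-1 - arc_prim (half_scale al) 2^-1).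
Proof.
move=> /andP[al0 al2]; have al02 : 0 < al <= 2^-1 by rewrite al0 ltW.
have up th k : 0 < th -> (0 < k < n)%N -> th * x k ^+ 2 < 1 -> th * x k.+1 ^+ 2 <= 1 ->
    x k `^ al^-1 <= th * x k ^+ 2 ->
    n%:R^-1 * tail_ratio al (x k) <= arc_prim th (x k.+1) - arc_prim th (x k).
  move=> th0 /andP[k0 kn] h1 h2 h3; have := arc_prim_tangent th0 h1 h2.
  rewrite xS; apply: le_trans; rewrite ler_wpM2l ?invr_ge0 ?(ltW nR) //.
  by apply: ratio_le => //; [rewrite x_gt0 // x_lt1|rewrite h3].
have mn : (m.+1 <= n)%N by rewrite /n; lia.
rewrite (big_cat_nat (n := m.+1)) //=.
have s1 : \sum_(1 <= k < m.+1) n%:R^-1 * tail_ratio al (x k) <= arc_prim (half_scale al) 2^-1.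
  apply: (@le_trans _ _ (arc_prim (half_scale al) (x m.+1) - arc_prim (half_scale al) (x 1))); last first.
    rewrite x_half gerBl /arc_prim divr_ge0 ?(ltW (half_scale_gt0 al)) // subr_ge0.
    rewrite -[leRHS]sqrtr1 ler_sqrt // gerBl mulr_ge0 ?sqr_ge0 //; exact/ltW/half_scale_gt0.
  rewrite -(telescope_sumr (fun k => arc_prim (half_scale al) (x k))) //.
  apply: ler_sum_nat => k /andP[k1 km].
  have xk : x k.+1 <= 2^-1 by rewrite -x_half x_le.
  have xk' : x k <= 2^-1 by rewrite -x_half x_le // ltnW.
  apply: up => //.
  - exact: half_scale_gt0.
  - by rewrite k1 (leq_trans km).
  - by rewrite theta_sq_lt1 // x_ge0.
  - by rewrite ltW // theta_sq_lt1 // x_ge0.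
  - by apply: theta_ge => //; rewrite x_gt0.
have s2 : \sum_(m.+1 <= k < n) n%:R^-1 * tail_ratio al (x k) <= 1 - arc_prim 1 2^-1.
  have xn : x n = 1 by rewrite /x divff // gt_eqF.
  have an : arc_prim 1 (x n) = 1 by rewrite /arc_prim xn expr1n mulr1 subrr sqrtr0 subr0 divr1.
  rewrite -[X in _ <= X - _]an -x_half -(telescope_sumr (fun k => arc_prim 1 (x k))) //.
  apply: ler_sum_nat => k /andP[mk kn].
  have k0 : (0 < k)%N by exact: leq_trans mk.
  apply: up => //.
  - by rewrite k0.
  - by apply: sq_lt1; [exact: x_ge0|exact: x_lt1].
  - by rewrite mul1r exprn_ile1 // -xn x_le.
  - by apply: powR_le_sqr => //; rewrite x_gt0 // ltW // x_lt1.
lra.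
Qed.

End riemann_sums.

(** * Choice of the number of cells *)

Section choice_of_partition.
Variable R : realType.
Implicit Types (al A B c D : R).

Let harmonic_cvg (f : R -> R) (u : nat -> R) (l r : R) : (forall m, u m = f m.+1%:R^-1) ->
  f x @[x --> (0 : R)] --> l -> l = r -> u m @[m --> \oo] --> r.
Proof.
move=> uE fl <-; rewrite (_ : u = fun m => f (harmonic m)); last by apply/funext.
exact: (cvg_comp _ _ (@cvg_harmonic R) fl).
Qed.

Let last_cvg : (2 * m.+1).-1%:R / (2 * m.+1)%:R @[m --> \oo] --> (1 : R).
Proof.
apply: (@harmonic_cvg (fun x => 1 - x * 2^-1) _ (1 - 0 * 2^-1)).
- move=> m; rewrite -subn1 natrB; last by rewrite mulnS.
  by rewrite mulrBl divff ?pnatr_eq0 // natrM invfM mul1r [2^-1 * _]mulrC.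
- by apply: cvgB; [exact: cvg_cst|apply: cvgM; [exact: cvg_id|exact: cvg_cst]].
- by rewrite mul0r subr0.
Qed.

Let prelast_cvg : (2 * m)%:R / (2 * m.+1)%:R @[m --> \oo] --> (1 : R).
Proof.
apply: (@harmonic_cvg (fun x => 1 - x) _ (1 - 0)).
- move=> m; have -> : (2 * m)%:R = (2 * m.+1)%:R - 2 :> R by rewrite mulnS natrD addrC addKr.
  by rewrite mulrBl divff ?pnatr_eq0 // natrM invfM mulrA divff ?mul1r // pnatr_eq0.
- by apply: cvgB; [exact: cvg_cst|exact: cvg_id].
- by rewrite subr0.
Qed.

(** As the mesh is refined, the lower estimate of the right-hand side tends to B (A + B) + A B e0 =
    B + A B e0, where e0 > 0 is the gain made on [0, 1/2]. *)
Lemma exists_lower_sum al A B : 2^-1 < al -> 0 < A -> 0 < B -> A + B = 1 ->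
  exists2 n : nat, (2 <= n)%N &
    B < B ^+ 2 * (n.-1%:R / n%:R) ^+ 2 +
      A * B * \sum_(1 <= k < n.-1) n%:R^-1 * cell_exponent al n k.
Proof.
move=> al2 A0 B0 AB; have al0 : 0 < al by apply: lt_trans al2; rewrite invr_gt0.
pose e0 := arc_prim (half_scale al) 2^-1 - arc_prim 1 2^-1.
have e00 : 0 < e0.
  by rewrite subr_gt0 arc_prim_half_lt ?half_scale_gt1 // ltW // half_scale_lt4.
pose f (m : nat) := B ^+ 2 * ((2 * m.+1).-1%:R / (2 * m.+1)%:R) ^+ 2 +
  A * B * (e0 + arc_prim 1 ((2 * m)%:R / (2 * m.+1)%:R)) : R.
have lim : f m @[m --> \oo] --> B ^+ 2 * 1 ^+ 2 + A * B * (e0 + arc_prim 1 1).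
  apply: cvgD; apply: cvgM; [exact: cvg_cst| |exact: cvg_cst|].
    by rewrite expr2; under eq_fun do rewrite expr2; apply: cvgM; exact: last_cvg.
  apply: cvgD; first exact: cvg_cst.
  apply: cvgM; last exact: cvg_cst.
  apply: cvgB; first exact: cvg_cst.
  apply: continuous_cvg; first exact: sqrt_continuous.
  apply: cvgB; first exact: cvg_cst.
  apply: cvgM; first exact: cvg_cst.
  by rewrite expr2; under eq_fun do rewrite expr2; apply: cvgM; exact: prelast_cvg.
have a1 : arc_prim 1 1 = 1 :> R.
  by rewrite /arc_prim expr1n mulr1 subrr sqrtr0 subr0 divr1.
rewrite a1 in lim.
have Blt : B < B ^+ 2 * 1 ^+ 2 + A * B * (e0 + 1).
  have h : 0 < A * B * e0 by rewrite !mulr_gt0.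
  have -> : B ^+ 2 * 1 ^+ 2 + A * B * (e0 + 1) = B * (A + B) + A * B * e0 by ring.
  by rewrite AB mulr1 ltrDl.
near \oo => m.
have m0 : (0 < m)%N by near: m; exact: nbhs_infty_gt.
have fB : B < f m by near: m; exact: (cvgr_gt _ lim _ Blt).
exists (2 * m.+1)%N; first (by rewrite mulnS); apply: (lt_le_trans fB); rewrite /f lerD2l ler_wpM2l //.
  by rewrite mulr_ge0 // ltW.
exact: ratio_sum_ge.
Unshelve. all: by end_near. Qed.

Lemma cell_bound_last_cvg al : 0 < al ->
  cell_bound al (2 * m.+1) (2 * m.+1).-1 @[m --> \oo] --> (1 : R).
Proof. by move=> al0; apply: powR_cvg1; exact: last_cvg. Qed.

(** The last cell bound tends to 1, which removes the term in [D] and leaves the limit c^2 (B - A B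
    e0), with e0 > 0 the saving made on [0, 1/2]. *)
Lemma exists_upper_sum al A B c D : 0 < al < 2^-1 -> 0 < A -> 0 < B -> A + B = 1 ->
  0 < c -> 0 < D ->
  exists n : nat, [/\ (2 <= n)%N, pi * (cell_bound al n n.-1 - 1) <= 1 &
    c ^+ 2 * (B ^+ 2 * ((2 - cell_bound al n n.-1) `^ (- al)) ^+ 2 +
       A * B * \sum_(1 <= k < n) n%:R^-1 * cell_exponent al n k) +
    D * (cell_bound al n n.-1 - 1) `^ (1 - al) < c ^+ 2 * B].
Proof.
move=> /andP[al0 al2] A0 B0 AB c0 D0.
have al1 : 0 < 1 - al by lra.
pose e0 := arc_prim 1 2^-1 - arc_prim (half_scale al) 2^-1.
have e00 : 0 < e0.
  rewrite subr_gt0 arc_prim_half_lt ?half_scale_gt0 //; last by rewrite ler1n.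
  by apply: half_scale_lt1; rewrite al0.
pose x (m : nat) := cell_bound al (2 * m.+1) (2 * m.+1).-1.
have xc : x m @[m --> \oo] --> (1 : R) by exact: cell_bound_last_cvg.
have x1 m : 1 < x m.
  by apply: (cell_bound_gt1 al0); rewrite mulnS /= ltnSn.
pose f (m : nat) := c ^+ 2 * (B ^+ 2 * ((2 - x m) `^ (- al)) ^+ 2 + A * B * (1 - e0)) +
    D * (x m - 1) `^ (1 - al) : R.
have lim : f m @[m --> \oo] --> c ^+ 2 * (B ^+ 2 * 1 ^+ 2 + A * B * (1 - e0)) + D * 0.
  apply: cvgD; apply: cvgM; [exact: cvg_cst| |exact: cvg_cst|].
    apply: cvgD; last exact: cvg_cst.
    apply: cvgM; first exact: cvg_cst.
    have h : (2 - x m) `^ (- al) @[m --> \oo] --> (1 : R).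
      apply: powR_cvg1; have h : 2 - x m @[m --> \oo] --> (2 - 1 : R) by apply: cvgB; [exact: cvg_cst|].
      by move: h; rewrite (_ : 2 - 1 = 1 :> R) //; ring.
    by rewrite expr2; under eq_fun do rewrite expr2; apply: cvgM.
  have h0 : x m - 1 @[m --> \oo] --> (0 : R).
    by rewrite -(subrr 1); apply: cvgB; [exact: xc|exact: cvg_cst].
  apply/cvgrPdist_le => e epos.
  have /cvgrPdist_le /(_ _ epos) := powR_cvg0 (R := R) al1.
  move=> [r /= r0 hr].
  have /cvgrPdist_lt /(_ _ r0) := h0; apply: filterS => m hm.
  by apply: hr => //=; rewrite subr_gt0 x1.
have ltB : c ^+ 2 * (B ^+ 2 * 1 ^+ 2 + A * B * (1 - e0)) + D * 0 < c ^+ 2 * B.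
  have h : 0 < c ^+ 2 * (A * B * e0) by rewrite !mulr_gt0 // exprn_gt0.
  have -> : c ^+ 2 * (B ^+ 2 * 1 ^+ 2 + A * B * (1 - e0)) + D * 0 =
    c ^+ 2 * (B * (A + B)) - c ^+ 2 * (A * B * e0) by ring.
  by rewrite AB mulr1 gtrBl.
have pi0 := pi_gt0 R.
have x2 : 1 < 1 + pi^-1 :> R by rewrite ltrDl invr_gt0.
near \oo => m; have fB : f m < c ^+ 2 * B by near: m; exact: (cvgr_lt _ lim _ ltB).
have xm : x m < 1 + pi^-1 by near: m; exact: (cvgr_lt _ xc _ x2).
exists (2 * m.+1)%N; split.
- by rewrite mulnS.
- rewrite mulrC -ler_pdivlMr // mul1r; rewrite /x in xm; lra.
- apply: le_lt_trans fB; rewrite /f lerD2r ler_wpM2l ?sqr_ge0 // lerD2l.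
  rewrite ler_wpM2l ?mulr_ge0 ?(ltW A0) ?(ltW B0) //.
  by apply: ratio_sum_le; rewrite al0.
Unshelve. all: by end_near. Qed.

End choice_of_partition.

(** * Large thresholds *)

Section exchangeable_asymptotics.
Variables (R : realType) (alpha A B c : R) (u1 u2 u3 : R -> R).
Hypotheses (alpha0 : 0 < alpha) (A0 : 0 < A) (B0 : 0 < B) (c0 : 0 < c) (AB : A + B = 1).
Hypothesis h1 : h `^ alpha * u1 h @[h --> +oo] --> c.
Hypothesis h2 : h `^ alpha * u2 h @[h --> +oo] --> c * A.
Hypothesis h3 : h `^ alpha * u3 h @[h --> +oo] --> c * A.

Let BE : B = 1 - A. Proof. by rewrite -AB addrAC subrr add0r. Qed.

Let u1_cvg0 : u1 h @[h --> +oo] --> 0. Proof. exact: (tail_vanish alpha0 h1). Qed.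

Let two_cvg : h `^ alpha * (u2 h - u3 h) @[h --> +oo] --> 0.
Proof.
rewrite -(subrr (c * A)); under eq_fun do rewrite mulrBr.
by apply: cvgB.
Qed.

Let one_cvg : h `^ alpha * (u1 h - 2 * u2 h + u3 h) @[h --> +oo] --> c * B.
Proof.
have -> : c * B = c - 2 * (c * A) + c * A by rewrite BE; ring.
under eq_fun do rewrite mulrDr mulrBr mulrCA.
by apply: cvgD; [apply: cvgB; [|apply: cvgM; [exact: cvg_cst|]]|].
Qed.

Let powR2_gt0 : \forall h \near +oo, 0 < h `^ alpha :> R.
Proof. by near=> h; apply: powR_gt0; near: h; exact: nbhs_pinfty_gt. Unshelve. all: by end_near. Qed.

Lemma single_small : \forall h \near +oo, 0 < u1 h < 2^-1.
Proof.
have half0 : 0 < 2^-1 :> R by rewrite invr_gt0.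
near=> h; apply/andP; split; last by near: h; exact: (cvgr_lt _ u1_cvg0 _ half0).
have p0 : 0 < h `^ alpha by near: h; exact: powR2_gt0.
rewrite -(pmulr_rgt0 _ p0); near: h; exact: (cvgr_gt _ h1 _ c0).
Unshelve. all: by end_near. Qed.

(** The first and the third inequality are settled at order h^(-alpha), with limits -c B and -c A
    for left minus right; only the second one is decided at order h^(-2 alpha), by [L]. *)
Lemma eventually_admissible (L : R) : c ^+ 2 * B < L ->
  (\forall h \near +oo, L <= h `^ alpha * h `^ alpha * (u2 h - u3 h)) ->
  \forall h \near +oo,
    [/\ u2 h - u3 h <= u1 h - 2 * u2 h + u3 h,
        u1 h * (u1 h - 2 * u2 h + u3 h) <= (1 - u1 h) * (u2 h - u3 h) &
        3 * (u2 h - u3 h) * (1 - 2 * u1 h) + (u1 h - 2 * u2 h + u3 h - (u2 h - u3 h)) <=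
          u1 h * (1 - u1 h) * (1 - 2 * u1 h)].
Proof.
move=> cL hL.
pose p h : R := h `^ alpha; pose two h := u2 h - u3 h; pose one h := u1 h - 2 * u2 h + u3 h.
have lim1 : 1 - u1 h @[h --> +oo] --> (1 - 0 : R) by apply: cvgB; [exact: cvg_cst|].
have lim2 : 1 - 2 * u1 h @[h --> +oo] --> (1 - 2 * 0 : R).
  by apply: cvgB; [exact: cvg_cst|apply: cvgM; [exact: cvg_cst|]].
have limA : p h * two h - p h * one h @[h --> +oo] --> (0 - c * B : R) by apply: cvgB.
have limB : p h * u1 h * (p h * one h) - (1 - u1 h) * L @[h --> +oo] --> (c * (c * B) - (1 - 0) * L : R).
  by apply: cvgB; [apply: cvgM|apply: cvgM; [|exact: cvg_cst]].
have limC : 3 * (p h * two h) * (1 - 2 * u1 h) + (p h * one h - p h * two h) -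
      p h * u1 h * (1 - u1 h) * (1 - 2 * u1 h) @[h --> +oo] -->
    (3 * 0 * (1 - 2 * 0) + (c * B - 0) - c * (1 - 0) * (1 - 2 * 0) : R).
  apply: cvgB; last by apply: cvgM => //; apply: cvgM.
  apply: cvgD; last by apply: cvgB.
  by apply: cvgM => //; apply: cvgM; [exact: cvg_cst|].
have ltA : 0 - c * B < 0 by rewrite sub0r oppr_lt0 mulr_gt0.
have ltB : c * (c * B) - (1 - 0) * L < 0 by move: cL; rewrite expr2; lra.
have ltC : 3 * 0 * (1 - 2 * 0) + (c * B - 0) - c * (1 - 0) * (1 - 2 * 0) < 0.
  by rewrite BE; have := mulr_gt0 c0 A0; lra.
near=> h.
have p0 : 0 < p h by near: h; exact: powR2_gt0.
have hA : p h * two h - p h * one h < 0 by near: h; exact: (cvgr_lt _ limA _ ltA).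
have hB : p h * u1 h * (p h * one h) - (1 - u1 h) * L < 0 by near: h; exact: (cvgr_lt _ limB _ ltB).
have hC : 3 * (p h * two h) * (1 - 2 * u1 h) + (p h * one h - p h * two h) -
    p h * u1 h * (1 - u1 h) * (1 - 2 * u1 h) < 0 by near: h; exact: (cvgr_lt _ limC _ ltC).
have hL' : L <= p h * p h * two h by near: h; exact: hL.
have /andP[u0 ul] : 0 < u1 h < 2^-1 by near: h; exact: single_small.
rewrite -/(two h) -/(one h); split.
- by rewrite -(ler_pM2l p0) ltW // -subr_lt0.
- rewrite -(ler_pM2l (mulr_gt0 p0 p0)).
  have u1' : 0 <= 1 - u1 h by lra.
  have := ler_wpM2l u1' hL'; move: hB.
  rewrite (_ : p h * p h * (u1 h * one h) = p h * u1 h * (p h * one h)); last by ring.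
  rewrite (_ : p h * p h * ((1 - u1 h) * two h) = (1 - u1 h) * (p h * p h * two h)); last by ring.
  lra.
- rewrite -(ler_pM2l p0); move: hC.
  rewrite (_ : p h * (3 * two h * _ + _) =
    3 * (p h * two h) * (1 - 2 * u1 h) + (p h * one h - p h * two h)); last by ring.
  rewrite (_ : p h * (u1 h * _ * _) = p h * u1 h * (1 - u1 h) * (1 - 2 * u1 h)); last by ring.
  lra.
Unshelve. all: by end_near. Qed.

Lemma eventually_inadmissible (L : R) : L < c ^+ 2 * B ->
  (\forall h \near +oo, h `^ alpha * h `^ alpha * (u2 h - u3 h) <= L) ->
  \forall h \near +oo, (1 - u1 h) * (u2 h - u3 h) < u1 h * (u1 h - 2 * u2 h + u3 h).
Proof.
move=> Lc hL.
pose p h : R := h `^ alpha; pose two h := u2 h - u3 h; pose one h := u1 h - 2 * u2 h + u3 h.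
have lim : (1 - u1 h) * L - p h * u1 h * (p h * one h) @[h --> +oo] --> ((1 - 0) * L - c * (c * B) : R).
  apply: cvgB; last by apply: cvgM.
  by apply: cvgM; [apply: cvgB; [exact: cvg_cst|]|exact: cvg_cst].
have lt0 : (1 - 0) * L - c * (c * B) < 0 by move: Lc; rewrite expr2; lra.
near=> h.
have p0 : 0 < p h by near: h; exact: powR2_gt0.
have hB : (1 - u1 h) * L - p h * u1 h * (p h * one h) < 0 by near: h; exact: (cvgr_lt _ lim _ lt0).
have hL' : p h * p h * two h <= L by near: h; exact: hL.
have /andP[u0 ul] : 0 < u1 h < 2^-1 by near: h; exact: single_small.
rewrite -/(two h) -/(one h) -(ltr_pM2l (mulr_gt0 p0 p0)).
have u1' : 0 <= 1 - u1 h by lra.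
have := ler_wpM2l u1' hL'; move: hB.
rewrite (_ : p h * p h * (u1 h * one h) = p h * u1 h * (p h * one h)); last by ring.
rewrite (_ : p h * p h * ((1 - u1 h) * two h) = (1 - u1 h) * (p h * p h * two h)); last by ring.
lra.
Unshelve. all: by end_near. Qed.

End exchangeable_asymptotics.

(** * Random variables with a stable law *)

Section stable_random_variables.
Context d (T : measurableType d) (R : realType) (P : probability T R).

Lemma mean_distribution (V : {RV P >-> R}) (f : R -> R) : measurable_fun setT f ->
  bounded_measurable (fun w => f (V w)) ->
  Rintegral (distribution P V) setT f = mean P (fun w => f (V w)).
Proof.
move=> mf bf; rewrite /mean /Rintegral.
rewrite (@integral_distribution _ _ _ _ _ P V (EFin \o f)) //; first exact/measurable_EFinP.
exact: bm_integrable.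
Qed.

Lemma stable_mean (alpha : R) (V : {RV P >-> R}) :
  standard_symmetric_stable alpha (distribution P V) -> forall t,
  mean P (fun w => cos (t * V w)) = expR (- (`|t| `^ alpha)) /\
  mean P (fun w => sin (t * V w)) = 0.
Proof.
move=> hV t; have := hV t; rewrite /charfun => -[hc hs].
have mV : measurable_fun setT V by exact: measurable_funP.
have mt : measurable_fun setT (fun x : R => t * x) by exact: measurable_funM.
split; [rewrite -hc|rewrite -[RHS]hs]; rewrite (@mean_distribution V (fun x => _ (t * x))) //.
- exact: measurableT_comp (continuous_measurable_fun (@continuous_cos R)) mt.
- exact: bm_cos.
- exact: measurableT_comp (continuous_measurable_fun (@continuous_sin R)) mt.
- exact: bm_sin.
Qed.

(** Equality of characteristic functions transfers the right tail of [V] to [W], and symmetry gives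
    the left one: one function [F] then serves for all four variables. *)
Lemma stable_symmetric_tail (alpha : R) (V W : {RV P >-> R}) :
  standard_symmetric_stable alpha (distribution P V) ->
  standard_symmetric_stable alpha (distribution P W) ->
  symmetric_tail P (fun x => pr P [set w | x < V w]) W.
Proof.
move=> hV hW; have mV : measurable_fun setT V by exact: measurable_funP.
have mW : measurable_fun setT W by exact: measurable_funP.
have e x : pr P [set w | x < W w] = pr P [set w | x < V w].
  apply: same_trig_gt; split => // t.
    by rewrite (stable_mean hV t).1 (stable_mean hW t).1.
  by rewrite (stable_mean hV t).2 (stable_mean hW t).2.
split=> // x; rewrite -e; apply: stable_symmetric => // t.
exact: (stable_mean hW t).2.
Qed.

End stable_random_variables.

(** * Thresholds of the one-factor model *)

Section one_factor_threshold.
Context d (T : measurableType d) (R : realType) (P : probability T R).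
Variables (U : T -> R) (V X : 'I_3 -> T -> R) (F : R -> R) (a b : R).
Local Notation pr := (pr P).
Hypothesis hU : symmetric_tail P F U.
Hypothesis hV : forall i, symmetric_tail P F (V i).
Hypothesis hind : forall (B0 : set R) (B : 'I_3 -> set R), measurable B0 ->
  (forall i, measurable (B i)) ->
  pr [set w | B0 (U w) /\ forall i, B i (V i w)] =
  pr [set w | B0 (U w)] * \prod_(i < 3) pr [set w | B i (V i w)].
Hypotheses (a0 : 0 < a) (b0 : 0 < b).
Hypothesis hX : forall i w, X i w = a * U w + b * V i w.

Let select (s : pred 'I_3) (i : 'I_3) : option bool := if s i then Some true else None.

Let pattern_exceed (s : pred 'I_3) (h : R) :
  pattern (threshold X h) (select s ord0) (select s (lift ord0 ord0)) (select s ord_max) =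
  exceed U V a b s h.
Proof.
apply/seteqP; split => w.
  rewrite /pattern /coord_is /select /= => -[[q0 q1] q2].
  have {q0 q1 q2} : forall i, if s i then threshold X h i w = true else True.
    by apply: ord3P; [move: q0|move: q1|move: q2]; case: (s _).
  by move=> q i si; have := q i; rewrite si /threshold hX.
move=> q; rewrite /pattern /coord_is /select /threshold /=.
by do ![split]; case: ifP => // /q; rewrite hX.
Qed.

Lemma pr_pattern_one_factor (s s' : pred 'I_3) (h : R) : #|s| = #|s'| ->
  pr (pattern (threshold X h) (select s ord0) (select s (lift ord0 ord0)) (select s ord_max)) =
  pr (exceed U V a b s' h).
Proof.
move=> ss'; rewrite pattern_exceed; apply: (exchangeable_gt _ _ hind _ a0 b0) => //.
- by case: hU.
- by move=> i; case: (hV i).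
- by move=> i x; case: (hV i) => _ -> _.
Qed.

Lemma measurable_threshold h i : measurable [set w | threshold X h i w].
Proof.
rewrite (_ : [set w | _] = [set w | h < X i w]) //; apply: measurable_gt.
rewrite (_ : X i = fun w => a * U w + b * V i w); last by apply/funext.
have [mU _ _] := hU; have [mV _ _] := hV i.
by apply: measurable_funD; exact: measurable_funM.
Qed.

Let u1 h := pr (exceed U V a b (pred1 ord0) h).
Let u2 h := pr (exceed U V a b (predC1 ord_max) h).
Let u3 h := pr (exceed U V a b predT h).

Let single_pr h : [/\ pr (pattern (threshold X h) (Some true) None None) = u1 h,
  pr (pattern (threshold X h) None (Some true) None) = u1 h &
  pr (pattern (threshold X h) None None (Some true)) = u1 h].
Proof.
split; [apply: (@pr_pattern_one_factor (pred1 ord0))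
  |apply: (@pr_pattern_one_factor (pred1 (lift ord0 ord0)))
  |apply: (@pr_pattern_one_factor (pred1 ord_max))]; by rewrite !card1.
Qed.

Let pair_pr h : [/\ pr (pattern (threshold X h) (Some true) (Some true) None) = u2 h,
  pr (pattern (threshold X h) (Some true) None (Some true)) = u2 h &
  pr (pattern (threshold X h) None (Some true) (Some true)) = u2 h].
Proof.
split; [apply: (@pr_pattern_one_factor (predC1 ord_max))
  |apply: (@pr_pattern_one_factor (predC1 (lift ord0 ord0)))
  |apply: (@pr_pattern_one_factor (predC1 ord0))]; by rewrite !cardC1.
Qed.

Let triple_pr h : pr (pattern (threshold X h) (Some true) (Some true) (Some true)) = u3 h.
Proof. exact: (@pr_pattern_one_factor predT). Qed.

Lemma threshold_color_process h : 0 < u1 h < 2^-1 ->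
  [/\ u2 h - u3 h <= u1 h - 2 * u2 h + u3 h,
      u1 h * (u1 h - 2 * u2 h + u3 h) <= (1 - u1 h) * (u2 h - u3 h) &
      3 * (u2 h - u3 h) * (1 - 2 * u1 h) + (u1 h - 2 * u2 h + u3 h - (u2 h - u3 h)) <=
        u1 h * (1 - u1 h) * (1 - 2 * u1 h)] ->
  color_process P (threshold X h).
Proof.
move=> /andP[h0 hl] [h1 h2 h3].
exact: (exchangeable_color_process (measurable_threshold h) (single_pr h) (pair_pr h) (triple_pr h)).
Qed.

Lemma threshold_not_color_process h : 0 < u1 h < 2^-1 ->
  (1 - u1 h) * (u2 h - u3 h) < u1 h * (u1 h - 2 * u2 h + u3 h) ->
  ~ color_process P (threshold X h).
Proof.
move=> /andP[h0 hl] hlt hc; have [s0 s1 s2] := single_pr h; have [p0 p1 p2] := pair_pr h.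
have mY := measurable_threshold h.
have := color_process_pattern mY hc; rewrite s0 => /(_ (ltW hl)).
rewrite !(pattern_false0 P mY, pattern_false1 P mY, pattern_false2 P mY) s2 p0 p1 p2 triple_pr.
rewrite (_ : u1 h - u2 h - (u2 h - u3 h) = u1 h - 2 * u2 h + u3 h); last by ring.
by rewrite leNgt hlt.
Qed.

Variables (alpha c : R).
Hypotheses (alpha0 : 0 < alpha) (c0 : 0 < c) (hab : a `^ alpha + b `^ alpha = 1).
Hypothesis hF : x `^ alpha * F x @[x --> +oo] --> c.

Let A0 : 0 < a `^ alpha. Proof. exact: powR_gt0. Qed.
Let B0 : 0 < b `^ alpha. Proof. exact: powR_gt0. Qed.
Let cvg1 := exceed1_cvg hU hV hind alpha0 a0 b0 hab hF.
Let cvg2 := exceed2_cvg hU hV hind alpha0 a0 b0 hF.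
Let cvg3 := exceed3_cvg hU hV hind alpha0 a0 b0 hF.

Let exists_above (Q : R -> Prop) : (\forall h \near +oo, Q h) ->
  exists h0 : R, forall h, h0 < h -> Q h.
Proof. by move=> [M [_ hM]]; exists M. Qed.

Lemma eventually_color_process : 2^-1 < alpha ->
  exists h0 : R, forall h, h0 < h -> color_process P (threshold X h).
Proof.
move=> alpha2; apply: exists_above.
have [n n2 hn] := exists_lower_sum alpha2 A0 B0 hab.
(* Half of the gap is spent on the convergence in h, the other half keeps the inequality strict. *)
set s := _ + _ in hn; pose e := c ^+ 2 * (s - b `^ alpha) / 2.
have c20 : 0 < c ^+ 2 by exact: exprn_gt0.
have e0 : 0 < e by rewrite divr_gt0 // mulr_gt0 // subr_gt0.
have ge := two_exceed_ge hU hV hind alpha0 a0 b0 hF n2 e0.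
have lt : c ^+ 2 * b `^ alpha < c ^+ 2 * s - e.
  have : 0 < c ^+ 2 * (s - b `^ alpha) by rewrite mulr_gt0 // subr_gt0.
  by rewrite /e; lra.
have adm : \forall h \near +oo, c ^+ 2 * s - e <= h `^ alpha * h `^ alpha * (u2 h - u3 h).
  by apply: filterS ge => h; rewrite (pr_two_exceed a b hU hV).
have := eventually_admissible alpha0 A0 B0 c0 hab cvg1 cvg2 cvg3 lt adm.
apply: filterS2 (single_small alpha0 c0 cvg1) => h h1 h2; exact: threshold_color_process.
Qed.

Lemma eventually_not_color_process : alpha < 2^-1 ->
  (exists2 C : R, 0 < C & forall x, 0 < x -> F x <= C * x `^ (- alpha)) ->
  (exists2 K : R, 0 < K & forall x z, 0 < z -> pi * z <= x ->
     pr [set w | `|U w - x| <= z] <= K * z * x `^ (- alpha) / x) ->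
  exists h0 : R, forall h, h0 < h -> ~ color_process P (threshold X h).
Proof.
move=> alpha2 tail_bound local_bound; apply: exists_above.
have alpha1 : alpha < 1 by lra.
have [D D0 le] := two_exceed_le hU hV hind alpha0 a0 b0 hF alpha1 tail_bound local_bound.
have alpha02 : 0 < alpha < 2^-1 by rewrite alpha0.
have [n [n2 npi hn]] := exists_upper_sum alpha02 A0 B0 hab c0 D0.
set s := _ + _ in hn; pose e := (c ^+ 2 * b `^ alpha - s) / 2.
have e0 : 0 < e by rewrite divr_gt0 // subr_gt0.
have lt : s + e < c ^+ 2 * b `^ alpha by rewrite /e; lra.
have inadm : \forall h \near +oo, h `^ alpha * h `^ alpha * (u2 h - u3 h) <= s + e.
  by apply: filterS (le n e n2 npi e0) => h; rewrite (pr_two_exceed a b hU hV).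
have := eventually_inadmissible alpha0 c0 hab cvg1 cvg2 cvg3 lt inadm.
apply: filterS2 (single_small alpha0 c0 cvg1) => h h1 h2; exact: threshold_not_color_process.
Qed.

End one_factor_threshold.

Theorem theorem1p9 (R : realType) (d : measure_display) (T : measurableType d)
    (P : probability T R) (alpha a : R) (S : 'I_4 -> {RV P >-> R})
    (X : 'I_3 -> T -> R)
    (halpha : 0 < alpha < 2) (ha : 0 < a < 1)
    (hlaw : forall k, standard_symmetric_stable alpha (distribution P (S k)))
    (hind : mutually_independent S)
    (hX : forall i w, X i w =
       a * S ord0 w + (1 - a `^ alpha) `^ alpha^-1 * S (lift ord0 i) w) :
  (2^-1 < alpha ->
     exists h0 : R, forall h : R, h0 < h -> color_process P (threshold X h)) /\
  (alpha < 2^-1 ->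
     exists h0 : R, forall h : R, h0 < h -> ~ color_process P (threshold X h)).
Proof.
have /andP[alpha0 _] := halpha; have /andP[a0 a1] := ha.
have mU : measurable_fun setT (S ord0) by exact: measurable_funP.
have hcos t := (stable_mean (hlaw ord0) t).1.
have hsin t := (stable_mean (hlaw ord0) t).2.
have hS k := stable_symmetric_tail (hlaw ord0) (hlaw k).
have hV i := hS (lift ord0 i).
have hin (B0 : set R) (B : 'I_3 -> set R) (mB0 : measurable B0) (mB : forall i, measurable (B i)) :=
  mutually_independent_pr hind mB0 mB.
have [c c0 hc] := stable_tail_cvg halpha mU hcos hsin.
have A1 : a `^ alpha < 1.
  have : a `^ alpha < 1 `^ alpha by rewrite gt0_ltr_powR ?nnegrE // ltW.
  by rewrite powR1.
have b0 : 0 < (1 - a `^ alpha) `^ alpha^-1 by rewrite powR_gt0 // subr_gt0.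
have hab : a `^ alpha + ((1 - a `^ alpha) `^ alpha^-1) `^ alpha = 1.
  by rewrite -powRrM mulVf ?gt_eqF // powRr1 ?subr_ge0 ?ltW // addrC subrK.
split=> alpha2.
  exact: (eventually_color_process (hS ord0) hV hin a0 b0 hX alpha0 c0 hab hc).
apply: (eventually_not_color_process (hS ord0) hV hin a0 b0 hX alpha0 c0 hab hc) => //.
  exact: (stable_tail_le halpha mU hcos hsin).
apply: (stable_local_bound _ mU hcos); rewrite alpha0 ltW //; lra.
Qed.
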